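(* Let $\mathbf{X}$ be a random vector in $\mathbb{R}^d$ and $Y$ a real random variable defined on the same probability space, and let $(\mathbf{X}_1,Y_1),(\mathbf{X}_2,Y_2),\ldots$ be independent copies of $(\mathbf{X},Y)$. Assume that $Y$ is not almost surely equal to a measurable function of $\mathbf{X}$. Then the rank-based Azadkia--Chatterjee correlation coefficient $\xi_n$ converges in probability, as $n\to\infty$, to $$\xi=\xi(\mathbf{X},Y)=\frac{\int \operatorname{Var}\{\mathbb{E}[\mathbf{1}(Y\ge y)\mid \mathbf{X}]\}\,dF(y)}{\int \operatorname{Var}\{\mathbf{1}(Y\ge y)\}\,dF(y)},$$ where $F$ is the cumulative distribution function of $Y$.
   Context: Based on the first $n$ pairs: $F_n(y)=\frac1n\sum_{i=1}^n \mathbf{1}(Y_i\le y)$, $G_n(y)=\frac1n\sum_{i=1}^n\mathbf{1}(Y_i\ge y)$, and for $\mathbf{x}=(x_1,\dots,x_d)^\top\in\mathbb{R}^d$, $\mathbf{F}_n(\mathbf{x})=(F_{n,1}(\mathbf{x}),\ldots,F_{n,d}(\mathbf{x}))^\top$ with $F_{n,j}(\mathbf{x})=\frac1n\sum_{k=1}^n\mathbf{1}(X_{k,j}\le x_j)$ (marginal empirical CDFs), where $\mathbf{X}_k=(X_{k,1},\dots,X_{k,d})^\top$. For $i\in\{1,\dots,n\}$, $N(i)$ (depending on $n$) is the index $j\neq i$ of the nearest neighbor of $\mathbf{F}_n(\mathbf{X}_i)$ among $\{\mathbf{F}_n(\mathbf{X}_j): 1\le j\le n,\ j\ne i\}$ in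 Euclidean norm, with ties broken uniformly at random using independent draws $U_i\sim\mathrm{Uniform}[0,1]$ that are also independent of the data (the draw $U_i$ is used to choose uniformly among the nearest-neighbor candidates of $i$). The rank-based Azadkia--Chatterjee correlation coefficient is $$\xi_n=\frac{\sum_{i=1}^n\{F_n(Y_i)\wedge F_n(Y_{N(i)})-G_n(Y_i)^2\}}{\sum_{i=1}^n G_n(Y_i)(1-G_n(Y_i))},$$ where $\wedge$ denotes the minimum. No continuity assumption is made on $\mathbf{X}$ or $Y$. *)

(* Defs.v *)
From HB Require Import structures.
From mathcomp Require Import all_boot all_order all_algebra.
From mathcomp Require Import all_classical all_reals all_analysis.

Set Implicit Arguments.
Unset Strict Implicit.
Unset Printing Implicit Defensive.

Import Order.TTheory GRing.Theory Num.Theory.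
Import numFieldNormedType.Exports.

Local Open Scope classical_set_scope.
Local Open Scope ring_scope.

Section Statistic.
Context {R : realType}.

Definition ecdf n (y : 'I_n -> R) (t : R) : R :=
  n%:R^-1 * \sum_(i < n) (y i <= t)%R%:R.

Definition esurv n (y : 'I_n -> R) (t : R) : R :=
  n%:R^-1 * \sum_(i < n) (t <= y i)%R%:R.

Definition ecdf_vec d n (x : 'I_n -> d.-tuple R) (v : d.-tuple R) : d.-tuple R :=
  [tuple ecdf (fun k => tnth (x k) j) (tnth v j) | j < d].

(* Not the norm of 'rV[R]_d, which is the maximum norm. *)
Definition euclid_dist d (a b : d.-tuple R) : R :=
  Num.sqrt (\sum_(j < d) (tnth a j - tnth b j) ^+ 2).

Definition nn_candidates d n (z : 'I_n -> d.-tuple R) (i : 'I_n) : seq 'I_n :=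
  [seq j <- enum 'I_n | (j != i) &&
    [forall k, (k != i) ==>
      (euclid_dist (z i) (z j) <= euclid_dist (z i) (z k))]].

(* If there are m candidates, the one selected by u is the candidate of rank
   floor(u m), which is uniform when u is uniform on [0, 1]; minn only matters
   when u = 1.  The default i is only reached if n = 1: otherwise m > 0. *)
Definition nn d n (z : 'I_n -> d.-tuple R) (u : 'I_n -> R) (i : 'I_n) : 'I_n :=
  let s := nn_candidates z i in
  nth i s (minn (Num.truncn (u i * (size s)%:R)) (size s).-1).

Definition xi_stat d n (x : 'I_n -> d.-tuple R) (y u : 'I_n -> R) : R :=
  let N := nn (fun k => ecdf_vec x (x k)) u in
  (\sum_(i < n) (Num.min (ecdf y (y i)) (ecdf y (y (N i)))
                 - esurv y (y i) ^+ 2))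
  / (\sum_(i < n) esurv y (y i) * (1 - esurv y (y i))).

End Statistic.

Section Probability.
Context {R : realType} {dT : measure_display} {T : measurableType dT}.
Variable P : probability T R.

Definition mutually_independent (I : eqType) (G : I -> set (set T)) : Prop :=
  forall (s : seq I) (A : I -> set T), uniq s ->
    (forall i, i \in s -> G i (A i)) ->
    P (\big[setI/setT]_(i <- s) A i) = (\prod_(i <- s) P (A i))%E.

Definition cvg_in_probability (Z : nat -> T -> R) (c : R) : Prop :=
  forall eps : R, 0 < eps ->
    P [set w | eps < `|Z n w - c|] @[n --> \oo] --> 0%E.

Definition is_cond_exp {dE : measure_display} {E : measurableType dE}
    (X : T -> E) (f g : T -> R) : Prop :=
  [/\ measurable_fun [set: g_sigma_algebra_preimageType X] g,
      P.-integrable [set: T] (EFin \o g)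
    & forall A, g_sigma_algebra_preimage X A ->
        (\int[P]_(w in A) (g w)%:E = \int[P]_(w in A) (f w)%:E)%E].

(* A version of E[f | X]; when X is measurable and f is integrable, one exists
   and any two of them are almost surely equal. *)
Definition cond_exp {dE : measure_display} {E : measurableType dE}
    (X : T -> E) (f : T -> R) : T -> R :=
  xget (cst 0) [set g | is_cond_exp X f g].

(* The integrals dF(y) are with respect to the law of Y, which is the
   Lebesgue-Stieltjes measure of F (see lebesgue_stieltjes_cdf_id). *)
Definition xi {d : nat} (X : {RV P >-> d.-tuple R}) (Y : {RV P >-> R}) : R :=
  let ind y : T -> R := \1_[set w | y <= Y w] in
  fine (\int[distribution P Y]_y 'V_P[cond_exp X (ind y)])%E
  / fine (\int[distribution P Y]_y 'V_P[ind y])%E.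

End Probability.

(* Main.v *)
(** Put F_n(Y_i) /\ F_n(Y_j) = 1/n sum_k 1(Y_i >= Y_k) 1(Y_j >= Y_k): the
    numerator of xi_n is an average over the thresholds y = Y_k of
    Q_n(y) - G_n(y)^2, where Q_n(y) = 1/n sum_i 1(Y_i >= y) 1(Y_N(i) >= y).
    All quantities are monotone in y, so it suffices to prove, for a fixed Borel
    set S, that 1/n sum_i 1_S(Y_i) 1_S(Y_N(i)) tends to E[g(X)^2] in L^1, where
    g(x) = P(Y in S | X = x); finitely many sets S then bracket all half-lines.

    - Given the X_i and the U_i the neighbours are fixed and the noises
      1_S(Y_i) - g(X_i) are independent and centred.  Hence 1_S(Y_i) 1_S(Y_N(i))
      may be replaced by g(X_i) g(X_N(i)), at a cost in L^2 that is controlled by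
      the number of pairs (i, i') with overlapping {i, N(i)} and {i', N(i')}.
    - Stone's lemma: averaging over the tie-breaking, each point is the neighbour
      of at most C_d others.  So the law of X_N(i) is at most C_d times that of X
      on average, and the overlaps above number O(n).
    - The Borel sets A such that X_i and X_N(i) are rarely separated by A form a
      sigma-algebra, by Stone's lemma.  It contains the half-spaces {x_j <= a}:
      most points have a neighbour within rank distance e, and if such a pair is
      separated by a, then the upper point is among the at most n e points whose
      j-th coordinate is next above a.
      Hence g(X_N(i)) is close to g(X_i), and the law of large numbers concludes. *)

Require Import Defs.
From HB Require Import structures.
From mathcomp Require Import all_boot all_order all_algebra.
From mathcomp Require Import all_classical all_reals all_analysis.
From mathcomp Require Import measurable_realfun ring lra.

Set Implicit Arguments.
Unset Strict Implicit.
Unset Printing Implicit Defensive.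

Import Order.TTheory GRing.Theory Num.Theory.
Import numFieldNormedType.Exports.

Local Open Scope classical_set_scope.
Local Open Scope ring_scope.

(** * Vanishing sequences and bounded random variables *)

(** Ranks jump at atoms and distort distances, so that closeness of the rank vectors of [X_i] and
    [X_N(i)] gives no direct control of the distance between the points themselves, and
    approximating g by continuous functions would not help directly. Separation by Borel sets takes
    the place of distance. Atoms also create clusters of coincident points: a fixed tie rule could
    send a whole cluster to one neighbour, and only the average over the draws, recorded by
    [weight], obeys Stone's bound. Each neighbour index depends on the whole sample. Rather than
    conditioning on part of it, the proof expresses independence as orthogonality: a centred bounded
    variable is orthogonal to every bounded function measurable for a given sub-sigma-algebra
    ([Ex_orthogonal]). The thresholds Y_k come from the same sample as Q_n and G_n, so a bound for
    each fixed y is not enough; the brackets give one bound valid for all y at once. The quotient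
    then converges because its limiting denominator is positive: a Y that is not a function of X is
    not almost surely constant. *)

Section Vanishing.
Context {R : realType}.
Implicit Types a b : nat -> R.

(* One-sided: for nonnegative sequences this is convergence to 0. *)
Definition vanishing a :=
  forall e, 0 < e -> exists m, forall n, (m <= n)%N -> a n <= e.

Lemma vanishing_le a b (k : nat) :
  (forall n, (k <= n)%N -> a n <= b n) -> vanishing b -> vanishing a.
Proof.
move=> ab vb e e0; have [m mb] := vb e e0.
exists (maxn k m) => n; rewrite geq_max => /andP[kn mn].
exact: le_trans (ab n kn) (mb n mn).
Qed.

Lemma vanishingD a b :
  vanishing a -> vanishing b -> vanishing (fun n => a n + b n).
Proof.
move=> va vb e e0; have e20 : 0 < e / 2 by rewrite divr_gt0.
have [m ma] := va _ e20; have [k kb] := vb _ e20.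
exists (maxn m k) => n; rewrite geq_max => /andP[mn kn].
by rewrite (splitr e) lerD ?ma ?kb.
Qed.

Lemma vanishing0 : vanishing (fun=> 0).
Proof. by move=> e e0; exists 0%N => n _; exact: ltW. Qed.

Lemma vanishingZ c a : 0 <= c -> vanishing a -> vanishing (fun n => c * a n).
Proof.
move=> c0 va e e0.
have c1 : 0 < c + 1 by rewrite ltr_wpDl.
have [m ma] := va (e / (c + 1)) (divr_gt0 e0 c1).
exists m => n mn; apply: le_trans (ler_wpM2l c0 (ma n mn)) _.
rewrite mulrCA ler_piMr ?(ltW e0)// ler_pdivrMr// mul1r.
by rewrite lerDl.
Qed.

Lemma vanishing_sum (I : Type) (r : seq I) (a : I -> nat -> R) :
  (forall i, vanishing (a i)) -> vanishing (fun n => \sum_(i <- r) a i n).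
Proof.
move=> va; elim: r => [|i r ih].
  by apply: (vanishing_le (k := 0%N)) vanishing0 => n _; rewrite big_nil.
apply: (vanishing_le (k := 0%N)) (vanishingD (va i) ih) => n _.
by rewrite big_cons.
Qed.

Lemma vanishing_inv c : vanishing (fun n => c / n%:R).
Proof.
move=> e e0; exists (Num.truncn (`|c| / e)).+1 => n hn.
have n0 : 0 < n%:R :> R by rewrite ltr0n (leq_trans _ hn).
rewrite ler_pdivrMr// (le_trans (ler_norm _))// mulrC -ler_pdivrMr//.
by apply: ltW; apply: lt_le_trans (truncnS_gt _) _; rewrite ler_nat.
Qed.

(** Approximation with a precision e fixed before n: the threshold [k] and the bound [b] may depend
    on e, the constant c may not. Dividing by c + 1 in the proof covers c = 0. *)
Lemma vanishing_approx c a : 0 <= c ->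
  (forall e, 0 < e -> exists k b, vanishing b /\
    forall n, (k <= n)%N -> a n <= b n + c * e) -> vanishing a.
Proof.
move=> c0 h e e0.
have c1 : 0 < c + 1 by rewrite ltr_wpDl.
have e' : 0 < e / 2 / (c + 1) by rewrite !divr_gt0.
have [k [b [vb ab]]] := h _ e'.
have [m mb] := vb (e / 2) (divr_gt0 e0 (ltr0n _ 2)).
exists (maxn k m) => n; rewrite geq_max => /andP[kn mn].
apply: le_trans (ab n kn) _; rewrite [leRHS](splitr e) lerD ?mb//.
rewrite mulrCA ler_piMr// ?divr_ge0// ?(ltW e0)// ler_pdivrMr// mul1r.
by rewrite lerDl.
Qed.

End Vanishing.

Lemma normB_bool {R : realType} (b c : bool) :
  `|b%:R - c%:R| = (b != c)%:R :> R.
Proof.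
by case: b; case: c; rewrite /= ?subrr ?subr0 ?sub0r ?normrN ?normr0 ?normr1.
Qed.

Section BoundedExpectation.
Context {R : realType} {dT : measure_display} {T : measurableType dT}.
Implicit Types f g : T -> R.

(** Bounded everywhere rather than almost surely, so that the class is closed under ring operations
    and every member is integrable. The measurable structure is a parameter: over
    [g_sigma_algebraType C] the same predicate demands measurability for the sigma-algebra generated
    by [C]. *)
Definition bounded_rv f :=
  measurable_fun setT f /\ exists M, forall w, `|f w| <= M.

Lemma bounded_rv_cst c : bounded_rv (fun=> c).
Proof. by split=> //; exists `|c|. Qed.

Lemma bounded_rvD f g : bounded_rv f -> bounded_rv g ->
  bounded_rv (fun w => f w + g w).
Proof.
move=> [mf [M fM]] [mg [N gN]]; split; first exact: measurable_funD.
by exists (M + N) => w; rewrite (le_trans (ler_normD _ _))// lerD.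
Qed.

Lemma bounded_rvN f : bounded_rv f -> bounded_rv (fun w => - f w).
Proof.
move=> [mf [M fM]]; split; first exact: measurable_funN.
by exists M => w; rewrite normrN.
Qed.

Lemma bounded_rvB f g : bounded_rv f -> bounded_rv g ->
  bounded_rv (fun w => f w - g w).
Proof. by move=> bf bg; apply: bounded_rvD => //; exact: bounded_rvN. Qed.

Lemma bounded_rvM f g : bounded_rv f -> bounded_rv g ->
  bounded_rv (fun w => f w * g w).
Proof.
move=> [mf [M fM]] [mg [N gN]]; split; first exact: measurable_funM.
by exists (M * N) => w; rewrite normrM ler_pM.
Qed.

Lemma bounded_rvX f n : bounded_rv f -> bounded_rv (fun w => f w ^+ n).
Proof.
move=> bf; elim: n => [|n ih]; first exact: bounded_rv_cst.
by under eq_fun do rewrite exprS; exact: bounded_rvM.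
Qed.

Lemma bounded_rv_norm f : bounded_rv f -> bounded_rv (fun w => `|f w|).
Proof.
move=> [mf [M fM]]; split; first exact: measurableT_comp.
by exists M => w; rewrite normr_id.
Qed.

Lemma bounded_rv_sum (I : Type) (r : seq I) (Q : pred I) (f : I -> T -> R) :
  (forall i, Q i -> bounded_rv (f i)) ->
  bounded_rv (fun w => \sum_(i <- r | Q i) f i w).
Proof.
move=> bf; elim: r => [|i r ih].
  by under eq_fun do rewrite big_nil; exact: bounded_rv_cst.
under eq_fun do rewrite big_cons.
have [Qi|nQi] := boolP (Q i); last exact: ih.
by apply: bounded_rvD ih; exact: bf.
Qed.

Lemma bounded_rv_bool (b : T -> bool) : measurable_fun setT b ->
  bounded_rv (fun w => (b w)%:R).
Proof.
move=> mb; split; last by exists 1 => w; case: (b w); rewrite ?normr1 ?normr0.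
rewrite [X in measurable_fun _ X](_ : _ = fun w => if b w then 1 else 0).
  by apply: measurable_fun_ifT => //; exact: measurable_cst.
by apply/funext => w; case: (b w).
Qed.

End BoundedExpectation.

Lemma measurable_true_set {dT : measure_display} {T : measurableType dT}
    (b : T -> bool) : measurable_fun setT b -> measurable [set w | b w].
Proof.
move=> mb; have := mb measurableT [set true].
by rewrite setTI preimage_true; apply.
Qed.

Section Expectation.
Context {R : realType} {dT : measure_display} {T : measurableType dT}.
Variable P : probability T R.
Implicit Types f g : T -> R.

Definition Ex f : R := \int[P]_w f w.

Lemma bounded_rv_integrable f : bounded_rv f ->
  P.-integrable setT (EFin \o f).
Proof.
move=> [mf [M fM]]; apply: measurable_bounded_integrable => //.
  exact: fin_num_fun_lty (fin_num_measure P).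
exists M; split; first exact: num_real.
by move=> x Mx w _ /=; rewrite (le_trans (fM w))// ltW.
Qed.

Lemma EFin_Ex f : bounded_rv f -> (\int[P]_w (f w)%:E)%E = (Ex f)%:E.
Proof.
move=> bf; rewrite /Ex /Rintegral fineK//.
by apply: integrable_fin_num => //; exact: bounded_rv_integrable.
Qed.

Lemma eq_Ex f g : f =1 g -> Ex f = Ex g.
Proof. by move=> /funext ->. Qed.

Lemma Ex_cst c : Ex (fun=> c) = c.
Proof. by rewrite /Ex Rintegral_cst// [X in fine X]probability_setT mulr1. Qed.

Lemma ExD f g : bounded_rv f -> bounded_rv g ->
  Ex (fun w => f w + g w) = Ex f + Ex g.
Proof. by move=> bf bg; rewrite /Ex RintegralD//; exact: bounded_rv_integrable. Qed.

Lemma ExB f g : bounded_rv f -> bounded_rv g ->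
  Ex (fun w => f w - g w) = Ex f - Ex g.
Proof. by move=> bf bg; rewrite /Ex RintegralB//; exact: bounded_rv_integrable. Qed.

Lemma ExZ c f : bounded_rv f -> Ex (fun w => c * f w) = c * Ex f.
Proof. by move=> bf; rewrite /Ex RintegralZl//; exact: bounded_rv_integrable. Qed.

Lemma Ex_sum (I : Type) (r : seq I) (Q : pred I) (f : I -> T -> R) :
  (forall i, Q i -> bounded_rv (f i)) ->
  Ex (fun w => \sum_(i <- r | Q i) f i w) = \sum_(i <- r | Q i) Ex (f i).
Proof.
move=> bf; elim: r => [|i r ih].
  by under eq_Ex do rewrite big_nil; rewrite Ex_cst big_nil.
under eq_Ex do rewrite big_cons; rewrite big_cons.
have [Qi|nQi] := boolP (Q i); last exact: ih.
by rewrite ExD ?ih//; [exact: bf|exact: bounded_rv_sum].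
Qed.

Lemma le_Ex f g : bounded_rv f -> bounded_rv g -> (forall w, f w <= g w) ->
  Ex f <= Ex g.
Proof.
move=> bf bg fg; apply: le_Rintegral => //; exact: bounded_rv_integrable.
Qed.

Lemma Ex_ge0 f : (forall w, 0 <= f w) -> 0 <= Ex f.
Proof. by move=> f0; exact: Rintegral_ge0. Qed.

Lemma Ex_le_cst f c : bounded_rv f -> (forall w, f w <= c) -> Ex f <= c.
Proof.
by move=> bf fc; rewrite -[leRHS]Ex_cst; apply: le_Ex => //; exact: bounded_rv_cst.
Qed.

Lemma ler_norm_Ex f : bounded_rv f -> `|Ex f| <= Ex (fun w => `|f w|).
Proof.
by move=> bf; apply: le_normr_Rintegral => //; exact: bounded_rv_integrable.
Qed.

Lemma Ex_bool (b : T -> bool) : measurable_fun setT b ->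
  (Ex (fun w => (b w)%:R))%:E = P [set w | b w].
Proof.
move=> mb; rewrite -EFin_Ex; last exact: bounded_rv_bool.
have mB : measurable [set w | b w] by exact: measurable_true_set.
rewrite -[RHS]mule1 -[X in (_ * X)%E]/(1%:E) muleC -integral_cst//.
rewrite [RHS]integral_mkcond; apply: eq_integral => w _.
rewrite patchE; case: ifPn => [|].
  by rewrite inE /= => ->.
by rewrite notin_setE/= => /negP/negbTE ->.
Qed.

(* AM-GM: |x| <= e + x^2 / e. *)
Lemma vanishing_L1_of_L2 (k : nat) (f : nat -> T -> R) :
  (forall n, (k <= n)%N -> bounded_rv (f n)) -> vanishing (fun n => Ex (fun w => f n w ^+ 2)) ->
  vanishing (fun n => Ex (fun w => `|f n w|)).
Proof.
move=> bf vf; apply: (vanishing_approx (c := 1)) => // e e0.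
exists k, (fun n => e^-1 * Ex (fun w => f n w ^+ 2)); split.
  by apply: vanishingZ => //; rewrite invr_ge0 ltW.
move=> n kn; rewrite mul1r; have {}bf := bf n kn.
rewrite -ExZ; last exact: bounded_rvX.
rewrite -[X in _ + X]Ex_cst -ExD; last 2 first.
- by apply: bounded_rvM; [exact: bounded_rv_cst|exact: bounded_rvX].
- exact: bounded_rv_cst.
apply: le_Ex.
- exact: bounded_rv_norm.
- apply: bounded_rvD; last exact: bounded_rv_cst.
  by apply: bounded_rvM; [exact: bounded_rv_cst|exact: bounded_rvX].
move=> w; have -> : f n w ^+ 2 = `|f n w| ^+ 2 by rewrite real_normK// num_real.
rewrite -(ler_pM2l e0) mulrDr mulrA mulfV ?gt_eqF// mul1r.
set x := `|f n w|; nra.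
Qed.

End Expectation.

(** * Orthogonality and independence *)

Lemma sum_ltn_minn m k : (\sum_(l < m) (l < k) = minn k m)%N.
Proof.
elim: m => [|m ih]; first by rewrite big_ord0 minn0.
rewrite big_ord_recr /= ih; case: (ltnP m k) => mk.
  by rewrite (minn_idPr mk) addn1.
by rewrite addn0 (minn_idPl (leq_trans mk (leqnSn _))).
Qed.

(** The sum is the integer part of m x. Applied to the values of a function, this approximates it
    uniformly by an average of indicators of its superlevel sets, which is how results pass from
    sets to functions. *)
Lemma discretization {R : realType} (m : nat) (x : R) : 0 <= x <= 1 ->
  (0 < m)%N ->
  `|x - m%:R^-1 * \sum_(l < m) (l.+1%:R <= m%:R * x)%R%:R| <= m%:R^-1.
Proof.
move=> /andP[x0 x1] m0; have m0' : 0 < m%:R :> R by rewrite ltr0n.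
set k := Num.truncn (m%:R * x).
have mx0 : 0 <= m%:R * x by rewrite mulr_ge0.
have km : (k <= m)%N.
  by rewrite -(ler_nat R) (@le_trans _ _ (m%:R * x)) ?truncn_le// ler_piMr// ltW.
have -> : \sum_(l < m) (l.+1%:R <= m%:R * x)%R%:R = k%:R :> R.
  rewrite -(minn_idPl km) -sum_ltn_minn natr_sum; apply: eq_bigr => l _.
  by rewrite -truncn_ge_nat.
rewrite -(ler_pM2l m0') mulfV ?gt_eqF// -{1}(ger0_norm (ltW m0')) -normrM.
rewrite mulrBr mulrA mulfV ?gt_eqF// mul1r ger0_norm.
  by rewrite lerBlDr addrC ltW// natr1 truncnS_gt.
by rewrite subr_ge0 truncn_le.
Qed.

Section SubSigmaAlgebra.
Context {R : realType} {dT : measure_display} {T : measurableType dT}.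
Variables (P : probability T R) (C : set (set T)).
Hypothesis mC : C `<=` measurable.

Lemma sub_sigma_measurable A : <<s C >> A -> measurable A.
Proof. by apply: smallest_sub => //; exact: sigma_algebra_measurable. Qed.

Lemma sub_sigma_measurable_fun {d'} {T' : measurableType d'} (f : T -> T') :
  measurable_fun [set: g_sigma_algebraType C] f -> measurable_fun [set: T] f.
Proof.
move=> mf _ B mB; rewrite setTI.
have := mf measurableT B mB; rewrite setTI; exact: sub_sigma_measurable.
Qed.

Lemma bounded_rv_sub_sigma (h : T -> R) :
  @bounded_rv R _ (g_sigma_algebraType C) h -> bounded_rv h.
Proof. by move=> [mh bh]; split => //; exact: sub_sigma_measurable_fun. Qed.

Variable f : T -> R.
Hypothesis bf : bounded_rv f.
Hypothesis f0 : forall A, <<s C >> A -> Ex P (fun w => f w * (w \in A)%:R) = 0.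

Lemma Ex_orthogonal_bool (b : T -> bool) :
  measurable_fun [set: g_sigma_algebraType C] b ->
  Ex P (fun w => f w * (b w)%:R) = 0.
Proof.
move=> mb; rewrite -[RHS](f0 (A := [set w | b w])).
  by apply: eq_Ex => w; rewrite mem_setE.
exact: (measurable_true_set mb).
Qed.

(** The superlevel sets of h belong to the sub-sigma-algebra, so their indicators are orthogonal to
    f. Replacing h by their average costs at most M / m, which is below e for the chosen m. *)
Lemma Ex_orthogonal01 (h : T -> R) :
  measurable_fun [set: g_sigma_algebraType C] h -> (forall w, 0 <= h w <= 1) ->
  Ex P (fun w => f w * h w) = 0.
Proof.
move=> mh h01; have [_ [M fM]] := bf.
have bh : bounded_rv h.
  split; first exact: sub_sigma_measurable_fun.
  by exists 1 => w; have /andP[h0 h1] := h01 w; rewrite ger0_norm.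
apply/eqP; rewrite -normr_eq0; apply/eqP/le_anti; rewrite normr_ge0 andbT.
apply/ler_addgt0Pl => e e0; rewrite addr0.
set m := (Num.truncn (M / e)).+1; have m0 : 0 < m%:R :> R by rewrite ltr0n.
have M0 : 0 <= M by rewrite (le_trans _ (fM point)).
pose b (l : 'I_m) w := (l.+1%:R <= m%:R * h w)%R.
have mb l : measurable_fun [set: g_sigma_algebraType C] (b l).
  by apply: measurable_fun_ler => //; apply: measurable_funM.
have bb l : bounded_rv (fun w => (b l w)%:R : R).
  by apply: bounded_rv_bool; apply: sub_sigma_measurable_fun.
have bs : bounded_rv (fun w => m%:R^-1 * \sum_l (b l w)%:R : R).
  by apply: bounded_rvM; [exact: bounded_rv_cst|exact: bounded_rv_sum].
have E0 : Ex P (fun w => f w * (m%:R^-1 * \sum_l (b l w)%:R)) = 0.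
  rewrite (eq_Ex _ (g := fun w => m%:R^-1 * \sum_l (f w * (b l w)%:R))); last first.
    by move=> w; rewrite mulrCA mulr_sumr.
  rewrite ExZ; last by apply: bounded_rv_sum => l _; exact: bounded_rvM.
  rewrite Ex_sum; last by move=> l _; exact: bounded_rvM.
  by rewrite big1 ?mulr0// => l _; exact: Ex_orthogonal_bool.
rewrite -[X in `|X|]subr0 -[X in _ - X]E0 -ExB; [|exact: bounded_rvM..].
apply: le_trans (ler_norm_Ex _ _) _; first by apply: bounded_rvB; exact: bounded_rvM.
apply: Ex_le_cst.
  by apply: bounded_rv_norm; apply: bounded_rvB; exact: bounded_rvM.
move=> w; rewrite -mulrBr normrM.
apply: le_trans (ler_pM _ _ (fM w) (discretization (h01 w) (ltn0Sn _))) _ => //.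
rewrite ler_pdivrMr// mulrC -ler_pdivrMr//.
by apply: ltW; exact: truncnS_gt.
Qed.

Lemma Ex_orthogonal (h : T -> R) :
  @bounded_rv R _ (g_sigma_algebraType C) h -> Ex P (fun w => f w * h w) = 0.
Proof.
move=> [mh [M hM]].
have M0 : 0 <= M by rewrite (le_trans _ (hM point)).
have M1 : 0 < M + 1 by rewrite ltr_wpDl.
have bh : bounded_rv h.
  by split; [exact: sub_sigma_measurable_fun|exists M].
have E1 : Ex P (fun w => f w * 1) = 0.
  by apply: Ex_orthogonal01 => // w; rewrite lexx ler01.
(* An affine map brings h into [0, 1]; dividing by M + 1 stays legitimate when M = 0. *)
have E2 : Ex P (fun w => f w * (2^-1 * ((M + 1)^-1 * h w + 1))) = 0.
  apply: Ex_orthogonal01 => [|w].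
    apply: measurable_funM => //; apply: measurable_funD => //.
    exact: measurable_funM.
  have : `|(M + 1)^-1 * h w| <= 1.
    rewrite normrM gtr0_norm ?invr_gt0// mulrC ler_pdivrMr// mul1r.
    by rewrite (le_trans (hM w))// lerDl.
  by rewrite ler_norml => /andP[? ?]; apply/andP; split; lra.
have : Ex P (fun w => 2 * (M + 1) * (f w * (2^-1 * ((M + 1)^-1 * h w + 1)))
                  - (M + 1) * (f w * 1)) = 0.
  have b0 := bounded_rv_cst (R := R) (T := T).
  have b1 : bounded_rv (fun w => f w * (2^-1 * ((M + 1)^-1 * h w + 1))).
    do 2 apply: bounded_rvM => //.
    by apply: bounded_rvD => //; exact: bounded_rvM.
  have b2 : bounded_rv (fun w => f w * 1) by exact: bounded_rvM.
  by rewrite ExB ?ExZ ?E1 ?E2 ?mulr0 ?subr0//; exact: bounded_rvM.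
move=> <-; apply: eq_Ex => w; field; lra.
Qed.

End SubSigmaAlgebra.

Section Independence.
Context {R : realType} {dT : measure_display} {T : measurableType dT}.
Variable P : probability T R.

Lemma indep_dynkin (A : set T) : measurable A ->
  dynkin [set B | measurable B /\ P (A `&` B) = (P A * P B)%E].
Proof.
move=> mA; split.
- by split=> //; rewrite setIT probability_setT mule1.
- move=> B [mB PAB]; split; first exact: measurableC.
  rewrite -setDE measureD//; last first.
    by rewrite ltey_eq fin_num_measure.
  rewrite [X in (_ - X)%E]PAB probability_setC// muleBr ?mule1//.
  by rewrite fin_num_measure.
- move=> F tF mF; split; first by apply: bigcupT_measurable => k; case: (mF k).
  rewrite setI_bigcupr measure_bigcup//; last 2 first.
  + by move=> k _; apply: measurableI => //; case: (mF k).
  + exact: trivIset_setIl.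
  rewrite measure_bigcup//; last by move=> k _; case: (mF k).
  rewrite -[X in (X * _)%E]fineK ?fin_num_measure// -nneseriesZl//.
  by apply: eq_eseriesr => k _; rewrite fineK ?fin_num_measure//; case: (mF k).
Qed.

Lemma indep_g_sigma (A : set T) (C : set (set T)) : measurable A ->
  C `<=` measurable -> setI_closed C ->
  (forall B, C B -> P (A `&` B) = (P A * P B)%E) ->
  forall B, <<s C >> B -> P (A `&` B) = (P A * P B)%E.
Proof.
move=> mA mC CI PAC B sB.
suff: <<s C >> `<=` [set B | measurable B /\ P (A `&` B) = (P A * P B)%E].
  by move=> /(_ _ sB) [].
apply: lambda_system_subset => //; first exact/dynkin_lambda_system/indep_dynkin.
by move=> D CD; split; [exact: mC|exact: PAC].
Qed.

Variables (J : finType) (G : J -> set (set T)).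
Hypothesis mG : forall j, G j `<=` measurable.
Hypothesis GT : forall j, G j setT.
Hypothesis GI : forall j, setI_closed (G j).
Hypothesis indepG : forall A : J -> set T, (forall j, G j (A j)) ->
  P (\big[setI/setT]_j A j) = (\prod_j P (A j))%E.

(** Used as a generator: [<<s rest i >>] is the information carried by all indices other than i. *)
Definition rest (i : J) : set (set T) := \bigcup_(j in [set j | j != i]) G j.

Lemma rest_measurable i : rest i `<=` measurable.
Proof. by move=> A [j _ /mG]. Qed.

Lemma indep_rest (i : J) (A B : set T) : G i A -> <<s rest i >> B ->
  P (A `&` B) = (P A * P B)%E.
Proof.
move=> GA sB.
(* Intersections whose i-th factor is the whole space form a pi-system whose sigma-algebra contains
   [rest i]; on it, independence of A is the product formula with A inserted at position i. *)
pose K := [set B | exists D : J -> set T,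
  [/\ forall j, G j (D j), D i = setT & B = \big[setI/setT]_j D j]].
have KB : <<s K >> B.
  suff: <<s rest i >> `<=` <<s K >> by apply.
  apply: smallest_sub; first exact: smallest_sigma_algebra.
  move=> D [j /= ji GD]; apply: sub_sigma_algebra.
  exists (fun k => if k == j then D else setT); split.
  - by move=> k; case: ifP => [/eqP ->|].
  - by rewrite eq_sym (negbTE ji).
  - rewrite (bigD1 j)//= eqxx big1 ?setIT// => k kj.
    by rewrite (negbTE kj).
apply: (indep_g_sigma (C := K)) KB.
- exact: mG GA.
- move=> D [E [GE _ ->]]; apply: big_ind => //.
    exact: measurableI.
  by move=> j _; exact: mG (GE j).
- move=> D1 D2 [E1 [G1 i1 ->]] [E2 [G2 i2 ->]].
  exists (fun j => E1 j `&` E2 j); split.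
  + by move=> j; exact: GI.
  + by rewrite i1 i2 setIT.
  + by rewrite big_split.
move=> D [E [GE Ei ->]].
have -> : A `&` \big[setI/setT]_j E j =
          \big[setI/setT]_j (if j == i then A else E j).
  rewrite (bigD1 i)//= Ei setTI [RHS](bigD1 i)//= eqxx; congr (_ `&` _).
  by apply: eq_bigr => j ji; rewrite (negbTE ji).
rewrite !indepG//; last by move=> j; case: ifP => [/eqP ->|].
rewrite (bigD1 i)//= eqxx [in RHS](bigD1 i)//= Ei probability_setT mul1e.
by congr (_ * _)%E; apply: eq_bigr => j ji; rewrite (negbTE ji).
Qed.

End Independence.

Section SubSigmaIndependence.
Context {R : realType} {dT : measure_display} {T : measurableType dT}.
Variable P : probability T R.

Lemma measurable_fun_g_sigma (C : set (set T)) {d'} {T' : measurableType d'}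
    (f : T -> T') : (forall B, measurable B -> C (f @^-1` B)) ->
  measurable_fun [set: g_sigma_algebraType C] f.
Proof.
by move=> h _ B mB; rewrite setTI; apply: sub_sigma_algebra; exact: h.
Qed.

Lemma measurable_mem (A : set T) : measurable A ->
  measurable_fun setT (fun w => w \in A).
Proof.
move=> mA; apply: (measurable_fun_bool true).
by rewrite setTI preimage_mem_true.
Qed.

Lemma Ex_mem (A : set T) : measurable A -> Ex P (fun w => (w \in A)%:R) = fine (P A).
Proof.
move=> mA; have := Ex_bool P (measurable_mem mA).
by rewrite set_mem_set => <-.
Qed.

Lemma bounded_rv_mem (A : set T) : measurable A ->
  bounded_rv (fun w => (w \in A)%:R : R).
Proof. by move=> mA; apply: bounded_rv_bool; exact: measurable_mem. Qed.

Variables C1 C2 : set (set T).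
Hypotheses (mC1 : C1 `<=` measurable) (mC2 : C2 `<=` measurable).
Hypothesis C12 : forall A B, <<s C1 >> A -> <<s C2 >> B ->
  P (A `&` B) = (P A * P B)%E.

(** Orthogonality is used twice. For B in [<<s C2 >>], the variable 1_B - P(B) is orthogonal to f;
    hence f - E f is orthogonal to every such 1_B, and therefore to g. *)
Lemma Ex_indep_mul (f g : T -> R) :
  @bounded_rv R _ (g_sigma_algebraType C1) f ->
  @bounded_rv R _ (g_sigma_algebraType C2) g ->
  Ex P (fun w => f w * g w) = Ex P f * Ex P g.
Proof.
move=> bf1 bg2.
have bf := bounded_rv_sub_sigma mC1 bf1.
have bg := bounded_rv_sub_sigma mC2 bg2.
have bc := bounded_rv_cst (R := R) (T := T).
have fB B : <<s C2 >> B -> Ex P (fun w => f w * (w \in B)%:R) = Ex P f * fine (P B).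
  move=> sB; have mB := sub_sigma_measurable mC2 sB.
  have bB := bounded_rv_mem mB.
  have : Ex P (fun w => ((w \in B)%:R - fine (P B)) * f w) = 0.
    apply: (Ex_orthogonal mC1) => //; first exact: bounded_rvB.
    move=> A sA; have mA := sub_sigma_measurable mC1 sA.
    have bA := bounded_rv_mem mA.
    rewrite (eq_Ex _ (g := fun w => (w \in A `&` B)%:R - fine (P B) * (w \in A)%:R)).
      rewrite ExB; last 2 first.
      - by apply: bounded_rv_mem; exact: measurableI.
      - exact: bounded_rvM.
      rewrite ExZ// !Ex_mem//; last exact: measurableI.
      by rewrite C12// fineM ?fin_num_measure// mulrC subrr.
    move=> w; rewrite mulrBl in_setI -natrM mulnb andbC; congr (_ - _).
  move=> h; apply/eqP; rewrite -subr_eq0; apply/eqP; rewrite -[RHS]h.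
  rewrite mulrC -ExZ// -ExB; [|exact: bounded_rvM..].
  by apply: eq_Ex => w; rewrite mulrBl; congr (_ - _); rewrite mulrC.
have : Ex P (fun w => (f w - Ex P f) * g w) = 0.
  apply: (Ex_orthogonal mC2) => //; first exact: bounded_rvB.
  move=> B sB; have mB := sub_sigma_measurable mC2 sB.
  have bB := bounded_rv_mem mB.
  rewrite (eq_Ex _ (g := fun w => f w * (w \in B)%:R - Ex P f * (w \in B)%:R)).
    by rewrite ExB ?ExZ ?fB ?Ex_mem ?subrr//; exact: bounded_rvM.
  by move=> w; rewrite mulrBl.
move=> h; apply/eqP; rewrite -subr_eq0; apply/eqP; rewrite -[RHS]h.
rewrite -ExZ// -ExB; [|exact: bounded_rvM..].
by apply: eq_Ex => w; rewrite mulrBl.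
Qed.

End SubSigmaIndependence.

Section DynkinOrthogonal.
Context {R : realType} {dT : measure_display} {T : measurableType dT}.
Variables (P : probability T R) (f : T -> R).
Hypothesis bf : bounded_rv f.

Lemma Ex_mul_mem (A : set T) : measurable A ->
  (Ex P (fun w => f w * (w \in A)%:R))%:E = (\int[P]_(w in A) (f w)%:E)%E.
Proof.
move=> mA; rewrite -EFin_Ex; last by apply: bounded_rvM => //; exact: bounded_rv_mem.
rewrite [RHS]integral_mkcond; apply: eq_integral => w _.
by rewrite patchE; case: ifP; rewrite ?mulr1 ?mulr0.
Qed.

Lemma orthogonal_dynkin : Ex P f = 0 ->
  dynkin [set A | measurable A /\ Ex P (fun w => f w * (w \in A)%:R) = 0].
Proof.
move=> f0; split.
- split=> //; rewrite -[RHS]f0; apply: eq_Ex => w.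
  by rewrite in_setT mulr1.
- move=> A [mA fA]; split; first exact: measurableC.
  rewrite -[RHS](subr0 0) -{1}f0 -fA -ExB//; last first.
    by apply: bounded_rvM => //; exact: bounded_rv_mem.
  apply: eq_Ex => w; rewrite in_setC.
  by case: (w \in A); rewrite /= ?mulr1 ?mulr0 ?subrr ?subr0.
- move=> F tF mF; have mUF : measurable (\bigcup_k F k).
    by apply: bigcupT_measurable => k; case: (mF k).
  split=> //; apply: EFin_inj; rewrite Ex_mul_mem// integral_bigcup//.
  + rewrite eseries0// => k _ _; rewrite -Ex_mul_mem; last by case: (mF k).
    by case: (mF k) => _ ->.
  + by move=> k; case: (mF k).
  + apply: (integrableS measurableT) => //; exact: bounded_rv_integrable.
Qed.

Lemma orthogonal_g_sigma (C : set (set T)) :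
  C `<=` measurable -> setI_closed C -> Ex P f = 0 ->
  (forall A, C A -> Ex P (fun w => f w * (w \in A)%:R) = 0) ->
  forall A, <<s C >> A -> Ex P (fun w => f w * (w \in A)%:R) = 0.
Proof.
move=> mC CI f0 fC A sA.
suff: <<s C >> `<=`
    [set A | measurable A /\ Ex P (fun w => f w * (w \in A)%:R) = 0].
  by move=> /(_ _ sA)[].
apply: lambda_system_subset => //; first exact/dynkin_lambda_system/orthogonal_dynkin.
by move=> D CD; split; [exact: mC|exact: fC].
Qed.

End DynkinOrthogonal.

(** * Nearest neighbours *)

Section NearestNeighbour.
Context {R : realType} {d n : nat}.
Implicit Types (z : 'I_n -> d.-tuple R) (i k : 'I_n).

(** Squared distances order the points as [euclid_dist] does, and keep the algebra and the
    measurability proofs free of square roots. *)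
Definition sqdist (a b : d.-tuple R) : R :=
  \sum_(j < d) (tnth a j - tnth b j) ^+ 2.

Lemma sqdist_ge0 a b : 0 <= sqdist a b.
Proof. by apply: sumr_ge0 => j _; exact: sqr_ge0. Qed.

Lemma euclid_dist_le a b c e :
  (euclid_dist a b <= euclid_dist c e) = (sqdist a b <= sqdist c e).
Proof. by rewrite /euclid_dist ler_sqrt// sqdist_ge0. Qed.

Definition cand z i : {set 'I_n} :=
  [set j | (j != i) && [forall k, (k != i) ==>
     (sqdist (z i) (z j) <= sqdist (z i) (z k))]].

Lemma nn_candidatesE z i : nn_candidates z i = enum (cand z i).
Proof.
rewrite /nn_candidates {2}/enum_mem -enumT; apply: eq_filter => j.
rewrite /= inE; congr (_ && _); apply: eq_forallb => k.
by rewrite euclid_dist_le.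
Qed.

Lemma cand_neq0 z i : (1 < n)%N -> (0 < #|cand z i|)%N.
Proof.
move=> n1; have [j0 j0i] : exists j0, j0 != i.
  have : (0 < #|[set~ i]%SET|)%N by rewrite cardsC1 card_ord; case: n n1 => [|[]].
  by rewrite card_gt0 => /set0Pn[j]; rewrite !inE => ji; exists j.
have [j ji jm] := @arg_minP _ R _ j0 (fun k => k != i)
  (fun k => sqdist (z i) (z k)) j0i.
rewrite card_gt0; apply/set0Pn; exists j; rewrite inE ji/=.
by apply/forallP => k; apply/implyP => /jm.
Qed.

(* [slot m r x] says that x falls in the r-th of the m cells [r, r + 1[, the
   first and the last cell being extended to infinity. *)
Definition slot (m r : nat) (x : R) : bool :=
  ((r == 0%N) || (r%:R <= x)) && ((r == m.-1) || (x < r.+1%:R)).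

(** [Num.truncn] is 0 on negative numbers and [minn] caps large ones, which is why the two extreme
    cells are unbounded and x needs no range assumption. *)
Lemma slotP m r (x : R) : (r < m)%N -> (minn (Num.truncn x) m.-1 == r) = slot m r x.
Proof.
move=> rm; have rm1 : (r <= m.-1)%N by case: m rm.
have le_tr : (r <= Num.truncn x)%N = (r == 0%N) || (r%:R <= x).
  by case: r {rm rm1} => [//|r]; rewrite -truncn_gt_nat.
have tr_lt : (Num.truncn x <= r)%N = (x < r.+1%:R).
  by rewrite leqNgt truncn_gt_nat ltNge.
rewrite eqn_leq geq_min leq_min rm1 andbT le_tr tr_lt /slot andbC; congr (_ && _).
by rewrite orbC; congr (_ || _); rewrite eqn_leq rm1.
Qed.

(** Separates the two sources of randomness: once the candidate set is fixed, the choice of k is an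
    event about [u i] alone. Measurability of the neighbour and the averaging over ties both rest on
    this. *)
Lemma nnE z (u : 'I_n -> R) i k : (1 < n)%N ->
  (nn z u i == k) = (k \in cand z i) &&
    slot #|cand z i| (index k (enum (cand z i))) (u i * #|cand z i|%:R).
Proof.
move=> n1; rewrite /nn nn_candidatesE -cardE.
have c0 := cand_neq0 z i n1.
set c := cand z i; set t := Num.truncn _.
have tc : (minn t #|c|.-1 < size (enum c))%N.
  by rewrite -cardE gtn_min orbC (prednK c0) leqnn.
have [kc|kc] := boolP (k \in c); last first.
  apply/negbTE; apply: contra kc => /eqP <-.
  by rewrite -(mem_enum c) mem_nth.
rewrite -slotP/=; last by rewrite cardE index_mem mem_enum.
apply/eqP/eqP => [<-|->]; first by rewrite index_uniq// enum_uniq.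
by rewrite nth_index// mem_enum.
Qed.

Lemma nn_cand z u i : (1 < n)%N -> nn z u i \in cand z i.
Proof. by move=> n1; have := nnE z u i (nn z u i) n1; rewrite eqxx => /esym/andP[]. Qed.

Lemma nn_neq z u i : (1 < n)%N -> nn z u i != i.
Proof. by move=> /(nn_cand z u i); rewrite inE => /andP[]. Qed.

Lemma nn_le z u i k : (1 < n)%N -> k != i ->
  sqdist (z i) (z (nn z u i)) <= sqdist (z i) (z k).
Proof.
move=> /(nn_cand z u i); rewrite inE => /andP[_ /forallP/(_ k)/implyP h] ki.
exact: h.
Qed.

(** The chance that a uniform draw selects k as the neighbour of i when the positions are z. *)
Definition weight z i k : R := (k \in cand z i)%:R / #|cand z i|%:R.

Lemma weight_ge0 z i k : 0 <= weight z i k.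
Proof. by rewrite divr_ge0. Qed.

Lemma weight_le z i k : weight z i k <= (k \in cand z i)%:R.
Proof.
rewrite /weight; have [kc|] := boolP (k \in _); last by rewrite mul0r.
have c0 : (0 < #|cand z i|)%N by rewrite card_gt0; apply/set0Pn; exists k.
by rewrite ler_pdivrMr ?ltr0n// mul1r ler1n.
Qed.

Lemma sqdistxx (a : d.-tuple R) : sqdist a a = 0.
Proof. by rewrite /sqdist big1// => j _; rewrite subrr expr0n. Qed.

Lemma sqdistC (a b : d.-tuple R) : sqdist a b = sqdist b a.
Proof. by apply: eq_bigr => j _; rewrite -sqrrN opprB. Qed.

Lemma sqdist_eq0 (a b : d.-tuple R) : (sqdist a b == 0) = (a == b).
Proof.
apply/eqP/eqP => [|->]; last exact: sqdistxx.
move=> /eqP; rewrite psumr_eq0; last by move=> j _; exact: sqr_ge0.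
move=> /allP h; apply: eq_from_tnth => j; apply/eqP; rewrite -subr_eq0.
by rewrite -(sqrf_eq0 (_ - _)); apply: h; rewrite mem_index_enum.
Qed.

(** In a cluster of c coincident points, each point has the c - 1 others as candidates, since
    distance 0 is minimal. So k receives at most 1 / (c - 1) from each of c - 1 points. *)
Lemma weight_cluster z k : \sum_(i | z i == z k) weight z i k <= 1.
Proof.
pose C := [set j | z j == z k]%SET.
have kC : k \in C by rewrite inE.
have cC i : i \in C -> (#|C|.-1 <= #|cand z i|)%N.
  move=> iC; rewrite [#|C|](cardsD1 i) iC add1n/= subset_leq_card//.
  apply/fintype.subsetP => j; rewrite !inE in iC *; move=> /andP[-> /eqP ->] /=.
  by apply/forallP => l; rewrite (eqP iC) sqdistxx sqdist_ge0 implybT.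
have [C1|C1] := leqP #|C| 1%N.
  rewrite big1// => i ik; have -> : i = k.
    by have /card_le1_eqP := C1; apply; rewrite ?inE.
  by rewrite /weight inE eqxx/= mul0r.
rewrite (bigD1 k)//= {1}/weight inE eqxx/= mul0r add0r.
have C0 : 0 < #|C|.-1%:R :> R by rewrite ltr0n; case: #|C| C1 => [|[]].
apply: le_trans (_ : \sum_(i in (C :\ k)%SET) #|C|.-1%:R^-1 <= _).
  rewrite [leRHS](eq_bigl (fun i => (z i == z k) && (i != k))); last first.
    by move=> i; rewrite !inE andbC.
  apply: ler_sum => i /andP[ik _]; rewrite /weight.
  have iC : i \in C by rewrite inE.
  have h := cC i iC; have c0 : 0 < #|cand z i|%:R :> R.
    by rewrite (lt_le_trans C0)// ler_nat.
  case: (k \in _); last by rewrite mul0r invr_ge0 ltW.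
  by rewrite mul1r lef_pV2 ?posrE// ler_nat.
rewrite sumr_const -[X in X *+ _]mulr1 -mulrnAr.
have -> : #|(C :\ k)%SET| = #|C|.-1 by rewrite [#|C|](cardsD1 k) kC.
by rewrite mulVf// gt_eqF.
Qed.

(* Two nonzero vectors both at most as long as their difference form an angle
   of at least 60 degrees. *)
Lemma unit_vectors_apart (a b : 'I_d -> R) :
  let A := \sum_j a j ^+ 2 in let B := \sum_j b j ^+ 2 in
  let D := \sum_j (a j - b j) ^+ 2 in
  0 < A -> 0 < B -> A <= D -> B <= D ->
  1 <= \sum_j (a j / Num.sqrt A - b j / Num.sqrt B) ^+ 2.
Proof.
move=> A B D A0 B0 AD BD.
set al := Num.sqrt A; set be := Num.sqrt B.
have al0 : 0 < al by rewrite sqrtr_gt0.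
have be0 : 0 < be by rewrite sqrtr_gt0.
have alA : al ^+ 2 = A by rewrite sqr_sqrtr// ltW.
have beB : be ^+ 2 = B by rewrite sqr_sqrtr// ltW.
pose S := \sum_j a j * b j.
have DE : D = A + B - 2 * S.
  rewrite /D /A /B /S mulr_sumr -big_split -sumrB/=.
  by apply: eq_bigr => j _; ring.
have -> : \sum_j (a j / al - b j / be) ^+ 2 =
    al^-1 ^+ 2 * A + be^-1 ^+ 2 * B - 2 * (al^-1 * be^-1) * S.
  rewrite /A /B /S !mulr_sumr -big_split -sumrB/=.
  by apply: eq_bigr => j _; ring.
rewrite -alA -beB -!exprMn !mulVf ?gt_eqF// !expr1n.
have S2 : 2 * S <= al * be.
  have [ab|ab] := leP al be.
    by apply: (@le_trans _ _ A); [lra|rewrite -alA expr2 ler_pM2l].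
  by apply: (@le_trans _ _ B); [lra|rewrite -beB expr2 ler_pM2r// ltW].
have : 2 * (al^-1 * be^-1) * S <= 1.
  have -> : 2 * (al^-1 * be^-1) * S = 2 * S / (al * be) by rewrite invfM; ring.
  by rewrite ler_pdivrMr ?mulr_gt0// mul1r.
lra.
Qed.

Lemma truncn_eq_close (x y : R) : 0 <= x -> 0 <= y ->
  Num.truncn x = Num.truncn y -> `|x - y| < 1.
Proof.
move=> x0 y0 xy.
have := truncn_le x; have := truncnS_gt x; rewrite xy.
have := truncn_le y; have := truncnS_gt y.
rewrite x0 y0 -!natr1 => h1 h2 h3 h4.
by rewrite ltr_norml; apply/andP; split; lra.
Qed.

Lemma cell_sqdist (x y : 'I_d -> R) : (forall j, 0 <= x j) ->
  (forall j, 0 <= y j) -> (forall j, Num.truncn (x j) = Num.truncn (y j)) ->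
  \sum_j (x j - y j) ^+ 2 <= d%:R.
Proof.
move=> x0 y0 xy; rewrite -[X in _ <= X%:R]card_ord -sum1_card natr_sum.
apply: ler_sum => j _; rewrite -real_normK ?num_real//.
by rewrite expr_le1// ltW// truncn_eq_close.
Qed.

(** Pigeonhole on unit cells: two points in one cell are at squared distance at most d. There are L
    + 1 cells per axis because the endpoint L is allowed. *)
Lemma card_cells (L : nat) (A : {set 'I_n}) (x : 'I_n -> 'I_d -> R) :
  (forall i j, i \in A -> 0 <= x i j <= L%:R) ->
  (forall i k, i \in A -> k \in A -> i != k ->
     d%:R < \sum_j (x i j - x k j) ^+ 2) ->
  (#|A| <= L.+1 ^ d)%N.
Proof.
move=> x0L far.
pose cell i : {ffun 'I_d -> 'I_L.+1} := [ffun j => inord (Num.truncn (x i j))].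
have cellK i j : i \in A -> cell i j = Num.truncn (x i j) :> nat.
  move=> iA; rewrite ffunE inordK// ltnS -(ler_nat R).
  have /andP[x0 xL] := x0L i j iA.
  by apply: le_trans xL; rewrite truncn_le.
have cell_inj : {in A &, injective cell}.
  move=> i k iA kA ck; apply/eqP; apply: contraT => ik.
  have := far i k iA kA ik; rewrite ltNge => /negP[].
  apply: cell_sqdist => j; first by case/andP: (x0L i j iA).
    by case/andP: (x0L k j kA).
  by rewrite -!cellK// ck.
rewrite -(card_in_imset cell_inj) (leq_trans (max_card _))//.
by rewrite card_ffun !card_ord.
Qed.

(** The 1 accounts for the points coinciding with k ([weight_cluster]), the power for those at
    positive distance ([card_reverse_nn]). *)
Definition stone_cst : R := 1 + ((2 * d.+1).+1 ^ d)%:R.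

Lemma stone_cst_ge0 : 0 <= stone_cst.
Proof. by rewrite addr_ge0. Qed.

(** Seen from [z k], two points that both have k as a nearest candidate are in directions at least
    60 degrees apart, by [unit_vectors_apart]; a packing bound limits the number of such
    directions. *)
Lemma card_reverse_nn z k :
  (#|[set i | (z i != z k) && (k \in cand z i)]%SET| <= (2 * d.+1).+1 ^ d)%N.
Proof.
set A := [set i | _]%SET.
pose a i (j : 'I_d) : R := tnth (z i) j - tnth (z k) j.
pose s i := \sum_j a i j ^+ 2.
pose v i j := a i j / Num.sqrt (s i).
have s0 i : i \in A -> 0 < s i.
  rewrite inE => /andP[zik _]; rewrite -[s i]/(sqdist (z i) (z k)).
  by rewrite lt_neqAle eq_sym sqdist_ge0 sqdist_eq0 zik.
have v1 i j : i \in A -> - 1 <= v i j <= 1.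
  move=> iA; rewrite -ler_norml /v normrM normfV.
  have q0 : 0 < Num.sqrt (s i) by rewrite sqrtr_gt0 s0.
  rewrite [`|Num.sqrt _|]gtr0_norm// ler_pdivrMr// mul1r -sqrtr_sqr.
  rewrite ler_sqrt; last by rewrite ltW// s0.
  rewrite /s (bigD1 j)//= lerDl.
  by apply: sumr_ge0 => l _; exact: sqr_ge0.
(* Shifting and scaling takes the unit vectors from [-1, 1]^d to [0, 2(d + 1)]^d, where squared
   distances at least 1 become at least (d + 1)^2 > d. *)
apply: (card_cells (x := fun i j => (v i j + 1) * d.+1%:R)).
  move=> i j iA; have /andP[h1 h2] := v1 i j iA.
  rewrite mulr_ge0 ?ler0n//=; last by lra.
  by rewrite natrM ler_pM2r ?ltr0Sn//; lra.
move=> i l iA lA il.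
under eq_bigr do rewrite -mulrBl opprD addrACA subrr addr0 exprMn.
rewrite -mulr_suml.
have le1 : 1 <= \sum_j (v i j - v l j) ^+ 2.
  have sE : \sum_j (a i j - a l j) ^+ 2 = sqdist (z i) (z l).
    by apply: eq_bigr => j _; rewrite /a; congr (_ ^+ 2); ring.
  move: (iA) (lA); rewrite !inE => /andP[_ /andP[_ /forallP hi]].
  move=> /andP[_ /andP[_ /forallP hl]].
  apply: unit_vectors_apart; rewrite ?s0// sE.
    by have := hi l; rewrite eq_sym il.
  by rewrite sqdistC; have := hl i; rewrite il.
apply: (@lt_le_trans _ _ (1 * d.+1%:R ^+ 2)); last by rewrite ler_pM2r ?exprn_gt0.
by rewrite mul1r -natrX ltr_nat -[X in (X <= _)%N]expn1 leq_pexp2l.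
Qed.

Lemma weight_sum z k : \sum_i weight z i k <= stone_cst.
Proof.
rewrite (bigID (fun i => z i == z k))/= lerD ?weight_cluster//.
apply: le_trans (_ : \sum_(i | z i != z k) (k \in cand z i)%:R <= _).
  by apply: ler_sum => i _; exact: weight_le.
rewrite -natr_sum ler_nat; apply: leq_trans (card_reverse_nn z k).
rewrite -sum1_card big_mkcond [leqRHS]big_mkcond leq_sum// => i _.
by rewrite inE; case: (z i != z k) => //=; case: (k \in _).
Qed.

End NearestNeighbour.

(** * Ranks *)

Section Ranks.
Context {R : realType} {d n : nat}.
Implicit Types (x z : 'I_n -> d.-tuple R) (i k l : 'I_n) (j : 'I_d).

Definition ranks x i : d.-tuple R := ecdf_vec x (x i).

Lemma tnth_ranks x i j :
  tnth (ranks x i) j = n%:R^-1 * \sum_l (tnth (x l) j <= tnth (x i) j)%R%:R.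
Proof. by rewrite tnth_mktuple. Qed.

Lemma mean_bool01 (b : 'I_n -> bool) :
  0 <= (n%:R^-1 * \sum_l (b l)%:R : R) <= 1.
Proof.
apply/andP; split; first by rewrite mulr_ge0 ?sumr_ge0.
have sn : \sum_l (b l)%:R <= n%:R :> R.
  rewrite -[X in _ <= X%:R]card_ord -sum1_card natr_sum.
  by rewrite ler_sum// => l _; case: (b l).
have [n0|n0] := posnP n; last by rewrite mulrC ler_pdivrMr ?ltr0n// mul1r.
by rewrite [X in X^-1](_ : _ = 0) ?invr0 ?mul0r// [X in X%:R]n0.
Qed.

Lemma sum_mem_card (A : {set 'I_n}) : \sum_i (i \in A)%:R = #|A|%:R :> R.
Proof.
by rewrite -sum1_card natr_sum [RHS]big_mkcond; apply: eq_bigr => i _; case: ifP.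
Qed.

Definition far_from_others z (e : R) i :=
  [forall k, (k != i) ==> (e ^+ 2 < sqdist (z i) (z k))].

(** The number of unit cells once [0, 1]^d is stretched by an integer L >= (d + 1) / e, so that
    distances above e become larger than d + 1. It does not depend on n, so isolated points are a
    vanishing fraction of the sample. *)
Definition isolated_bound (e : R) : nat :=
  (((Num.truncn (d.+1%:R / e)).+1).+1 ^ d)%N.

Lemma card_isolated z e : 0 < e -> (forall i j, 0 <= tnth (z i) j <= 1) ->
  (#|[set i | far_from_others z e i]%SET| <= isolated_bound e)%N.
Proof.
move=> e0 z01; set L := (Num.truncn (d.+1%:R / e)).+1.
have Le : d.+1%:R <= L%:R * e.
  by rewrite -ler_pdivrMr// ltW// truncnS_gt.
apply: (card_cells (x := fun i j => tnth (z i) j * L%:R)).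
  move=> i j _; have /andP[h0 h1] := z01 i j.
  by rewrite mulr_ge0//= -[leRHS]mul1r ler_pM2r// ltr0n.
move=> i k; rewrite !inE => /forallP /(_ k) + _ ik.
rewrite eq_sym ik/= => far.
under eq_bigr do rewrite -mulrBl exprMn.
rewrite -mulr_suml -/(sqdist (z i) (z k)).
apply: (@le_lt_trans _ _ (e ^+ 2 * L%:R ^+ 2)); last first.
  by rewrite ltr_pM2r// exprn_gt0// ltr0n.
rewrite -exprMn [e * _]mulrC.
apply: (@le_trans _ _ (d.+1%:R ^+ 2)); last by rewrite ler_pXn2r// nnegrE// (le_trans _ Le).
rewrite -natrX ler_nat (@leq_trans d.+1)// -[X in (X <= _)%N]expn1.
by rewrite leq_pexp2l.
Qed.

(* The points less than [e] above the threshold [a] in normalised rank. *)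
Definition upper_neighbours x j (a e : R) : {set 'I_n} :=
  [set k | (a < tnth (x k) j) &&
    (\sum_l ((a < tnth (x l) j) && (tnth (x l) j <= tnth (x k) j))%R%:R
       <= n%:R * e)].

(** The member with the largest j-th coordinate counts the whole set, ties included, in its own sum,
    and that sum is at most n e. *)
Lemma card_upper_neighbours x j a e : 0 <= e ->
  #|upper_neighbours x j a e|%:R <= n%:R * e.
Proof.
move=> e0; have [->|] := eqVneq (upper_neighbours x j a e) finset.set0.
  by rewrite cards0 mulr_ge0.
case/set0Pn => k0 k0K.
have [k kK kmax] := @arg_maxP _ R _ k0 (fun k => k \in upper_neighbours x j a e)
  (fun k => tnth (x k) j) k0K.
move: (kK); rewrite inE => /andP[_]; apply: le_trans.
rewrite -sum1_card natr_sum big_mkcond/=; apply: ler_sum => l _.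
case: ifPn => // lK; rewrite ler1n lt0b; apply/andP; split; last exact: kmax.
by move: lK; rewrite inE => /andP[].
Qed.

(** Every point with coordinate in ]a, x_k] is counted in the rank of k and not in that of i,
    because x_i <= a. The inequality between counts holds whatever the atoms. *)
Lemma close_ranks x i k j a e : (0 < n)%N ->
  0 <= e -> sqdist (ranks x i) (ranks x k) <= e ^+ 2 ->
  tnth (x i) j <= a -> a < tnth (x k) j -> k \in upper_neighbours x j a e.
Proof.
move=> n0 e0 ike ia ak; rewrite inE ak/=.
have n0' : 0 < n%:R :> R by rewrite ltr0n.
have le_e : `|tnth (ranks x i) j - tnth (ranks x k) j| <= e.
  rewrite -(ler_pXn2r (n := 2)) ?nnegrE// real_normK ?num_real//.
  apply: le_trans ike; rewrite /sqdist (bigD1 j)//= lerDl.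
  by apply: sumr_ge0 => l _; exact: sqr_ge0.
rewrite mulrC -ler_pdivrMr//; apply: le_trans le_e.
rewrite distrC; apply: le_trans (ler_norm _).
rewrite !tnth_ranks -mulrBr mulrC ler_pM2l ?invr_gt0// -sumrB.
apply: ler_sum => l _; case: (leP (tnth (x l) j) (tnth (x i) j)) => li.
  have la := le_trans li ia.
  by rewrite ltNge la/= (le_trans la (ltW ak)) subrr.
by rewrite subr0; case: (a < _).
Qed.

(** Unless i is isolated, i and k are within rank distance e. The upper point of a separated pair
    may be either of them, hence one term for each. *)
Lemma nn_crossing x u i k j a e : (1 < n)%N -> 0 <= e ->
  k = nn (ranks x) u i ->
  ((tnth (x i) j <= a) != (tnth (x k) j <= a))%:R <=
  (far_from_others (ranks x) e i)%:R + (i \in upper_neighbours x j a e)%:R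
  + (k \in upper_neighbours x j a e)%:R :> R.
Proof.
move=> n1 e0 kE; have n0 := ltnW n1.
have [|/forallPn[l]] := boolP (far_from_others (ranks x) e i).
  by case: eqP; case: (i \in _); case: (k \in _); rewrite /= ?addr0; lra.
rewrite negb_imply -leNgt => /andP[li lie].
have ik : sqdist (ranks x i) (ranks x k) <= e ^+ 2.
  by rewrite kE; exact: le_trans (nn_le _ _ n1 li) lie.
have ki : sqdist (ranks x k) (ranks x i) <= e ^+ 2 by rewrite sqdistC.
case: (leP (tnth (x i) j) a) => ia; case: (leP (tnth (x k) j) a) => ka /=;
  rewrite ?addr_ge0//.
- by rewrite (close_ranks n0 e0 ik ia ka) addrC lerDl addr_ge0.
- by rewrite (close_ranks n0 e0 ki ka ia) add0r lerDl.
Qed.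

End Ranks.

(** * Measurability of ranks, candidates and neighbours *)

Section Measurability.
Context {R : realType} {dT : measure_display} {T : measurableType dT}.

Lemma measurable_forall (I : finType) (b : I -> T -> bool) :
  (forall i, measurable_fun setT (b i)) ->
  measurable_fun setT (fun w => [forall i, b i w]).
Proof.
move=> mb; have -> : (fun w => [forall i, b i w]) = fun w => \big[andb/true]_i b i w.
  by apply/funext => w; rewrite big_andE; apply: eq_forallb.
elim: (index_enum I) => [|i r ih].
  by under eq_fun do rewrite big_nil; exact: measurable_cst.
by under eq_fun do rewrite big_cons; exact: measurable_and.
Qed.

Lemma measurable_exists (I : finType) (b : I -> T -> bool) :
  (forall i, measurable_fun setT (b i)) ->
  measurable_fun setT (fun w => [exists i, b i w]).
Proof.
move=> mb; have -> : (fun w => [exists i, b i w]) = fun w => \big[orb/false]_i b i w.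
  by apply/funext => w; rewrite big_orE; apply: eq_existsb.
elim: (index_enum I) => [|i r ih].
  by under eq_fun do rewrite big_nil; exact: measurable_cst.
by under eq_fun do rewrite big_cons; exact: measurable_or.
Qed.

Lemma measurable_implb (b c : T -> bool) : measurable_fun setT b ->
  measurable_fun setT c -> measurable_fun setT (fun w => b w ==> c w).
Proof.
move=> mb mc; under eq_fun do rewrite implybE.
by apply: measurable_or => //; exact: measurable_neg.
Qed.

Lemma measurable_eqb_cst (b : T -> bool) (c : bool) : measurable_fun setT b ->
  measurable_fun setT (fun w => b w == c).
Proof.
move=> mb; case: c; first by under eq_fun do rewrite eqb_id.
by under eq_fun do rewrite eqbF_neg; exact: measurable_neg.
Qed.

Context {d n : nat}.
Variables (X : 'I_n -> T -> d.-tuple R) (U : 'I_n -> T -> R).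
Hypothesis mX : forall i, measurable_fun setT (X i).

Let x w : 'I_n -> d.-tuple R := fun i => X i w.
Let z w := ranks (x w).

Lemma measurable_coord i j : measurable_fun setT (fun w => tnth (X i w) j).
Proof. exact: (measurableT_comp (measurable_tnth j)). Qed.

Lemma measurable_bool_natr (b : T -> bool) : measurable_fun setT b ->
  measurable_fun setT (fun w => (b w)%:R : R).
Proof. by case/(bounded_rv_bool (R := R)). Qed.

Lemma measurable_ranks i j : measurable_fun setT (fun w => tnth (z w i) j).
Proof.
under eq_fun do rewrite /z tnth_ranks.
apply: measurable_funM => //; apply: measurable_sum => l.
apply: measurable_bool_natr.
by apply: measurable_fun_ler; exact: measurable_coord.
Qed.

Lemma measurable_sqdist i k : measurable_fun setT (fun w => sqdist (z w i) (z w k)).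
Proof.
apply: measurable_sum => j; apply: measurable_funX.
by apply: measurable_funB; exact: measurable_ranks.
Qed.

Lemma measurable_mem_cand i k : measurable_fun setT (fun w => k \in cand (z w) i).
Proof.
under eq_fun do rewrite inE.
apply: measurable_and => //; apply: measurable_forall => l.
apply: measurable_implb => //.
by apply: measurable_fun_ler; exact: measurable_sqdist.
Qed.

Lemma measurable_cand i c : measurable_fun setT (fun w => cand (z w) i == c).
Proof.
have -> : (fun w => cand (z w) i == c) =
    (fun w => [forall k, (k \in cand (z w) i) == (k \in c)]).
  apply/funext => w; apply/eqP/forallP => [-> //|h].
  by apply/setP => k; exact/eqP.
apply: measurable_forall => k; apply: measurable_eqb_cst.
exact: measurable_mem_cand.
Qed.

Lemma measurable_isolated e i : measurable_fun setT (fun w => far_from_others (z w) e i).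
Proof.
apply: measurable_forall => k; apply: measurable_implb => //.
by apply: measurable_fun_ltr => //; exact: measurable_sqdist.
Qed.

Lemma measurable_upper_neighbours j a e k :
  measurable_fun setT (fun w => k \in upper_neighbours (x w) j a e).
Proof.
under eq_fun do rewrite inE.
apply: measurable_and.
  by apply: measurable_fun_ltr => //; exact: measurable_coord.
apply: measurable_fun_ler => //; apply: measurable_sum => l.
apply: measurable_bool_natr; apply: measurable_and.
  by apply: measurable_fun_ltr => //; exact: measurable_coord.
by apply: measurable_fun_ler; exact: measurable_coord.
Qed.

Lemma measurable_slot m r (f : T -> R) : measurable_fun setT f ->
  measurable_fun setT (fun w => slot m r (f w)).
Proof.
move=> mf; apply: measurable_and; apply: measurable_or => //.
  exact: measurable_fun_ler.
exact: measurable_fun_ltr.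
Qed.

(** The candidate set takes finitely many values, and [nnE] describes the event on each. Only the
    draw of index i is required to be measurable and T is arbitrary, so the lemma also applies to
    sigma-algebras that omit another draw. *)
Lemma measurable_nn i k : measurable_fun setT (U i) -> (1 < n)%N ->
  measurable_fun setT (fun w => nn (z w) (fun l => U l w) i == k).
Proof.
move=> mU n1.
have -> : (fun w => nn (z w) (fun l => U l w) i == k) = fun w =>
    [exists c : {set 'I_n}, (cand (z w) i == c) &&
      ((k \in c) && slot #|c| (index k (enum c)) (U i w * #|c|%:R))].
  apply/funext => w; rewrite nnE//; apply/idP/existsP.
    by move=> h; exists (cand (z w) i); rewrite eqxx.
  by move=> [c /andP[/eqP <-]].
apply: measurable_exists => c; apply: measurable_and.
  exact: measurable_cand.
apply: measurable_and => //; apply: measurable_slot.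
exact: measurable_funM.
Qed.

Lemma measurable_weight i k : measurable_fun setT (fun w => weight (z w) i k).
Proof.
have -> : (fun w => weight (z w) i k) = fun w =>
    \sum_(c : {set 'I_n}) (cand (z w) i == c)%:R * ((k \in c)%:R / #|c|%:R).
  apply/funext => w; rewrite (bigD1 (cand (z w) i))//= eqxx mul1r big1 ?addr0//.
  by move=> c /negbTE; rewrite eq_sym => ->; rewrite mul0r.
apply: measurable_sum => c; apply: measurable_funM => //.
apply: measurable_bool_natr; exact: measurable_cand.
Qed.

End Measurability.

Section Uniform.
Context {R : realType}.

(** Within [0, 1] the slot lies in an interval of length 1/m. The upper bound suffices, since
    tie-breaking serves only to bound nonnegative expectations from above. *)
Lemma uniform_slot (m r : nat) : (r < m)%N ->
  (uniform_prob (@ltr01 R) [set u : R | slot m r (u * m%:R)] <= (m%:R^-1)%:E)%E.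
Proof.
move=> rm; have m0 : 0 < m%:R :> R by rewrite ltr0n (leq_trans _ rm).
rewrite /uniform_prob integral_uniform_pdf.
have ms : measurable_fun setT (fun u : R => slot m r (u * m%:R)).
  by apply: measurable_slot; exact: mulrr_measurable.
have mA : measurable ([set u : R | slot m r (u * m%:R)] `&` `[0%R, 1%R]).
  by apply: measurableI => //; exact: measurable_true_set.
rewrite (eq_integral (cst 1%E)); last first.
  move=> u; rewrite inE /= => -[_]; rewrite in_itv/= => h.
  by rewrite /uniform_pdf h subr0 invr1.
rewrite integral_cst// mul1e.
apply: (@le_trans _ _ (lebesgue_measure (`[(r%:R / m%:R : R), (r.+1%:R / m%:R)]%classic))).
  apply: le_measure; rewrite ?inE//.
  move=> u [/= us]; rewrite !in_itv/= => /andP[u0 u1].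
  rewrite ler_pdivrMr// ler_pdivlMr//.
  move/andP: us => [/orP h1 /orP h2]; apply/andP; split.
    by case: h1 => [/eqP ->|//]; rewrite mulr_ge0.
  case: h2 => [/eqP ->|/ltW//]; rewrite (ltn_predK rm).
  by rewrite ler_piMl.
rewrite lebesgue_measure_itv/= lte_fin ltr_pM2r ?invr_gt0// ltr_nat ltnS leqnn.
by rewrite -EFinB -mulrBl -natrB// subSnn mul1r.
Qed.

End Uniform.

(** * Neighbours in a random sample *)

Section Sample.
Context {R : realType} {d : nat}.
Context {dT0 : measure_display} {T0 : measurableType dT0} (P0 : probability T0 R).
Variables (X : {RV P0 >-> d.-tuple R}) (Y : {RV P0 >-> R}).
Context {dT : measure_display} {T : measurableType dT} (P : probability T R).
Variables (Xs : nat -> {RV P >-> d.-tuple R}) (Ys U : nat -> {RV P >-> R}).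
Hypothesis hcopies : forall (k : nat) (B : set (d.-tuple R * R)), measurable B ->
  P [set w | B (Xs k w, Ys k w)] = P0 [set w | B (X w, Y w)].
Hypothesis hunif : forall (k : nat) (B : set R), measurable B ->
  distribution P (U k) B = uniform_prob (@ltr01 R) B.
Hypothesis hindep : mutually_independent P (fun a : nat + nat =>
  match a with
  | inl k => g_sigma_algebra_preimage (fun w => (Xs k w, Ys k w))
  | inr k => g_sigma_algebra_preimage (U k)
  end).

Let mX k : measurable_fun setT (Xs k). Proof. exact: measurable_funPT. Qed.
Let mY k : measurable_fun setT (Ys k). Proof. exact: measurable_funPT. Qed.
Let mU k : measurable_fun setT (U k). Proof. exact: measurable_funPT. Qed.

Let mXY k : measurable_fun setT (fun w => (Xs k w, Ys k w)).
Proof. exact: measurable_fun_pair. Qed.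

Let mXY0 : measurable_fun setT (fun w => (X w, Y w)).
Proof. by apply: measurable_fun_pair; exact: measurable_funPT. Qed.

Lemma Ex_copy k (f : d.-tuple R * R -> R) : bounded_rv f ->
  Ex P (fun w => f (Xs k w, Ys k w)) = Ex P0 (fun w => f (X w, Y w)).
Proof.
move=> [mf [M fM]].
have bk : bounded_rv (fun w => f (Xs k w, Ys k w)).
  by split; [exact: measurableT_comp|exists M].
have b0 : bounded_rv (fun w => f (X w, Y w)).
  by split; [exact: measurableT_comp|exists M].
apply: EFin_inj; rewrite -!EFin_Ex//.
have := @integral_pushforward _ _ _ _ R _ (mXY k) P setT (EFin \o f).
rewrite preimage_setT => <-//; last 2 first.
- exact/measurable_EFinP.
- exact: bounded_rv_integrable.
have := @integral_pushforward _ _ _ _ R _ mXY0 P0 setT (EFin \o f).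
rewrite preimage_setT => <-//; last 2 first.
- exact/measurable_EFinP.
- exact: bounded_rv_integrable.
apply: eq_measure_integral => A mA _; exact: hcopies.
Qed.

Section FixedSize.
Variable n : nat.

Definition sample_sigma (a : 'I_n + 'I_n) : set (set T) :=
  match a with
  | inl k => g_sigma_algebra_preimage (fun w => (Xs k w, Ys k w))
  | inr k => g_sigma_algebra_preimage (U k)
  end.

Lemma sample_sigma_algebra a : sigma_algebra setT (sample_sigma a).
Proof.
by case: a => k; apply: sigma_algebra_preimage; exact: sigma_algebra_measurable.
Qed.

Lemma sample_sigma_measurable a : sample_sigma a `<=` measurable.
Proof.
case: a => k _ [B mB <-]; first exact: mXY.
exact: mU.
Qed.

Lemma sample_sigmaT a : sample_sigma a setT.
Proof.
by case: (sample_sigma_algebra a) => h0 hC _; rewrite -(setD0 setT); exact: hC.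
Qed.

Lemma sample_sigmaI a : setI_closed (sample_sigma a).
Proof.
move=> A B; rewrite -(sigma_algebra_id (sample_sigma_algebra a)).
exact: (@measurableI _ (g_sigma_algebraType (sample_sigma a))).
Qed.

(** Brings independence of the infinite family down to the finite index type of [indep_rest]; [A']
    extends A by the whole space to indices from n on. *)
Lemma sample_indep (A : 'I_n + 'I_n -> set T) :
  (forall a, sample_sigma a (A a)) ->
  P (\big[setI/setT]_a A a) = (\prod_a P (A a))%E.
Proof.
move=> hA.
pose inj (a : 'I_n + 'I_n) : nat + nat :=
  match a with inl k => inl (val k) | inr k => inr (val k) end.
pose A' (a : nat + nat) : set T := match a with
  | inl k => oapp (fun k' => A (inl k')) setT (insub k)
  | inr k => oapp (fun k' => A (inr k')) setT (insub k) end.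
have inj_inj : injective inj.
  by move=> [a|a] [b|b] //= [] /val_inj ->.
have A'E a : A' (inj a) = A a by case: a => a /=; rewrite valK.
have := @hindep (map inj (index_enum _)) A'.
rewrite !big_map; under eq_bigr do rewrite A'E.
move=> ->; first by apply: eq_bigr => a _; rewrite A'E.
  by rewrite map_inj_uniq// index_enum_uniq.
by move=> _ /mapP[a _ ->]; rewrite A'E; have := hA a; case: a.
Qed.

Definition sample_rest := rest sample_sigma.

Lemma sample_rest_measurable a : sample_rest a `<=` measurable.
Proof. exact/rest_measurable/sample_sigma_measurable. Qed.

Lemma sample_indep_rest a A B : <<s sample_sigma a >> A ->
  <<s sample_rest a >> B -> P (A `&` B) = (P A * P B)%E.
Proof.
rewrite (sigma_algebra_id (sample_sigma_algebra a)); apply: indep_rest.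
- exact: sample_sigma_measurable.
- exact: sample_sigmaT.
- exact: sample_sigmaI.
- exact: sample_indep.
Qed.

Lemma measurable_rest_pair a (k : 'I_n) : inl k != a ->
  measurable_fun [set: g_sigma_algebraType (sample_rest a)]
    (fun w => (Xs k w, Ys k w)).
Proof.
move=> ka; apply: measurable_fun_g_sigma => B mB.
by exists (inl k) => //; exists B => //; rewrite setTI.
Qed.

Lemma measurable_rest_X a (k : 'I_n) : inl k != a ->
  measurable_fun [set: g_sigma_algebraType (sample_rest a)] (Xs k).
Proof.
by move=> ka; exact: (measurableT_comp measurable_fst (measurable_rest_pair ka)).
Qed.

Lemma measurable_rest_Y a (k : 'I_n) : inl k != a ->
  measurable_fun [set: g_sigma_algebraType (sample_rest a)] (Ys k).
Proof.
by move=> ka; exact: (measurableT_comp measurable_snd (measurable_rest_pair ka)).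
Qed.

Lemma measurable_rest_U a (k : 'I_n) : inr k != a ->
  measurable_fun [set: g_sigma_algebraType (sample_rest a)] (U k).
Proof.
move=> ka; apply: measurable_fun_g_sigma => B mB.
by exists (inr k) => //; exists B => //; rewrite setTI.
Qed.

Lemma measurable_sigma_pair (k : 'I_n) :
  measurable_fun [set: g_sigma_algebraType (sample_sigma (inl k))]
    (fun w => (Xs k w, Ys k w)).
Proof.
by apply: measurable_fun_g_sigma => B mB; exists B => //; rewrite setTI.
Qed.

Lemma measurable_sigma_U (k : 'I_n) :
  measurable_fun [set: g_sigma_algebraType (sample_sigma (inr k))] (U k).
Proof.
by apply: measurable_fun_g_sigma => B mB; exists B => //; rewrite setTI.
Qed.

Lemma Ex_copy_mul (i k : 'I_n) (f g : d.-tuple R * R -> R) :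
  bounded_rv f -> bounded_rv g -> i != k ->
  Ex P (fun w => f (Xs i w, Ys i w) * g (Xs k w, Ys k w)) =
  Ex P0 (fun w => f (X w, Y w)) * Ex P0 (fun w => g (X w, Y w)).
Proof.
move=> bf bg ik; rewrite -(Ex_copy i bf) -(Ex_copy k bg).
case: bf bg => mf [M fM] [mg [L gL]].
apply: (Ex_indep_mul (@sample_sigma_measurable (inl i))
  (@sample_rest_measurable (inl i)) (@sample_indep_rest (inl i))).
- split; last by exists M.
  exact: (measurableT_comp mf (@measurable_sigma_pair i)).
- split; last by exists L.
  apply: (measurableT_comp mg); apply: measurable_rest_pair.
  by apply: contra ik => /eqP[->].
Qed.

Definition sample_X w : 'I_n -> d.-tuple R := fun k => Xs k w.
Definition sample_z w := ranks (sample_X w).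
Definition neighbour w (i : 'I_n) : 'I_n := nn (sample_z w) (fun k => U k w) i.

Lemma measurable_neighbour i k : (1 < n)%N ->
  measurable_fun setT (fun w => neighbour w i == k).
Proof. by move=> n1; apply: measurable_nn. Qed.

Lemma Ex_slot (i : 'I_n) m r : (r < m)%N ->
  Ex P (fun w => (slot m r (U i w * m%:R))%:R) <= m%:R^-1.
Proof.
move=> rm; have mS : measurable_fun setT (fun u : R => slot m r (u * m%:R)).
  by apply: measurable_slot; exact: mulrr_measurable.
rewrite -lee_fin Ex_bool; last exact: (measurableT_comp mS (mU i)).
apply: le_trans (uniform_slot rm); rewrite -(hunif i)//.
exact: measurable_true_set.
Qed.

(** On each value c of the candidate set, the slot event depends on [U i] alone, while h and the
    candidate set are functions of the rest. They are independent, and the slot has probability at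
    most 1/#|c|. Note that h may involve the other draws. *)
Lemma tie_breaking (i k : 'I_n) (h : T -> R) : (1 < n)%N ->
  @bounded_rv R _ (g_sigma_algebraType (sample_rest (inr i))) h ->
  (forall w, 0 <= h w) ->
  Ex P (fun w => h w * (neighbour w i == k)%:R) <=
  Ex P (fun w => h w * weight (sample_z w) i k).
Proof.
move=> n1 bh h0.
have bh' := bounded_rv_sub_sigma (@sample_rest_measurable (inr i)) bh.
pose D (c : {set 'I_n}) w : R := (cand (sample_z w) i == c)%:R.
have bD' c : @bounded_rv R _ (g_sigma_algebraType (sample_rest (inr i))) (D c).
  by apply: bounded_rv_bool; apply: measurable_cand => l; exact: measurable_rest_X.
have bD c := bounded_rv_sub_sigma (@sample_rest_measurable (inr i)) (bD' c).
pose V (c : {set 'I_n}) w : R := (slot #|c| (index k (enum c)) (U i w * #|c|%:R))%:R.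
have bV' c : @bounded_rv R _ (g_sigma_algebraType (sample_sigma (inr i))) (V c).
  apply: bounded_rv_bool; apply: measurable_slot.
  by apply: measurable_funM => //; exact: measurable_sigma_U.
have bV c := bounded_rv_sub_sigma (@sample_sigma_measurable (inr i)) (bV' c).
have bc := bounded_rv_cst (R := R) (T := T).
rewrite (eq_Ex _ (g := fun w => \sum_(c : {set 'I_n}) (k \in c)%:R * (V c w * (h w * D c w)))); last first.
  move=> w; rewrite (bigD1 (cand (sample_z w) i))//= big1 ?addr0; last first.
    by move=> c /negbTE cc; rewrite /D eq_sym cc !mulr0.
  rewrite /neighbour nnE// /D eqxx mulr1 -/(V (cand (sample_z w) i) w).
  by rewrite -mulnb natrM mulrC -/(V _ w); ring.
rewrite [leRHS](eq_Ex _ (g := fun w =>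
    \sum_(c : {set 'I_n}) (k \in c)%:R / #|c|%:R * (h w * D c w))); last first.
  move=> w; rewrite (bigD1 (cand (sample_z w) i))//= big1 ?addr0; last first.
    by move=> c /negbTE cc; rewrite /D eq_sym cc !mulr0.
  by rewrite /D eqxx mulr1 mulrC.
have bhD c : bounded_rv (fun w => h w * D c w) by exact: bounded_rvM.
have bVhD c : bounded_rv (fun w => V c w * (h w * D c w)) by exact: bounded_rvM.
rewrite !Ex_sum; try by move=> c _; apply: bounded_rvM.
apply: ler_sum => c _; rewrite !ExZ//.
have [kc|kc] := boolP (k \in c); last by rewrite !mul0r.
rewrite !mul1r.
rewrite (Ex_indep_mul (@sample_sigma_measurable (inr i))
  (@sample_rest_measurable (inr i)) (@sample_indep_rest (inr i)) (bV' c)); last first.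
  exact: bounded_rvM.
apply: ler_wpM2r; first by apply: Ex_ge0 => w; rewrite mulr_ge0.
by apply: Ex_slot; rewrite cardE index_mem mem_enum.
Qed.

(** * Noises given the points, and their second moment *)

Section Noise.
Variables (S : set R) (g : d.-tuple R -> R).
Hypothesis mS : measurable S.
Hypothesis bg : bounded_rv g.
Hypothesis gS : forall A, measurable A ->
  Ex P0 (fun w => ((Y w \in S)%:R - g (X w)) * (X w \in A)%:R) = 0.

Definition noise (i : 'I_n) w : R := (Ys i w \in S)%:R - g (Xs i w).

(** Generates everything in the sample except [Ys i]: the point [Xs i], the other pairs and all the
    draws. *)
Definition noise_context (i : 'I_n) : set (set T) :=
  g_sigma_algebra_preimage (Xs i) `|` sample_rest (inl i).

Lemma noise_context_measurable i : noise_context i `<=` measurable.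
Proof.
by move=> A [[B mB <-]|]; [exact: mX|exact: sample_rest_measurable].
Qed.

Let b_resid : @bounded_rv R _ (d.-tuple R * R)%type
  (fun p => (p.2 \in S)%:R - g p.1).
Proof.
apply: bounded_rvB.
  apply: bounded_rv_bool; apply: (measurableT_comp (measurable_mem mS)).
  exact: measurable_snd.
case: bg => mg [M gM]; split; last by exists M.
exact: (measurableT_comp mg measurable_fst).
Qed.

Lemma bounded_noise i : bounded_rv (noise i).
Proof.
case: b_resid => mr [M rM]; split; first exact: (measurableT_comp mr (mXY i)).
by exists M => w; exact: (rM (_, _)).
Qed.

Lemma Ex_noise_rect i A B : measurable A -> <<s sample_rest (inl i) >> B ->
  Ex P (fun w => noise i w * (w \in (Xs i @^-1` A) `&` B)%:R) = 0.
Proof.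
move=> mA sB; have mB := sub_sigma_measurable (@sample_rest_measurable (inl i)) sB.
have bA : @bounded_rv R _ (d.-tuple R * R)%type (fun p => (p.1 \in A)%:R).
  apply: bounded_rv_bool; apply: (measurableT_comp (measurable_mem mA)).
  exact: measurable_fst.
have brA := bounded_rvM b_resid bA.
rewrite (eq_Ex _ (g := fun w => (noise i w * (Xs i w \in A)%:R) * (w \in B)%:R)).
  rewrite (Ex_indep_mul (@sample_sigma_measurable (inl i))
    (@sample_rest_measurable (inl i)) (@sample_indep_rest (inl i))).
  - by rewrite (Ex_copy i brA) gS// mul0r.
  - case: brA => mr [M rM]; split; last by exists M => w; exact: (rM (_, _)).
    exact: (measurableT_comp mr (@measurable_sigma_pair i)).
  - apply: bounded_rv_bool.
    exact: (@measurable_mem _ (g_sigma_algebraType (sample_rest (inl i)))).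
by move=> w; rewrite in_setI -mulrA -natrM mulnb; congr (_ * (_ && _)%:R); rewrite !in_setE.
Qed.

(** The noise of i is centred given its whole context. On rectangles, built from an event of [Xs i]
    and an event of the rest, this is independence combined with the defining property of g;
    rectangles form a generating pi-system. *)
Lemma noise_orthogonal i (h : T -> R) :
  @bounded_rv R _ (g_sigma_algebraType (noise_context i)) h ->
  Ex P (fun w => noise i w * h w) = 0.
Proof.
apply: (Ex_orthogonal (@noise_context_measurable i) (bounded_noise i)) => A sA.
pose K := [set E | exists A B, [/\ measurable A, <<s sample_rest (inl i) >> B &
  E = (Xs i @^-1` A) `&` B]].
have sT : <<s sample_rest (inl i) >> setT.
  exact: (@measurableT _ (g_sigma_algebraType (sample_rest (inl i)))).
have KA : <<s K >> A.
  suff: <<s noise_context i >> `<=` <<s K >> by apply.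
  apply: smallest_sub; first exact: smallest_sigma_algebra.
  move=> E [[B mB <-]|rE]; apply: sub_sigma_algebra.
    by exists B, setT; split => //; rewrite setIT setTI.
  exists setT, E; split => //; first exact: sub_sigma_algebra.
  by rewrite preimage_setT setTI.
apply: (orthogonal_g_sigma (bounded_noise i)) KA.
- move=> _ [B [E [mB sE ->]]]; apply: measurableI.
    by rewrite -[_ @^-1` _]setTI; exact: mX.
  exact: sub_sigma_measurable (@sample_rest_measurable (inl i)) _ sE.
- move=> _ _ [A1 [B1 [mA1 sB1 ->]]] [A2 [B2 [mA2 sB2 ->]]].
  exists (A1 `&` A2), (B1 `&` B2); split; first exact: measurableI.
    exact: (@measurableI _ (g_sigma_algebraType (sample_rest (inl i)))).
  by rewrite preimage_setI setIACA.
- rewrite -[RHS](Ex_noise_rect (i := i) measurableT sT).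
  by apply: eq_Ex => w; rewrite preimage_setT setTI in_setT mulr1.
- by move=> _ [B [E [mB sE ->]]]; exact: Ex_noise_rect.
Qed.

End Noise.

Let bcst := bounded_rv_cst (R := R) (T := T).

(** Replaces a random index by a sum over fixed indices, to which measurability, independence and
    linearity apply. *)
Lemma sum_neighbour w i (h : 'I_n -> R) :
  h (neighbour w i) = \sum_k h k * (neighbour w i == k)%:R.
Proof.
rewrite (bigD1 (neighbour w i))//= eqxx mulr1 big1 ?addr0// => k /negbTE.
by rewrite eq_sym => ->; rewrite mulr0.
Qed.

Lemma bounded_neighbour i k : (1 < n)%N ->
  bounded_rv (fun w => (neighbour w i == k)%:R : R).
Proof. by move=> n1; apply: bounded_rv_bool; exact: measurable_neighbour. Qed.

Lemma bounded_at_neighbour i (h : 'I_n -> T -> R) : (1 < n)%N ->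
  (forall k, bounded_rv (h k)) -> bounded_rv (fun w => h (neighbour w i) w).
Proof.
move=> n1 bh; under eq_fun do rewrite (sum_neighbour _ _ (h ^~ _)).
by apply: bounded_rv_sum => k _; apply: bounded_rvM => //; exact: bounded_neighbour.
Qed.

Lemma bounded_weight i k : bounded_rv (fun w => weight (sample_z w) i k).
Proof.
split; first by apply: measurable_weight => l.
exists 1 => w; rewrite ger0_norm ?weight_ge0// (le_trans (weight_le _ _ _))//.
by case: (_ \in _).
Qed.

(** [tie_breaking] turns neighbour indicators into weights; after exchanging the sums, [weight_sum]
    bounds the total weight received by each k. The functions must avoid [U i] for every i, as
    functions of the data do. *)
Lemma stone (h : 'I_n -> T -> R) : (1 < n)%N ->
  (forall i k, @bounded_rv R _ (g_sigma_algebraType (sample_rest (inr i))) (h k)) ->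
  (forall k w, 0 <= h k w) ->
  Ex P (fun w => \sum_i h (neighbour w i) w) <=
  @stone_cst R d * \sum_k Ex P (h k).
Proof.
move=> n1 bh h0.
have bh' k : bounded_rv (h k).
  exact: (bounded_rv_sub_sigma (@sample_rest_measurable (inr k)) (bh k k)).
rewrite Ex_sum; last by move=> i _; exact: bounded_at_neighbour.
apply: (@le_trans _ _ (\sum_i \sum_k Ex P (fun w => h k w * weight (sample_z w) i k))).
  apply: ler_sum => i _; rewrite (eq_Ex _ (fun w => sum_neighbour w i (h ^~ w))).
  rewrite Ex_sum; last by move=> k _; apply: bounded_rvM => //; exact: bounded_neighbour.
  by apply: ler_sum => k _; exact: tie_breaking.
rewrite exchange_big mulr_sumr; apply: ler_sum => k _.
rewrite -Ex_sum; last by move=> i _; apply: bounded_rvM => //; exact: bounded_weight.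
rewrite -ExZ//; apply: le_Ex.
- by apply: bounded_rv_sum => i _; apply: bounded_rvM => //; exact: bounded_weight.
- exact: bounded_rvM.
- by move=> w; rewrite -mulr_sumr mulrC ler_wpM2r// weight_sum.
Qed.

(** The event that k is the neighbour of i' involves the draw of i', so [stone] does not apply as it
    stands. For i != i' it still avoids [U i], so [tie_breaking] applies term by term; this is why
    i' is left out of the sum. *)
Lemma shared_neighbour (i' : 'I_n) : (1 < n)%N ->
  Ex P (fun w => \sum_(i | i != i') (neighbour w i == neighbour w i')%:R) <=
  @stone_cst R d.
Proof.
move=> n1.
have bN := bounded_neighbour _ _ n1; have bw := bounded_weight.
rewrite (eq_Ex _ (g := fun w => \sum_(i | i != i') \sum_k
    (neighbour w i' == k)%:R * (neighbour w i == k)%:R)); last first.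
  move=> w; apply: eq_bigr => i _.
  by rewrite (sum_neighbour w i (fun k => (k == neighbour w i')%:R));
    apply: eq_bigr => k _; rewrite eq_sym.
rewrite Ex_sum; last first.
  by move=> i _; apply: bounded_rv_sum => k _; exact: bounded_rvM.
apply: (@le_trans _ _ (\sum_(i | i != i') \sum_k
    Ex P (fun w => (neighbour w i' == k)%:R * weight (sample_z w) i k))).
  apply: ler_sum => i ii'; rewrite Ex_sum; last by move=> k _; exact: bounded_rvM.
  apply: ler_sum => k _; apply: tie_breaking => //.
  apply: bounded_rv_bool; apply: measurable_nn => //.
    by move=> l; exact: measurable_rest_X.
  by apply: measurable_rest_U; apply: contra ii' => /eqP[->].
rewrite exchange_big.
apply: (@le_trans _ _ (\sum_k @stone_cst R d * Ex P (fun w => (neighbour w i' == k)%:R))).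
  apply: ler_sum => k _.
  rewrite -Ex_sum; last by move=> i _; exact: bounded_rvM.
  rewrite -ExZ//; apply: le_Ex; [|exact: bounded_rvM|].
    by apply: bounded_rv_sum => i _; exact: bounded_rvM.
  move=> w; rewrite -mulr_sumr mulrC ler_wpM2r//.
  apply: le_trans (weight_sum (sample_z w) k).
  rewrite [leRHS](bigID (fun i => i != i'))/= lerDl.
  by apply: sumr_ge0 => i _; exact: weight_ge0.
rewrite -mulr_sumr -Ex_sum//.
rewrite (eq_Ex _ (g := fun=> 1)) ?Ex_cst ?mulr1// => w.
by have := sum_neighbour w i' (fun=> 1); under eq_bigr do rewrite mul1r.
Qed.

Lemma measurable_context_X i (k : 'I_n) :
  measurable_fun [set: g_sigma_algebraType (noise_context i)] (Xs k).
Proof.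
apply: measurable_fun_g_sigma => B mB.
have [->|ki] := eqVneq k i; first by left; exists B => //; rewrite setTI.
right; exists (inl k); first by apply: contra ki => /eqP[->].
exists ([set p | B p.1]); last by rewrite setTI.
by rewrite -[X in measurable X]setTI; exact: measurable_fst.
Qed.

Lemma measurable_context_rest i d' (T' : measurableType d') (f : T -> T') :
  measurable_fun [set: g_sigma_algebraType (sample_rest (inl i))] f ->
  measurable_fun [set: g_sigma_algebraType (noise_context i)] f.
Proof.
move=> mf _ B mB; have := mf measurableT B mB; rewrite !setTI.
suff h : <<s sample_rest (inl i) >> `<=` <<s noise_context i >> by exact: h.
apply: smallest_sub; first exact: smallest_sigma_algebra.
by move=> A rA; apply: sub_sigma_algebra; right.
Qed.

Lemma measurable_context_U i k :
  measurable_fun [set: g_sigma_algebraType (noise_context i)] (U (k : 'I_n)).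
Proof. by apply: measurable_context_rest; exact: measurable_rest_U. Qed.

Lemma measurable_context_Y i (k : 'I_n) : k != i ->
  measurable_fun [set: g_sigma_algebraType (noise_context i)] (Ys k).
Proof.
move=> ki; apply: measurable_context_rest; apply: measurable_rest_Y.
by apply: contra ki => /eqP[->].
Qed.

Section SecondMoment.
Variables (S : set R) (g : d.-tuple R -> R).
Hypothesis n1 : (1 < n)%N.
Hypothesis mS : measurable S.
Hypothesis mg : measurable_fun setT g.
Hypothesis g01 : forall x, 0 <= g x <= 1.
Hypothesis gS : forall A, measurable A ->
  Ex P0 (fun w => ((Y w \in S)%:R - g (X w)) * (X w \in A)%:R) = 0.

Let bg : bounded_rv g.
Proof. by split=> //; exists 1 => x; have /andP[? ?] := g01 x; rewrite ger0_norm. Qed.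

Definition pair_noise (i k : 'I_n) w : R :=
  (Ys i w \in S)%:R * (Ys k w \in S)%:R - g (Xs i w) * g (Xs k w).

Lemma pair_noise_le1 i k w : `|pair_noise i k w| <= 1.
Proof.
have /andP[a0 a1] := g01 (Xs i w); have /andP[c0 c1] := g01 (Xs k w).
have ac0 := mulr_ge0 a0 c0; have ac1 := mulr_ile1 a0 c0 a1 c1.
rewrite /pair_noise ler_norml.
by case: (_ \in S); case: (_ \in S); rewrite /= ?mulr1 ?mulr0; apply/andP; split; lra.
Qed.

Section Context.
Context {d' : measure_display} {T' : measurableType d'} (iota : T' -> T).

(** [iota] is meant to be the identity from T, possibly equipped with a coarser sigma-algebra, so
    that one lemma serves both the ambient space and the noise contexts. *)
Lemma bounded_mark (i : 'I_n) : measurable_fun setT (Ys i \o iota) ->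
  bounded_rv (fun w => (Ys i (iota w) \in S)%:R : R).
Proof.
move=> mYi; apply: bounded_rv_bool; exact: (measurableT_comp (measurable_mem mS) mYi).
Qed.

Lemma bounded_regr (i : 'I_n) : measurable_fun setT (Xs i \o iota) ->
  bounded_rv (fun w => g (Xs i (iota w))).
Proof.
move=> mXi; case: bg => _ [M gM]; split; last by exists M.
exact: (measurableT_comp mg mXi).
Qed.

End Context.

Lemma bounded_pair_noise i k : bounded_rv (pair_noise i k).
Proof.
split; last by exists 1; exact: pair_noise_le1.
have h1 := (@bounded_mark _ _ id i (mY i)).
have h2 := (@bounded_mark _ _ id k (mY k)).
have h3 := (@bounded_regr _ _ id i (mX i)).
have h4 := (@bounded_regr _ _ id k (mX k)).
by case: (bounded_rvB (bounded_rvM h1 h2) (bounded_rvM h3 h4)).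
Qed.

Lemma pair_noise_orthogonal (i k i' k' : 'I_n) :
  k != i -> i' != i -> k' != i -> i' != k -> k' != k ->
  Ex P (fun w => (neighbour w i == k)%:R * (neighbour w i' == k')%:R *
                 (pair_noise i k w * pair_noise i' k' w)) = 0.
Proof.
move=> ki i'i k'i i'k k'k.
pose Z w : R := (neighbour w i == k)%:R * (neighbour w i' == k')%:R * pair_noise i' k' w.
have bZ j : i' != j -> k' != j ->
    @bounded_rv R _ (g_sigma_algebraType (noise_context j)) Z.
  move=> i'j k'j.
  have bN l m : @bounded_rv R _ (g_sigma_algebraType (noise_context j))
      (fun w => (neighbour w l == m)%:R).
    apply: bounded_rv_bool; apply: measurable_nn => //.
      by move=> o; exact: measurable_context_X.
    exact: measurable_context_U.
  apply: bounded_rvM; first exact: bounded_rvM.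
  by apply: bounded_rvB; apply: bounded_rvM;
    do ?[apply: (@bounded_mark _ (g_sigma_algebraType (noise_context j)) id);
         exact: measurable_context_Y
        |apply: (@bounded_regr _ (g_sigma_algebraType (noise_context j)) id);
         exact: measurable_context_X].
have b1 : @bounded_rv R _ (g_sigma_algebraType (noise_context i))
    (fun w => (Ys k w \in S)%:R * Z w).
  apply: bounded_rvM; last exact: bZ.
  apply: (@bounded_mark _ (g_sigma_algebraType (noise_context i)) id).
  exact: measurable_context_Y.
have b2 : @bounded_rv R _ (g_sigma_algebraType (noise_context k))
    (fun w => g (Xs i w) * Z w).
  apply: bounded_rvM; last exact: bZ.
  apply: (@bounded_regr _ (g_sigma_algebraType (noise_context k)) id).
  exact: measurable_context_X.
(* From ab - a'b' = (a - a')b + a'(b - b'): each noise multiplies a function of its own context,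
   since neighbours depend on points and draws only and the other pair avoids both i and k. *)
rewrite (eq_Ex _ (g := fun w => noise S g i w * ((Ys k w \in S)%:R * Z w) +
  noise S g k w * (g (Xs i w) * Z w))); last first.
  by move=> w; rewrite /Z /noise /pair_noise; ring.
rewrite ExD; last 2 first.
- apply: bounded_rvM; first exact: bounded_noise.
  exact: (bounded_rv_sub_sigma (@noise_context_measurable i) b1).
- apply: bounded_rvM; first exact: bounded_noise.
  exact: (bounded_rv_sub_sigma (@noise_context_measurable k) b2).
by rewrite !(noise_orthogonal mS bg gS)// addr0.
Qed.

(** At least 1 as soon as the pairs {i, k} and {i', k'} meet. The last term excludes i = i', the
    case left out by [shared_neighbour] and already counted by the first term. *)
Definition overlap (i k i' k' : 'I_n) : R :=
  (i == i')%:R + (i == k')%:R + (k == i')%:R + ((i != i') && (k == k'))%:R.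

Lemma overlap_ge0 i k i' k' : 0 <= overlap i k i' k'.
Proof. by rewrite !addr_ge0. Qed.

Lemma bounded_NN i k i' k' :
  bounded_rv (fun w => (neighbour w i == k)%:R * (neighbour w i' == k')%:R : R).
Proof. by apply: bounded_rvM; exact: bounded_neighbour. Qed.

Lemma pair_noise_overlap (i k i' k' : 'I_n) :
  Ex P (fun w => (neighbour w i == k)%:R * (neighbour w i' == k')%:R *
                 (pair_noise i k w * pair_noise i' k' w)) <=
  Ex P (fun w => (neighbour w i == k)%:R * (neighbour w i' == k')%:R *
                 overlap i k i' k').
Proof.
have bn := bounded_rvM (bounded_pair_noise i k) (bounded_pair_noise i' k').
have [ki|ki] := eqVneq k i.
  rewrite !(eq_Ex _ (g := fun=> 0)) ?Ex_cst// => w;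
  by rewrite ki (negbTE (nn_neq _ _ _ n1)) !mul0r.
have b1 := bounded_rvM (bounded_NN i k i' k') bn.
have b2 := bounded_rvM (bounded_NN i k i' k') (bcst (overlap i k i' k')).
have [/and4P[h1 h2 h3 h4]|h] := boolP [&& i != i', i != k', k != i' & k != k'].
  rewrite pair_noise_orthogonal//; do 1?by rewrite eq_sym.
  by apply: Ex_ge0 => w; rewrite !mulr_ge0// overlap_ge0.
apply: le_Ex => // w; apply: ler_wpM2l; first by rewrite mulr_ge0.
apply: (@le_trans _ _ 1).
  apply: le_trans (ler_norm _) _; rewrite normrM.
  by rewrite mulr_ile1 ?pair_noise_le1.
move: h; rewrite /overlap !negb_and !negbK.
case: (i == i') => /=; case: (i == k') => /=; case: (k == i') => /=;
  case: (k == k') => //= _; lra.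
Qed.

Lemma sum_pair_neighbour w i i' (h : 'I_n -> 'I_n -> R) :
  h (neighbour w i) (neighbour w i') =
  \sum_k \sum_k' (neighbour w i == k)%:R * (neighbour w i' == k')%:R * h k k'.
Proof.
rewrite (sum_neighbour w i (h ^~ (neighbour w i'))); apply: eq_bigr => k _.
rewrite (sum_neighbour w i' (h k)) mulr_suml; apply: eq_bigr => k' _.
by rewrite mulrC [h k k' * _]mulrC mulrA.
Qed.

Definition neighbour_noise i w : R := pair_noise i (neighbour w i) w.

Lemma bounded_neighbour_noise i : bounded_rv (neighbour_noise i).
Proof. by apply: bounded_at_neighbour => // k; exact: bounded_pair_noise. Qed.

Lemma neighbour_noise_overlap i i' :
  Ex P (fun w => neighbour_noise i w * neighbour_noise i' w) <=
  Ex P (fun w => overlap i (neighbour w i) i' (neighbour w i')).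
Proof.
have bn k k' := bounded_rvM (bounded_pair_noise i k) (bounded_pair_noise i' k').
have b1 k k' := bounded_rvM (bounded_NN i k i' k') (bn k k').
have b2 k k' := bounded_rvM (bounded_NN i k i' k') (bcst (overlap i k i' k')).
rewrite (eq_Ex _ (fun w => sum_pair_neighbour w i i'
  (fun k k' => pair_noise i k w * pair_noise i' k' w))).
rewrite [leRHS](eq_Ex _ (fun w => sum_pair_neighbour w i i' (fun k k' => overlap i k i' k'))).
rewrite !Ex_sum; do 1?by move=> k _; apply: bounded_rv_sum.
apply: ler_sum => k _; rewrite !Ex_sum//.
by apply: ler_sum => k' _; exact: pair_noise_overlap.
Qed.

Lemma neighbour_noise_L2 :
  Ex P (fun w => (\sum_i neighbour_noise i w) ^+ 2) <=
  n%:R * (3 + @stone_cst R d).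
Proof.
have bN i k := bounded_neighbour i k n1.
have bD := bounded_neighbour_noise.
have b3 i : bounded_rv (fun w => \sum_(i' | i' != i) (neighbour w i' == neighbour w i)%:R : R).
  apply: bounded_rv_sum => k _.
  apply: (@bounded_at_neighbour k (fun l w => (l == neighbour w i)%:R)) => // l.
  by under eq_fun do rewrite eq_sym.
rewrite (eq_Ex _ (g := fun w => \sum_i \sum_i' neighbour_noise i w * neighbour_noise i' w)); last first.
  by move=> w; rewrite expr2 mulr_suml; apply: eq_bigr => i _; rewrite mulr_sumr.
rewrite Ex_sum; last by move=> i _; apply: bounded_rv_sum => k _; exact: bounded_rvM.
apply: (@le_trans _ _ (\sum_i \sum_i' Ex P (fun w =>
    overlap i (neighbour w i) i' (neighbour w i')))).
  apply: ler_sum => i _; rewrite Ex_sum; last by move=> k _; exact: bounded_rvM.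
  by apply: ler_sum => k _; exact: neighbour_noise_overlap.
have one (k : 'I_n) : \sum_l (l == k)%:R = 1 :> R.
  by rewrite (bigD1 k)//= eqxx big1 ?addr0// => l /negbTE ->.
have one' (k : 'I_n) : \sum_l (k == l)%:R = 1 :> R.
  by under eq_bigr do rewrite eq_sym; exact: one.
have bNN i k : bounded_rv (fun w => (neighbour w i == neighbour w k)%:R : R).
  apply: (@bounded_at_neighbour k (fun l w => (neighbour w i == l)%:R)) => // l.
have bo i k : bounded_rv (fun w => overlap i (neighbour w i) k (neighbour w k)).
  have e1 : bounded_rv (fun w => (i == neighbour w k)%:R : R).
    by under eq_fun do rewrite eq_sym.
  have e2 : bounded_rv (fun w => ((i != k) && (neighbour w i == neighbour w k))%:R : R).
    by case: (i != k) => //=; exact: bcst.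
  by apply: bounded_rvD => //; apply: bounded_rvD => //; exact: bounded_rvD.
rewrite (eq_bigr (fun i => Ex P (fun w =>
    \sum_i' overlap i (neighbour w i) i' (neighbour w i')))); last first.
  by move=> i _; rewrite Ex_sum.
rewrite -Ex_sum; last by move=> i _; exact: bounded_rv_sum.
(* Each of the first three coincidences is realised by exactly n pairs (i, i'), every index having
   exactly one neighbour; the fourth is left to [shared_neighbour]. *)
rewrite (eq_Ex _ (g := fun w => n%:R * 3 +
    \sum_k \sum_(i | i != k) (neighbour w i == neighbour w k)%:R)); last first.
  move=> w; have cn : \sum_(i < n) 1 = n%:R :> R by rewrite sumr_const card_ord.
  under eq_bigr do rewrite /overlap !big_split/= one' one'.
  rewrite !big_split/= [X in _ + X]exchange_big cn/=.
  rewrite [X in _ + X + _ + _]exchange_big/=; under [X in _ + X + _ + _]eq_bigr do rewrite one.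
  rewrite cn; congr (_ + _); first by ring.
  apply: eq_bigr => k _; rewrite [RHS]big_mkcond; apply: eq_bigr => i _.
  by case: (i != k).
rewrite ExD//; last by apply: bounded_rv_sum.
rewrite Ex_cst [leRHS]mulrDr; apply: lerD => //; rewrite Ex_sum//.
apply: (@le_trans _ _ (\sum_(k < n) @stone_cst R d)).
  by apply: ler_sum => k _; exact: shared_neighbour.
by rewrite sumr_const card_ord mulr_natl.
Qed.


End SecondMoment.

Lemma sample_sum_L2 (f : d.-tuple R * R -> R) (M : R) : bounded_rv f ->
  (forall p, `|f p| <= M) -> Ex P0 (fun w => f (X w, Y w)) = 0 ->
  Ex P (fun w => (\sum_(i < n) f (Xs i w, Ys i w)) ^+ 2) <= n%:R * M ^+ 2.
Proof.
move=> bf fM f0.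
have bfk (i : 'I_n) : bounded_rv (fun w => f (Xs i w, Ys i w)).
  by case: bf => mf _; split; [exact: measurableT_comp|exists M].
rewrite (eq_Ex _ (g := fun w => \sum_(i < n) \sum_(k < n)
    f (Xs i w, Ys i w) * f (Xs k w, Ys k w))); last first.
  by move=> w; rewrite expr2 mulr_suml; apply: eq_bigr => i _; rewrite mulr_sumr.
rewrite Ex_sum; last by move=> i _; apply: bounded_rv_sum => k _; exact: bounded_rvM.
rewrite mulr_natl -[X in _ <= _ *+ X]card_ord -sumr_const; apply: ler_sum => i _.
rewrite Ex_sum; last by move=> k _; exact: bounded_rvM.
rewrite (bigD1 i)//= big1 ?addr0; last first.
  by move=> k ki; rewrite Ex_copy_mul// ?f0 ?mul0r// eq_sym.
apply: Ex_le_cst => [|w]; first exact: bounded_rvM.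
by rewrite -expr2 -real_normK ?num_real// ler_pXn2r// ?nnegrE// (le_trans _ (fM point)).
Qed.

End FixedSize.

Let C : R := @stone_cst R d.

Let bcst := bounded_rv_cst (R := R) (T := T).

Lemma lln (f : d.-tuple R * R -> R) : bounded_rv f ->
  vanishing (fun n => Ex P (fun w =>
    `|n%:R^-1 * \sum_(i < n) f (Xs i w, Ys i w) - Ex P0 (fun w => f (X w, Y w))|)).
Proof.
move=> bf; set m := Ex P0 _; have [mf [M fM]] := bf.
have bfk (i : nat) : bounded_rv (fun w => f (Xs i w, Ys i w)).
  by split; [exact: measurableT_comp|exists M].
have b0 : bounded_rv (fun w => f (X w, Y w)).
  by split; [exact: measurableT_comp|exists M].
apply: (vanishing_L1_of_L2 (k := 0%N)).
  move=> n _; apply: bounded_rvB => //; apply: bounded_rvM => //.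
  by apply: bounded_rv_sum => i _; exact: bfk.
apply: (vanishing_le (k := 1%N)) (vanishing_inv ((M + `|m|) ^+ 2)) => n n0.
have nn0 : n%:R != 0 :> R by rewrite pnatr_eq0 -lt0n.
pose f0 p := f p - m.
have bf0 : bounded_rv f0 by apply: bounded_rvB => //; exact: bounded_rv_cst.
rewrite (eq_Ex _ (g := fun w => n%:R^-1 ^+ 2 * (\sum_(i < n) f0 (Xs i w, Ys i w)) ^+ 2)).
  rewrite ExZ; last first.
    apply: bounded_rvX; apply: bounded_rv_sum => i _.
    by apply: bounded_rvB.
  apply: (@le_trans _ _ (n%:R^-1 ^+ 2 * (n%:R * (M + `|m|) ^+ 2))).
    apply: ler_wpM2l; first exact: sqr_ge0.
    apply: sample_sum_L2 => //.
      by move=> p; rewrite (le_trans (ler_normB _ _))// lerD.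
    by rewrite ExB ?Ex_cst ?subrr//; exact: bounded_rv_cst.
  rewrite le_eqVlt; apply/orP; left; apply/eqP; field; exact: nn0.
move=> w; rewrite -exprMn; congr (_ ^+ 2).
rewrite /f0 sumrB mulrBr sumr_const card_ord; congr (_ - _).
by rewrite -[X in _ = _ * X]mulr_natl mulKf.
Qed.

(** * Sets that rarely separate a point from its neighbour *)

Definition crossing n (A : set (d.-tuple R)) w : R := n%:R^-1 *
  \sum_(i < n) ((Xs i w \in A) != (Xs (neighbour w i) w \in A))%:R.

Definition few_crossings (A : set (d.-tuple R)) :=
  measurable A /\ vanishing (fun n => Ex P (crossing n A)).

Lemma bounded_memX (k : nat) A : measurable A ->
  bounded_rv (fun w => (Xs k w \in A)%:R : R).
Proof.
by move=> mA; apply: bounded_rv_bool; exact: (measurableT_comp (measurable_mem mA) (mX k)).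
Qed.

Lemma bounded_crossing n A : (1 < n)%N -> measurable A -> bounded_rv (crossing n A).
Proof.
move=> n1 mA; apply: bounded_rvM => //; apply: bounded_rv_sum => i _.
apply: (@bounded_at_neighbour n i (fun k w => ((Xs i w \in A) != (Xs k w \in A))%:R)) => // k.
rewrite (_ : (fun w => _) = fun w => `|(Xs i w \in A)%:R - (Xs k w \in A)%:R|).
  by apply: bounded_rv_norm; apply: bounded_rvB; exact: bounded_memX.
by apply/funext => w; rewrite normB_bool.
Qed.

Lemma stone_mem n (A : set (d.-tuple R)) : (1 < n)%N -> measurable A ->
  Ex P (fun w => n%:R^-1 * \sum_(i < n) (Xs (neighbour w i) w \in A)%:R) <=
  C * Ex P0 (fun w => (X w \in A)%:R).
Proof.
move=> n1 mA; have n0 : 0 < n%:R :> R by rewrite ltr0n ltnW.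
rewrite ExZ; last first.
  apply: bounded_rv_sum => i _.
  by apply: (@bounded_at_neighbour n i (fun k w => (Xs k w \in A)%:R)) => // k; exact: bounded_memX.
rewrite mulrC ler_pdivrMr//.
apply: le_trans (stone (h := fun k w => (Xs k w \in A)%:R) n1 _ _) _ => //.
  move=> i k; apply: bounded_rv_bool.
  by apply: (measurableT_comp (measurable_mem mA)); exact: measurable_rest_X.
rewrite -mulrA ler_wpM2l ?stone_cst_ge0//.
have bA : @bounded_rv R _ (d.-tuple R * R)%type (fun p => (p.1 \in A)%:R).
  apply: bounded_rv_bool; apply: (measurableT_comp (measurable_mem mA)).
  exact: measurable_fst.
rewrite (eq_bigr (fun=> Ex P0 (fun w => (X w \in A)%:R))).
  by rewrite sumr_const card_ord -[leLHS]mulr_natr.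
by move=> k _; exact: (Ex_copy k bA).
Qed.

Lemma few_crossings_halfspace (j : 'I_d) (a : R) :
  few_crossings [set x | tnth x j <= a].
Proof.
have mA : measurable [set x : d.-tuple R | tnth x j <= a].
  apply: (@measurable_true_set _ _ (fun x : d.-tuple R => tnth x j <= a)).
  by apply: measurable_fun_ler => //; exact: measurable_tnth.
split=> //; apply: (vanishing_approx (c := 1 + C)); first by rewrite addr_ge0// stone_cst_ge0.
move=> e e0; exists 2%N, (fun n => (@isolated_bound R d e)%:R / n%:R); split.
  exact: vanishing_inv.
move=> n n1; have n0 : 0 < n%:R :> R by rewrite ltr0n ltnW.
pose I w (i : 'I_n) : R := (far_from_others (sample_z w) e i)%:R.
pose K w (k : 'I_n) : R := (k \in upper_neighbours (@sample_X n w) j a e)%:R.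
have bI i : bounded_rv (I ^~ i).
  by apply: bounded_rv_bool; apply: measurable_isolated.
have bK k : bounded_rv (K ^~ k).
  by apply: bounded_rv_bool; apply: measurable_upper_neighbours.
have bKN i : bounded_rv (fun w => K w (neighbour w i)).
  exact: (@bounded_at_neighbour n i (fun k w => K w k)).
rewrite (_ : _ + _ = n%:R^-1 * ((@isolated_bound R d e)%:R + n%:R * e + C * (n%:R * e))); last first.
  by field; rewrite gt_eqF.
rewrite ExZ; last first.
  have := bounded_rvM (bcst n%:R) (bounded_crossing n1 mA).
  by congr bounded_rv; apply/funext => w; rewrite mulrA mulfV ?mul1r// gt_eqF.
rewrite ler_pM2l ?invr_gt0//.
have bS : bounded_rv (fun w => \sum_i I w i + \sum_i K w i + \sum_i K w (neighbour w i)).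
  by apply: bounded_rvD; [apply: bounded_rvD|]; exact: bounded_rv_sum.
apply: (@le_trans _ _ (Ex P (fun w => \sum_i I w i + \sum_i K w i + \sum_i K w (neighbour w i)))).
  apply: le_Ex => //.
    have := bounded_rvM (bcst n%:R) (bounded_crossing n1 mA).
    by congr bounded_rv; apply/funext => w; rewrite mulrA mulfV ?mul1r// gt_eqF.
  move=> w; rewrite -!big_split/=; apply: ler_sum => i _.
  rewrite !mem_setE; exact: nn_crossing (ltW e0) _.
rewrite !ExD; do ?[exact: bounded_rv_sum|apply: bounded_rvD].
have EK : Ex P (fun w => \sum_i K w i) <= n%:R * e.
  apply: Ex_le_cst => [|w]; first exact: bounded_rv_sum.
  by rewrite /K sum_mem_card card_upper_neighbours// ltW.
apply: lerD; first (apply: lerD => //).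
  apply: Ex_le_cst => [|w]; first exact: bounded_rv_sum.
  have -> : \sum_(i < n) I w i =
      #|[set i | far_from_others (@sample_z n w) e i]%SET|%:R :> R.
    by rewrite -sum_mem_card; apply: eq_bigr => i _; rewrite inE.
  rewrite ler_nat; apply: card_isolated => //.
  by move=> i l; rewrite tnth_ranks mean_bool01.
(* The case where the neighbour is the upper point: Stone's inequality returns to the size of the
   set at the cost of the factor [C]. *)
apply: le_trans (stone (h := fun k w => K w k) n1 _ _) _ => //.
  move=> i k; apply: bounded_rv_bool; apply: measurable_upper_neighbours => l.
  exact: measurable_rest_X.
by rewrite ler_wpM2l ?stone_cst_ge0// -Ex_sum.
Qed.

Lemma few_crossingsC A : few_crossings A -> few_crossings (~` A).
Proof.
move=> [mA vA]; split; first exact: measurableC.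
rewrite (_ : (fun n => _) = fun n => Ex P (crossing n A))//.
apply/funext => n; apply: eq_Ex => w; congr (_ * _); apply: eq_bigr => i _.
by rewrite !in_setC; case: (_ \in A); case: (_ \in A).
Qed.

(** Finitely many of the sets fill the union up to a remainder [E m] of probability at most e. The
    remainder is rarely visited by [X_i], and by [X_N(i)] as well thanks to [stone_mem]. *)
Lemma few_crossings_bigcup (F : (set (d.-tuple R))^nat) :
  (forall k, few_crossings (F k)) -> few_crossings (\bigcup_k F k).
Proof.
move=> fF; have mF k : measurable (F k) by case: (fF k).
have mU' : measurable (\bigcup_k F k) by exact: bigcupT_measurable.
split=> //; apply: (vanishing_approx (c := 1 + C)); first by rewrite addr_ge0// stone_cst_ge0.
move=> e e0.
pose G m := \big[setU/set0]_(k < m) F k.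
have mG m : measurable (G m) by apply: bigsetU_measurable.
pose E m := (\bigcup_k F k) `\` G m.
have mE m : measurable (E m) by exact: measurableD.
have [m Em] : exists m, Ex P0 (fun w => (X w \in E m)%:R) <= e.
  have mXE m : measurable (X @^-1` E m).
    by rewrite -[X in measurable X]setTI; exact: (measurable_funPT X).
  have cvg0 : P0 (X @^-1` E m) @[m --> \oo] --> P0 (\bigcap_m (X @^-1` E m)).
    apply: nonincreasing_cvg_mu => //.
    - by rewrite ltey_eq fin_num_measure.
    - exact: bigcapT_measurable.
    - move=> m1 m2 m12; apply/subsetPset => w [Uw nG]; split => //.
      by apply: contra_not nG; apply: subset_bigsetU.
  have I0 : \bigcap_m (X @^-1` E m) = set0.
    rewrite -subset0 => w /= h; have [[k _ Fk] _] := h 0%N I.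
    have [_] := h k.+1 I; apply; rewrite /G -bigcup_mkord.
    by exists k => //=.
  rewrite I0 measure0 in cvg0.
  have /fine_cvgP[_ /cvgrPdist_le /(_ e e0)] := cvg0.
  case=> m _ /(_ m (leqnn m)); rewrite /= sub0r normrN => h; exists m.
  rewrite (Ex_mem P0 (mXE m))// in h *; apply: le_trans h.
  by rewrite -(Ex_mem P0 (mXE m)) ger0_norm// ?Ex_ge0//; apply: eq_Ex.
exists 2%N, (fun n => \sum_(k < m) Ex P (crossing n (F k))); split.
  by apply: vanishing_sum => k; case: (fF k).
move=> n n1; have n0 : 0 < n%:R :> R by rewrite ltr0n ltnW.
have bE1 : bounded_rv (fun w => n%:R^-1 * \sum_(i < n) (Xs i w \in E m)%:R : R).
  by apply: bounded_rvM => //; apply: bounded_rv_sum => i _; exact: bounded_memX.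
have bE2 : bounded_rv (fun w =>
    n%:R^-1 * \sum_(i < n) (Xs (neighbour w i) w \in E m)%:R : R).
  apply: bounded_rvM => //; apply: bounded_rv_sum => i _.
  by apply: (@bounded_at_neighbour n i (fun k w => (Xs k w \in E m)%:R)) => // k; exact: bounded_memX.
have bF : bounded_rv (fun w => \sum_(k < m) crossing n (F k) w).
  by apply: bounded_rv_sum => k _; exact: bounded_crossing.
apply: (@le_trans _ _ (Ex P (fun w => \sum_(k < m) crossing n (F k) w +
   (n%:R^-1 * \sum_(i < n) (Xs i w \in E m)%:R +
    n%:R^-1 * \sum_(i < n) (Xs (neighbour w i) w \in E m)%:R)))).
  apply: le_Ex; first exact: bounded_crossing.
    by apply: bounded_rvD => //; exact: bounded_rvD.
  move=> w; rewrite /crossing -mulr_sumr -!mulrDr ler_pM2l ?invr_gt0//.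
  rewrite exchange_big -!big_split/=; apply: ler_sum => i _.
  set x := Xs i w; set x' := Xs _ w.
  (* The inside point lies either in the remainder or in some F k with k < m, and this F k then
     separates the two points. *)
  have key y y' : y \in \bigcup_k F k -> y' \notin \bigcup_k F k ->
      1 <= \sum_(k < m) ((y \in F k) != (y' \in F k))%:R + (y \in E m)%:R :> R.
    rewrite inE notin_setE => Uy nUy'.
    have [yE|] := boolP (y \in E m); first by rewrite lerDr sumr_ge0.
    rewrite notin_setE => nE.
    have : G m y by apply: contrapT => nG; apply: nE.
    rewrite /G -bigcup_mkord => -[k /= km Fk].
    rewrite addr0 (bigD1 (Ordinal km))//= (mem_set Fk).
    rewrite memNset ?lerDl ?sumr_ge0//.
    by move=> Fy'; apply: nUy'; exists k.
  have [xU|xU] := boolP (x \in \bigcup_k F k);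
    have [xU'|xU'] := boolP (x' \in \bigcup_k F k); rewrite /= ?addr_ge0 ?sumr_ge0//.
    by rewrite addrA; apply: le_trans (key _ _ xU xU') _; rewrite lerDl.
  have := key _ _ xU' xU; under eq_bigr do rewrite eq_sym.
  by move=> h; apply: le_trans h _; rewrite lerD2l lerDr.
have bEX : @bounded_rv R _ (d.-tuple R * R)%type (fun p => (p.1 \in E m)%:R).
  apply: bounded_rv_bool; apply: (measurableT_comp (measurable_mem (mE m))).
  exact: measurable_fst.
rewrite ExD//; last exact: bounded_rvD.
rewrite Ex_sum; last by move=> k _; exact: bounded_crossing.
rewrite lerD2l ExD// mulrDl mul1r; apply: lerD.
  rewrite ExZ; last by apply: bounded_rv_sum => i _; exact: bounded_memX.
  rewrite mulrC ler_pdivrMr// Ex_sum; last by move=> i _; exact: bounded_memX.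
  rewrite mulr_natr -[X in _ *+ X]card_ord -sumr_const; apply: ler_sum => i _.
  by rewrite (Ex_copy i bEX).
apply: le_trans (stone_mem n1 (mE m)) _.
by rewrite ler_wpM2l// stone_cst_ge0.
Qed.

Lemma few_crossings_measurable A : measurable A -> few_crossings A.
Proof.
have sF : sigma_algebra setT few_crossings.
  split.
  - split=> //; apply: (vanishing_le (k := 0%N)) (vanishing0) => n _.
    rewrite (eq_Ex _ (g := fun=> 0)) ?Ex_cst// => w.
    by rewrite /crossing big1 ?mulr0// => i _; rewrite !in_set0.
  - by move=> B fB; rewrite setTD; exact: few_crossingsC.
  - exact: few_crossings_bigcup.
move: A; apply: smallest_sub => //.
apply: (big_ind (fun S => S `<=` few_crossings)); first exact: sub0set.
  by move=> B1 B2 h1 h2; rewrite subUset.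
move=> j _ _ [B mB <-]; rewrite setTI.
pose f (x : d.-tuple R) := tnth x j.
(* The sets of reals whose preimage under the j-th coordinate has few crossings form a
   sigma-algebra, so the open half-lines ]a, +oo[ are enough. *)
have sI := @sigma_algebra_image _ _ setT f _ sF.
suff : measurable `<=` image_set_system setT f few_crossings.
  by move=> /(_ _ mB); rewrite /image_set_system/= setTI.
rewrite [X in X `<=` _](RGenOInfty.measurableE R); apply: smallest_sub => //.
move=> _ [a ->]; rewrite /image_set_system/= setTI.
rewrite (_ : f @^-1` _ = ~` [set x | tnth x j <= a]).
  exact/few_crossingsC/few_crossings_halfspace.
apply/seteqP; split => x /=; rewrite in_itv/= andbT ltNge; first by move/negP.
by move/negP.
Qed.

(** Up to 1/m, g is an average of indicators of superlevel sets, each with few crossings. The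
    constant 2 counts the discretization errors at a point and at its neighbour. *)
Lemma regression_crossing (g : d.-tuple R -> R) : measurable_fun setT g ->
  (forall x, 0 <= g x <= 1) ->
  vanishing (fun n => Ex P (fun w => n%:R^-1 *
    \sum_(i < n) `|g (Xs i w) - g (Xs (neighbour w i) w)|)).
Proof.
move=> mg g01; apply: (vanishing_approx (c := 2)) => // e e0.
set m := (Num.truncn e^-1).+1; have m0 : 0 < m%:R :> R by rewrite ltr0n.
have me : m%:R^-1 <= e.
  by rewrite -[leRHS]invrK lef_pV2 ?posrE ?invr_gt0// ltW// truncnS_gt.
pose A l := [set x : d.-tuple R | l.+1%:R <= m%:R * g x].
have mA l : measurable (A l).
  apply: (@measurable_true_set _ _ (fun x => l.+1%:R <= m%:R * g x)).
  by apply: measurable_fun_ler => //; exact: measurable_funM.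
exists 2%N, (fun n => m%:R^-1 * \sum_(l < m) Ex P (crossing n (A l))); split.
  apply: vanishingZ; first by rewrite invr_ge0 ltW.
  by apply: vanishing_sum => l; case: (few_crossings_measurable (mA l)).
move=> n n1; have n0 : 0 < n%:R :> R by rewrite ltr0n ltnW.
rewrite -Ex_sum; last by move=> l _; exact: bounded_crossing.
have bc : bounded_rv (fun w => \sum_(l < m) crossing n (A l) w).
  by apply: bounded_rv_sum => l _; exact: bounded_crossing.
have bgX (k : nat) : bounded_rv (fun w => g (Xs k w)).
  split; first exact: measurableT_comp.
  by exists 1 => w; have /andP[? ?] := g01 (Xs k w); rewrite ger0_norm.
rewrite -ExZ// -[X in _ <= _ + X](Ex_cst P) -ExD//; last first.
  by apply: bounded_rvM.
apply: le_Ex.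
- apply: bounded_rvM => //; apply: bounded_rv_sum => i _.
  apply: (@bounded_at_neighbour n i (fun k w => `|g (Xs i w) - g (Xs k w)|)) => // k.
  by apply: bounded_rv_norm; exact: bounded_rvB.
- by apply: bounded_rvD => //; exact: bounded_rvM.
move=> w; rewrite /crossing -mulr_sumr mulrCA exchange_big/=.
rewrite ler_pdivrMl// mulrDr mulVKf ?gt_eqF// mulr_sumr.
rewrite mulr_natl -[X in _ <= _ + (_ *+ X)]card_ord -sumr_const -big_split/=.
apply: ler_sum => i _; set x := Xs i w; set x' := Xs _ w.
have h := discretization (g01 x) (ltn0Sn (Num.truncn e^-1)).
have h' := discretization (g01 x') (ltn0Sn (Num.truncn e^-1)).
rewrite -/m in h h'; move: h h'.
set a := _ * \sum_(_ < _) _; set a' := _ * \sum_(_ < _) _ => h h'.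
have aa' : `|a - a'| <= m%:R^-1 * \sum_(l < m) ((x \in A l) != (x' \in A l))%:R.
  rewrite -mulrBr normrM gtr0_norm ?invr_gt0// ler_pM2l ?invr_gt0// -sumrB.
  apply: le_trans (ler_norm_sum _ _ _) _; apply: ler_sum => l _.
  by rewrite !mem_setE normB_bool.
have -> : g x - g x' = (g x - a) + (a - a') + (a' - g x') by ring.
apply: le_trans (ler_normD _ _) _.
apply: le_trans (lerD (ler_normD _ _) (lexx _)) _.
rewrite [`|a' - _|]distrC.
have := le_trans h me; have := le_trans h' me; lra.
Qed.

(** * Convergence of the pair average for a fixed Borel set *)

Section PairMean.
Variables (S : set R) (g : d.-tuple R -> R).
Hypothesis mS : measurable S.
Hypothesis mg : measurable_fun setT g.
Hypothesis g01 : forall x, 0 <= g x <= 1.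
Hypothesis gS : forall A, measurable A ->
  Ex P0 (fun w => ((Y w \in S)%:R - g (X w)) * (X w \in A)%:R) = 0.

Definition pair_mean n w : R := n%:R^-1 *
  \sum_(i < n) (Ys i w \in S)%:R * (Ys (neighbour w i) w \in S)%:R.

Lemma bounded_pair_mean n : (1 < n)%N -> bounded_rv (pair_mean n).
Proof.
move=> n1; apply: bounded_rvM => //; apply: bounded_rv_sum => i _.
have bY (k : nat) : bounded_rv (fun w => (Ys k w \in S)%:R : R).
  by apply: bounded_rv_bool; exact: (measurableT_comp (measurable_mem mS) (mY k)).
apply: (@bounded_at_neighbour n i (fun k w => (Ys i w \in S)%:R * (Ys k w \in S)%:R)) => // k.
exact: bounded_rvM.
Qed.

Lemma pair_mean_cvg :
  vanishing (fun n => Ex P (fun w => `|pair_mean n w - Ex P0 (fun w => g (X w) ^+ 2)|)).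
Proof.
set c := Ex P0 _.
have bgp : @bounded_rv R _ (d.-tuple R * R)%type (fun p => g p.1 ^+ 2).
  apply: bounded_rvX; split; first exact: (measurableT_comp mg measurable_fst).
  by exists 1 => p; have /andP[? ?] := g01 p.1; rewrite ger0_norm.
have bgX (k : nat) : bounded_rv (fun w => g (Xs k w)).
  split; first exact: measurableT_comp.
  by exists 1 => w; have /andP[? ?] := g01 (Xs k w); rewrite ger0_norm.
pose D n w := n%:R^-1 * \sum_(i < n) neighbour_noise S g i w.
have bD n : (1 < n)%N -> bounded_rv (D n).
  move=> n1; apply: bounded_rvM => //; apply: bounded_rv_sum => i _.
  exact: bounded_neighbour_noise.
have vD : vanishing (fun n => Ex P (fun w => `|D n w|)).
  apply: (vanishing_L1_of_L2 (k := 2%N)) => //.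
  apply: (vanishing_le (k := 2%N)) (vanishing_inv (3 + C)) => n n1.
  have n0 : 0 < n%:R :> R by rewrite ltr0n ltnW.
  rewrite (eq_Ex _ (g := fun w => n%:R^-1 ^+ 2 * (\sum_(i < n) neighbour_noise S g i w) ^+ 2)); last first.
    by move=> w; rewrite -exprMn.
  rewrite ExZ; last first.
    by apply: bounded_rvX; apply: bounded_rv_sum => i _; exact: bounded_neighbour_noise.
  apply: (@le_trans _ _ (n%:R^-1 ^+ 2 * (n%:R * (3 + C)))).
    by apply: ler_wpM2l; [exact: sqr_ge0|exact: neighbour_noise_L2].
  by rewrite le_eqVlt; apply/orP; left; apply/eqP; field; rewrite gt_eqF.
have := vanishingD (vanishingD vD (regression_crossing mg g01)) (lln bgp).
apply: (vanishing_le (k := 2%N)) => n n1.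
have n0 : 0 < n%:R :> R by rewrite ltr0n ltnW.
have b1 : bounded_rv (fun w => n%:R^-1 *
    \sum_(i < n) `|g (Xs i w) - g (Xs (neighbour w i) w)|).
  apply: bounded_rvM => //; apply: bounded_rv_sum => i _.
  apply: (@bounded_at_neighbour n i (fun k w => `|g (Xs i w) - g (Xs k w)|)) => // k.
  by apply: bounded_rv_norm; exact: bounded_rvB.
have b2 : bounded_rv (fun w => `|n%:R^-1 * \sum_(i < n) g (Xs i w) ^+ 2 - c|).
  apply: bounded_rv_norm; apply: bounded_rvB => //; apply: bounded_rvM => //.
  by apply: bounded_rv_sum => i _; exact: bounded_rvX.
have b3 := bounded_rv_norm (bD n n1).
rewrite /= -!ExD//; last exact: bounded_rvD.
apply: le_Ex.
- by apply: bounded_rv_norm; apply: bounded_rvB => //; exact: bounded_pair_mean.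
- by apply: bounded_rvD => //; exact: bounded_rvD.
move=> w; set r := \sum_(i < n) g (Xs i w) ^+ 2.
pose q := \sum_(i < n) (g (Xs i w) * (g (Xs (neighbour w i) w) - g (Xs i w))).
(* Three errors: the noise [D], small in L^2; the replacement of g at the neighbour by g at the
   point, in [q]; and the fluctuation of the mean of g^2. *)
have -> : pair_mean n w - c = D n w + n%:R^-1 * q + (n%:R^-1 * r - c).
  rewrite addrA; congr (_ - c); rewrite /pair_mean /D /q /r -!mulrDr -!big_split/=.
  congr (_ * _); apply: eq_bigr => i _; rewrite /neighbour_noise /pair_noise; ring.
apply: le_trans (ler_normD _ _) _; rewrite lerD2r.
apply: le_trans (ler_normD _ _) _; rewrite lerD2l.
rewrite normrM gtr0_norm ?invr_gt0// ler_pM2l ?invr_gt0//.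
apply: le_trans (ler_norm_sum _ _ _) _; apply: ler_sum => i _.
rewrite normrM distrC; have /andP[h0 h1] := g01 (Xs i w).
by rewrite ger0_norm// ler_piMl.
Qed.

End PairMean.
End Sample.

(** * The regression function and the limit *)

Section Regression.
Context {R : realType} {d : nat}.
Context {dT0 : measure_display} {T0 : measurableType dT0} (P0 : probability T0 R).
Variables (X : {RV P0 >-> d.-tuple R}) (Y : {RV P0 >-> R}) (S : set R).
Hypothesis mS : measurable S.

(** The image under X of P0 restricted to the event Y in S, packaged as a charge so that
    [Radon_Nikodym] can be applied to it. *)
Lemma ex_joint_charge : exists nu : {charge set (d.-tuple R) -> \bar R},
  forall A, nu A = P0 ((X @^-1` A) `&` (Y @^-1` S)).
Proof.
have mYS : measurable (Y @^-1` S).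
  by rewrite -[X in measurable X]setTI; exact: (measurable_funPT Y).
have moo : (P0 (Y @^-1` S) < +oo)%E by rewrite ltey_eq fin_num_measure.
pose c := charge_of_finite_measure (mfrestr mYS moo).
have mX : measurable_fun setT X by exact: measurable_funPT.
unshelve eexists; first refine (pushforward c X : {charge set _ -> \bar R}).
  exact: mX.
by [].
Qed.

Let mu := distribution P0 X.

(* Radon-Nikodym gives a density [h]; being a density of a measure dominated by
   [mu], it can be truncated to [0, 1] without changing its integrals. *)
Lemma ex_regression : exists g : d.-tuple R -> R,
  [/\ measurable_fun setT g, forall x, 0 <= g x <= 1 &
    forall A, measurable A ->
      Ex P0 (fun w => ((Y w \in S)%:R - g (X w)) * (X w \in A)%:R) = 0].
Proof.
have mYS : measurable (Y @^-1` S).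
  by rewrite -[X in measurable X]setTI; exact: (measurable_funPT Y).
have mXA A : measurable A -> measurable (X @^-1` A).
  by move=> mA; rewrite -[X in measurable X]setTI; exact: (measurable_funPT X).
have [nu nuE] := ex_joint_charge.
have nu_ge0 A : (0 <= nu A)%E by rewrite nuE.
have nu_le A : measurable A -> (nu A <= mu A)%E.
  move=> mA; rewrite nuE -[mu A]/(P0 (X @^-1` A)).
  apply: le_measure; rewrite ?inE; last exact: subIsetl.
    by apply: measurableI => //; exact: mXA.
  exact: mXA.
have numu : nu `<< mu.
  apply/null_content_dominatesP => A mA muA; apply/eqP.
  by rewrite eq_le nu_ge0 andbT -muA nu_le.
pose f := Radon_Nikodym nu mu.
pose h x := fine (f x).
have hE : EFin \o h = f.
  by apply/funext => x /=; rewrite fineK//; exact: Radon_Nikodym_fin_num.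
have ih : mu.-integrable setT (EFin \o h) by rewrite hE; exact: Radon_Nikodym_integrable.
have mh : measurable_fun setT h by exact/measurable_EFinP/measurable_int/ih.
have Ih A : measurable A -> (\int[mu]_(x in A) (h x)%:E = nu A)%E.
  move=> mA; rewrite (Radon_Nikodym_integral numu mA); apply: eq_integral => x _.
  by rewrite -/f -hE.
pose g x := Num.max 0 (Num.min (h x) 1).
have mg : measurable_fun setT g.
  by apply: measurable_maxr => //; exact: measurable_minr.
have g01 x : 0 <= g x <= 1.
  by rewrite /g le_max lexx/= ge_max ler01/= ge_min lexx orbT.
have ig : mu.-integrable setT (EFin \o g).
  apply: bounded_rv_integrable; split => //; exists 1 => x.
  by have /andP[? ?] := g01 x; rewrite ger0_norm.
pose B1 := [set x | 1 < h x]; pose B0 := [set x | h x < 0].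
have mB1 : measurable B1.
  by apply: (@measurable_true_set _ _ (fun x => 1 < h x)); exact: measurable_fun_ltr.
have mB0 : measurable B0.
  by apply: (@measurable_true_set _ _ (fun x => h x < 0)); exact: measurable_fun_ltr.
have iS A u : measurable A -> mu.-integrable setT u -> mu.-integrable A u.
  by move=> mA; apply: integrableS.
(* Where h > 1, mu A <= nu A by integrating h, and nu A <= mu A by domination: the two agree and g =
   1 has the right integral. Where h < 0, [E0] likewise forces nu A = 0. *)
have E1 A : measurable A -> A `<=` B1 ->
    (\int[mu]_(x in A) (g x)%:E = nu A)%E.
  move=> mA AB1; rewrite (eq_integral (cst 1%E)); last first.
    move=> x; rewrite inE => /AB1; rewrite /B1/= => h1; rewrite /g min_r ?ltW//.
    by rewrite max_r.
  rewrite integral_cst// mul1e; apply/eqP; rewrite eq_le nu_le// andbT.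
  rewrite -Ih// -[leLHS]mul1e -integral_cst//; apply: le_integral => //.
  - exact: finite_measure_integrable_cst.
  - exact: iS.
  - by move=> x; rewrite inE => /AB1; rewrite /B1/= => h1; rewrite lee_fin ltW.
have E0 A : measurable A -> A `<=` B0 ->
    (\int[mu]_(x in A) (g x)%:E = nu A)%E.
  move=> mA AB0; rewrite (eq_integral (cst 0%E)); last first.
    move=> x; rewrite inE => /AB0; rewrite /B0/= => h0; rewrite /g max_l//.
    by rewrite ge_min ltW.
  rewrite integral_cst// mul0e; apply/eqP; rewrite eq_le nu_ge0/=.
  rewrite -Ih// -[leRHS](mul0e (mu A)) -integral_cst//; apply: le_integral => //.
  - exact: iS.
  - exact: finite_measure_integrable_cst.
  - by move=> x; rewrite inE => /AB0; rewrite /B0/= => h0; rewrite lee_fin ltW.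
have Ig A : measurable A -> (\int[mu]_(x in A) (g x)%:E = nu A)%E.
  move=> mA; have AE : A = (A `&` B1) `|` ((A `&` B0) `|` (A `\` (B1 `|` B0))).
    apply/seteqP; split => x; last by move=> [[]|[[]|[]]].
    move=> Ax; have [x1|x1] := pselect (B1 x); first by left.
    by have [x0|x0] := pselect (B0 x); right; [left|right]; split => // -[].
  have mA1 : measurable (A `&` B1) by exact: measurableI.
  have mA0 : measurable (A `&` B0) by exact: measurableI.
  have mA2 : measurable (A `\` (B1 `|` B0)).
    by apply: measurableD => //; exact: measurableU.
  have dis0 : [disjoint A `&` B0 & A `\` (B1 `|` B0)].
    by apply/disj_setPS => x [[_ x0] [_]]; apply; right.
  have dis1 : [disjoint A `&` B1 & (A `&` B0) `|` (A `\` (B1 `|` B0))].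
    apply/disj_setPS => x [[_ x1] [[_ x0]|[_]]]; last by apply; left.
    by have := lt_trans x0 (lt_trans ltr01 x1); rewrite ltxx.
  have split3 u : mu.-integrable setT (EFin \o u) ->
      (\int[mu]_(x in A) (u x)%:E = \int[mu]_(x in A `&` B1) (u x)%:E +
       (\int[mu]_(x in A `&` B0) (u x)%:E +
        \int[mu]_(x in A `\` (B1 `|` B0)) (u x)%:E))%E.
    move=> iu; have mu' : measurable_fun setT (EFin \o u) by exact: measurable_int iu.
    rewrite {1}AE integral_setU//; last 2 first.
    - exact: measurableU.
    - exact: measurable_funTS.
    by rewrite integral_setU//; exact: measurable_funTS.
  rewrite split3// (E1 _ mA1 (@subIsetr _ _ _)) (E0 _ mA0 (@subIsetr _ _ _)).
  rewrite -[RHS]Ih// (split3 h ih) (Ih _ mA1) (Ih _ mA0).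
  congr (_ + (_ + _))%E; apply: eq_integral.
  move=> x; rewrite inE => -[_ /not_orP[/negP n1 /negP n0]].
  rewrite /g min_l; last by rewrite leNgt.
  by rewrite max_r// leNgt.
exists g; split => // A mA.
have bgA : @bounded_rv R _ (d.-tuple R) (fun x => g x * (x \in A)%:R).
  apply: bounded_rvM; last exact: bounded_rv_mem.
  by split => //; exists 1 => x; have /andP[? ?] := g01 x; rewrite ger0_norm.
have bg0 : bounded_rv (fun w => g (X w) * (X w \in A)%:R).
  case: bgA => mgA [M gM]; split; last by exists M => w; exact: gM.
  exact: (measurableT_comp mgA (measurable_funPT X)).
have bS : bounded_rv (fun w => (w \in (X @^-1` A) `&` (Y @^-1` S))%:R : R).
  by apply: bounded_rv_mem; apply: measurableI => //; exact: mXA.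
rewrite (eq_Ex _ (g := fun w => (w \in (X @^-1` A) `&` (Y @^-1` S))%:R -
   g (X w) * (X w \in A)%:R)).
  rewrite ExB//; apply/eqP; rewrite subr_eq0; apply/eqP/EFin_inj.
  rewrite Ex_mem; last by apply: measurableI => //; exact: mXA.
  rewrite fineK; last by rewrite fin_num_measure//; apply: measurableI => //; exact: mXA.
  rewrite -nuE -Ig// -EFin_Ex//.
  have bi : mu.-integrable setT (EFin \o (fun x => g x * (x \in A)%:R)).
    exact: bounded_rv_integrable.
  transitivity (\int[mu]_x (g x * (x \in A)%:R)%:E)%E.
    rewrite integral_mkcond; apply: eq_integral => x _.
    by rewrite patchE; case: ifP; rewrite ?mulr1 ?mulr0.
  rewrite integral_distribution//; last exact: bounded_rv_integrable.
  by apply/measurable_EFinP; case: bgA.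
move=> w; rewrite mulrBl in_setI -natrM mulnb andbC; congr (_ - _).
Qed.

End Regression.

(** * Versions of a conditional expectation and their variance *)

Section ConditionalExpectation.
Context {R : realType} {dT : measure_display} {T : measurableType dT}.
Variable P : probability T R.
Context {dE : measure_display} {E : measurableType dE} (X : {RV P >-> E}).

Lemma preimage_sigma_measurable A : g_sigma_algebra_preimage X A -> measurable A.
Proof. by move=> [B mB <-]; exact: (measurable_funPT X). Qed.

(** The set where h2 < h1 belongs to the sigma-algebra of X, so h1 - h2 has integral 0 over it
    although it is positive there. *)
Lemma cond_exp_le_ae (f h1 h2 : T -> R) :
  is_cond_exp P X f h1 -> is_cond_exp P X f h2 ->
  ae_eq P [set w | h2 w < h1 w] (fun w => (h1 w - h2 w)%:E) (cst 0%E).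
Proof.
move=> [m1 i1 E1] [m2 i2 E2]; set A := [set w | _].
have sA : g_sigma_algebra_preimage X A.
  exact: (@measurable_true_set _ (g_sigma_algebra_preimageType X) _ (measurable_fun_ltr m2 m1)).
have mA := preimage_sigma_measurable sA.
have i1A : P.-integrable A (EFin \o h1) by apply: (integrableS measurableT).
have i2A : P.-integrable A (EFin \o h2) by apply: (integrableS measurableT).
have i12 : P.-integrable A (fun w => (h1 w - h2 w)%:E).
  by under eq_fun do rewrite EFinB; exact: integrableB.
apply/ae_eq_integral_abs => //; first exact: measurable_int i12.
rewrite (eq_integral (fun w => (h1 w)%:E - (h2 w)%:E)%E).
  rewrite integralB_EFin// E1// E2// subee//.
  have := integrable_fin_num mA i1A.
  by rewrite -(E1 _ sA).
move=> w; rewrite inE /A /= => h; rewrite ger0_norm ?EFinB// subr_ge0 ltW//.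
Qed.

Lemma cond_exp_unique (f h1 h2 : T -> R) :
  is_cond_exp P X f h1 -> is_cond_exp P X f h2 ->
  {ae P, forall w, h1 w = h2 w}.
Proof.
move=> c1 c2; have := cond_exp_le_ae c1 c2; have := cond_exp_le_ae c2 c1.
apply: filterS2 => w /= a b; have [h|h|//] := ltgtP (h1 w) (h2 w).
  by have [/eqP] := a h; rewrite subr_eq0 => /eqP.
by have [/eqP] := b h; rewrite subr_eq0 => /eqP.
Qed.

Lemma variance_ae_eq (h1 h2 : T -> R) : measurable_fun setT h1 ->
  measurable_fun setT h2 -> {ae P, forall w, h1 w = h2 w} ->
  'V_P[h1] = 'V_P[h2].
Proof.
move=> m1 m2 h12.
have EE : ('E_P[h1] = 'E_P[h2])%E.
  rewrite unlock; apply: ae_eq_integral => //; do 1?exact/measurable_EFinP.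
  by apply: filterS h12 => w /= -> _.
rewrite /variance unlock EE !unlock; apply: ae_eq_integral => //.
- apply/measurable_EFinP; apply: measurable_funM; exact: measurable_funB.
- apply/measurable_EFinP; apply: measurable_funM; exact: measurable_funB.
- by apply: filterS h12 => w /= h _; rewrite /= !fctE/= h.
Qed.

Lemma variance_bounded (h : T -> R) : bounded_rv h ->
  'V_P[h] = (Ex P (fun w => h w ^+ 2) - Ex P h ^+ 2)%:E.
Proof.
move=> bh; have EE f : bounded_rv f -> ('E_P[f] = (Ex P f)%:E)%E.
  by move=> bf; rewrite unlock EFin_Ex.
set m := Ex P h.
have bc := bounded_rv_cst (R := R) (T := T).
have bhm : bounded_rv (fun w => h w - m) by exact: bounded_rvB.
have -> : 'V_P[h] = ('E_P[(fun w => (h w - m) * (h w - m))%R])%E.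
  by rewrite /variance covariance.unlock (EE h bh).
rewrite EE; last exact: bounded_rvM.
congr EFin.
rewrite (eq_Ex _ (g := fun w => h w ^+ 2 - (2 * m * h w - m ^+ 2))); last first.
  by move=> w; ring.
rewrite !ExB ?ExZ ?Ex_cst//; do ?[exact: bounded_rvX|exact: bounded_rvB|exact: bounded_rvM].
  by rewrite -/m; ring.
by apply: bounded_rvB => //; exact: bounded_rvM.
Qed.

(** [cond_exp] is an unspecified choice; the existence of h makes it a version, and the variance is
    the same for all versions. *)
Lemma variance_cond_exp (f h : T -> R) : is_cond_exp P X f h -> bounded_rv h ->
  'V_P[cond_exp P X f] = (Ex P (fun w => h w ^+ 2) - Ex P h ^+ 2)%:E.
Proof.
move=> ch bh; have := @xgetPex _ (cst 0) [set g | is_cond_exp P X f g] (ex_intro _ h ch).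
rewrite -/(cond_exp P X f) /= => c.
rewrite -variance_bounded//; apply: variance_ae_eq; last exact: cond_exp_unique c ch.
- by case: c => _ + _ => /measurable_int/measurable_EFinP.
- by case: bh.
Qed.

End ConditionalExpectation.

(** * Bracketing all half-lines by finitely many sets *)

Section Brackets.
Context {R : realType} {dT : measure_display} {T : measurableType dT}.
Variable P : probability T R.

(** Covers the open and the closed half-lines as well as the empty set and the whole line, which
    avoids quantiles and case distinctions on endpoints. *)
Definition upset (A : set R) := forall x y, A x -> x <= y -> A y.

Lemma measurable_upset A : upset A -> measurable A.
Proof.
move=> uA; apply: is_interval_measurable => x y Ax Ay z /andP[xz zy].
exact: uA Ax xz.
Qed.

Lemma bounded_rv_upset (Y : T -> R) A : measurable_fun setT Y -> measurable A ->
  bounded_rv (fun w => (Y w \in A)%:R : R).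
Proof.
move=> mY mA; apply: bounded_rv_bool.
exact: (measurableT_comp (measurable_mem mA) mY).
Qed.

Lemma bounded_rv_ler (Y Z : T -> R) : measurable_fun setT Y ->
  measurable_fun setT Z -> bounded_rv (fun w => (Y w <= Z w)%R%:R : R).
Proof. by move=> mY mZ; apply: bounded_rv_bool; exact: measurable_fun_ler. Qed.

(* Without a least element, an upset is a countable increasing union of closed
   half-lines, the rationals being dense. *)
Lemma Ex_upset_le (Y : T -> R) A t : measurable_fun setT Y -> upset A -> 0 <= t ->
  (forall z, A z -> Ex P (fun w => (z <= Y w)%R%:R) <= t) ->
  Ex P (fun w => (Y w \in A)%:R) <= t.
Proof.
move=> mY uA t0 At; have mA := measurable_upset uA.
have bz z : bounded_rv (fun w => (z <= Y w)%R%:R : R) by exact: bounded_rv_ler.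
have bA := bounded_rv_upset mY mA.
have [[z [Az zmin]]|nomin] := pselect (exists z, A z /\ forall y, A y -> z <= y).
  apply: le_trans (At z Az); apply: le_Ex => // w.
  by have [/set_mem/zmin -> //|_] := boolP (Y w \in A).
have [[a0 Aa0]|A0] := pselect (exists a, A a); last first.
  rewrite (_ : (fun w => _) = fun=> 0) ?Ex_cst//; apply/funext => w.
  by rewrite memNset// => AY; apply: A0; exists (Y w).
(* [z] enumerates the rationals of A, with default value a0, and [m] takes running minima, so that
   the events [m k <= Y] increase with k. *)
pose z k := if unpickle k is Some q then
  if ratr q \in A then ratr q : R else a0 else a0.
have Az k : A (z k).
  by rewrite /z; case: unpickle => // q; case: ifPn => // /set_mem.
pose m := fix m (k : nat) : R := if k is k'.+1 then Num.min (m k') (z k') else a0.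
have Am k : A (m k).
  by elim: k => //= k ih; rewrite /Num.min; case: ifP.
pose F k := [set w | m k <= Y w].
have mF k : measurable (F k).
  by apply: (@measurable_true_set _ _ (fun w => m k <= Y w)); exact: measurable_fun_ler.
have FU : \bigcup_k F k = Y @^-1` A.
  apply/seteqP; split => w /=; first by move=> [k _ /=]; exact: uA (Am k).
  move=> AY; have [y [Ay yY]] : exists y, A y /\ y < Y w.
    apply: contrapT => h; apply: nomin; exists (Y w); split => // y Ay.
    by rewrite leNgt; apply/negP => yY; apply: h; exists y.
  have [q] := rat_in_itvoo yY; rewrite in_itv/= => /andP[yq qY].
  have Aq : A (ratr q) by exact: uA Ay (ltW yq).
  exists (pickle q).+1 => //=; rewrite /F/=.
  apply: le_trans (ltW qY); rewrite ge_min; apply/orP; right.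
  by rewrite /z pickleK (mem_set Aq).
have PA : P (Y @^-1` A) = (Ex P (fun w => (Y w \in A)%:R))%:E.
  rewrite Ex_bool; last exact: (measurableT_comp (measurable_mem mA) mY).
  by congr (P _); apply/seteqP; split => w /= => [/mem_set|/set_mem].
have cF : P (F k) @[k --> \oo] --> P (\bigcup_k F k).
  apply: nondecreasing_cvg_mu => //; first exact: bigcupT_measurable.
  move=> k l kl; apply/subsetPset => w /= mkY; apply: le_trans mkY.
  rewrite /F /=; elim: l kl => [|l ih]; first by rewrite leqn0 => /eqP ->.
  rewrite leq_eqVlt => /predU1P[-> //|]; rewrite ltnS => /ih; apply: le_trans.
  by rewrite /= ge_min lexx.
rewrite -lee_fin -PA -FU.
apply: (cvge_le _ cF); near=> k.
rewrite /F -Ex_bool ?lee_fin; first exact: At.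
exact: measurable_fun_ler.
Unshelve. all: by end_near.
Qed.

(** The reflection y -> -y maps the complement of an upset to an upset, and P(Y > z) = 1 - P(-Y >=
    -z); [Ex_upset_le] then applies with 1 - t. *)
Lemma Ex_upset_ge (Y : T -> R) A t : measurable_fun setT Y -> upset A -> t <= 1 ->
  (forall z, ~ A z -> t <= Ex P (fun w => (z < Y w)%R%:R)) ->
  t <= Ex P (fun w => (Y w \in A)%:R).
Proof.
move=> mY uA t1 At; pose B := [set z | ~ A (- z)].
have bc := bounded_rv_cst (R := R) (T := T).
have mY' : measurable_fun setT (fun w => - Y w) by exact: measurable_funN.
have uB : upset B.
  by move=> x y nAx xy Ay; apply: nAx; apply: uA Ay _; rewrite lerN2.
have bA := bounded_rv_upset mY (measurable_upset uA).
have : Ex P (fun w => (- Y w \in B)%:R) <= 1 - t.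
  apply: Ex_upset_le => //; first by rewrite subr_ge0.
  move=> z nAz; have := At _ nAz.
  rewrite (_ : Ex P (fun w => (z <= - Y w)%R%:R) = 1 - Ex P (fun w => (- z < Y w)%R%:R)).
    by rewrite lerD2l lerN2.
  have bl : bounded_rv (fun w => (- z < Y w)%R%:R : R).
    by apply: bounded_rv_bool; exact: measurable_fun_ltr.
  rewrite -[X in X - _](Ex_cst P) -ExB//; apply: eq_Ex => w.
  by rewrite lerNr leNgt; case: ltP; rewrite /= ?subrr ?subr0.
rewrite (_ : Ex P (fun w => (- Y w \in B)%:R) = 1 - Ex P (fun w => (Y w \in A)%:R)).
  by rewrite lerD2l lerN2.
rewrite -[X in X - _](Ex_cst P) -ExB//; apply: eq_Ex => w.
have [YA|YA] := boolP (Y w \in A).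
  by rewrite memNset ?subrr// /B/= opprK => /(_ (set_mem YA)).
rewrite mem_set ?subr0// /B/= opprK => AY.
by move: YA; rewrite (mem_set AY).
Qed.

(** With N > 1/e and l the integer part of N P(Y >= y), the lower bracket is the set of z with P(Y >
    z) < l/N, of mass at least l/N, and the upper one the set of z with P(Y >= z) <= (l + 1)/N, of
    mass at most (l + 1)/N. Using strict and large inequalities for the two sides absorbs the
    atoms. *)
Lemma upset_brackets (Y : T -> R) e : measurable_fun setT Y -> 0 < e ->
  exists (m : nat) (S : nat -> set R), (forall l, measurable (S l)) /\
    forall y, exists l l', [/\ (l < m)%N, (l' < m)%N,
      S l `<=` [set z | y <= z], [set z | y <= z] `<=` S l' &
      Ex P (fun w => (Y w \in S l')%:R) <= Ex P (fun w => (Y w \in S l)%:R) + e].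
Proof.
move=> mY e0; set N := (Num.truncn e^-1).+1.
have N0 : 0 < N%:R :> R by rewrite ltr0n.
have Ne : N%:R^-1 <= e.
  by rewrite -[leRHS]invrK lef_pV2 ?posrE ?invr_gt0// ltW// truncnS_gt.
pose G y := Ex P (fun w => (y <= Y w)%R%:R).
pose G' y := Ex P (fun w => (y < Y w)%R%:R).
have bG y : bounded_rv (fun w => (y <= Y w)%R%:R : R) by exact: bounded_rv_ler.
have bG' y : bounded_rv (fun w => (y < Y w)%R%:R : R).
  by apply: bounded_rv_bool; exact: measurable_fun_ltr.
pose A l := [set y | G y <= l%:R / N%:R].
pose A' l := [set y | G' y < l%:R / N%:R].
have uA l : upset (A l).
  move=> x y /= Gx xy; apply: le_trans Gx; apply: le_Ex => // w.
  by rewrite ler_nat; case: (leP y) => // yY; rewrite (le_trans xy yY).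
have uA' l : upset (A' l).
  move=> x y /= Gx xy; apply: le_lt_trans Gx; apply: le_Ex => // w.
  by rewrite ler_nat; case: (ltP y) => // yY; rewrite (le_lt_trans xy yY).
(* Parity codes the two families in one sequence. The level l = N occurs when G y = 1, so indices go
   up to 2(N + 1) + 1. *)
exists N.+2.*2, (fun l => if odd l then A l./2 else A' l./2); split.
  by move=> l; case: odd; apply: measurable_upset.
move=> y; have Gy0 : 0 <= G y by exact: Ex_ge0.
have Gy1 : G y <= 1 by apply: Ex_le_cst => // w; rewrite (ler_nat _ _ 1) leq_b1.
set l := Num.truncn (N%:R * G y).
have NG0 : 0 <= N%:R * G y by rewrite mulr_ge0// ltW.
have lG : l%:R / N%:R <= G y by rewrite ler_pdivrMr// mulrC truncn_le.
have Gl : G y <= l.+1%:R / N%:R.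
  by rewrite ler_pdivlMr// mulrC ltW// truncnS_gt.
have lN : (l <= N)%N.
  by rewrite -(ler_nat R) -[leRHS]mul1r -ler_pdivrMr// (le_trans lG).
have o1 : odd l.+1.*2.+1 by rewrite oddS odd_double.
have h1 : l.+1.*2.+1./2 = l.+1 := half_bit_double l.+1 true.
exists l.*2, l.+1.*2.+1; split.
- by rewrite ltn_double ltnS (leq_trans lN).
- by rewrite ltn_Sdouble ltnS ltnS.
- rewrite odd_double doubleK => z /= Gz; rewrite leNgt; apply/negP => zy.
  have : G y <= G' z.
    apply: le_Ex => // w; rewrite ler_nat; case: (leP y) => // yY.
    by rewrite (lt_le_trans zy yY).
  by move=> h; have := lt_le_trans Gz (le_trans lG h); rewrite ltxx.
- rewrite o1 h1 => z /= yz.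
  by apply: uA yz; exact: Gl.
rewrite o1 h1 odd_double doubleK.
apply: (@le_trans _ _ (l.+1%:R / N%:R)).
  by apply: Ex_upset_le => //; rewrite divr_ge0.
apply: (@le_trans _ _ (l%:R / N%:R + e)).
  by rewrite -natr1 mulrDl mul1r lerD2l.
rewrite lerD2r; apply: Ex_upset_ge => //; first exact: le_trans lG Gy1.
by move=> z /negP; rewrite -leNgt.
Qed.

End Brackets.

(** * The limit expressed through regression functions *)

Section Limit.
Context {R : realType} {d : nat}.
Context {dT0 : measure_display} {T0 : measurableType dT0} (P0 : probability T0 R).
Variables (X : {RV P0 >-> d.-tuple R}) (Y : {RV P0 >-> R}).
Variable g : set R -> d.-tuple R -> R.
Hypothesis mg : forall S, measurable S -> measurable_fun setT (g S).
Hypothesis g01 : forall S, measurable S -> forall x, 0 <= g S x <= 1.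
Hypothesis gS : forall S, measurable S -> forall A, measurable A ->
  Ex P0 (fun w => ((Y w \in S)%:R - g S (X w)) * (X w \in A)%:R) = 0.

Definition mass (S : set R) := Ex P0 (fun w => (Y w \in S)%:R).
Definition regr_sq (S : set R) := Ex P0 (fun w => g S (X w) ^+ 2).
Definition halfline (y : R) : set R := [set z | y <= z].

Let bcst := bounded_rv_cst (R := R) (T := T0).

Lemma bounded_regression S : measurable S -> bounded_rv (fun w => g S (X w)).
Proof.
move=> mS; split.
  exact: (measurableT_comp (mg mS) (measurable_funPT X)).
by exists 1 => w; have /andP[? ?] := g01 mS (X w); rewrite ger0_norm.
Qed.

Lemma bounded_memY S : measurable S -> bounded_rv (fun w => (Y w \in S)%:R : R).
Proof. by move=> mS; apply: bounded_rv_upset => //; exact: measurable_funPT. Qed.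

Lemma regression_orthogonal S (h : d.-tuple R -> R) : measurable S -> bounded_rv h ->
  Ex P0 (fun w => ((Y w \in S)%:R - g S (X w)) * h (X w)) = 0.
Proof.
move=> mS [mh [M hM]]; pose C := g_sigma_algebra_preimage X.
have mC : C `<=` measurable by move=> A [B mB <-]; exact: (measurable_funPT X).
apply: (Ex_orthogonal mC).
- by apply: bounded_rvB; [exact: bounded_memY|exact: bounded_regression].
- move=> A; rewrite sigma_algebra_id; last first.
    by apply: sigma_algebra_preimage; exact: sigma_algebra_measurable.
  move=> [B mB <-]; rewrite -[RHS](gS mS mB); apply: eq_Ex => w.
  by congr (_ * (nat_of_bool _)%:R); rewrite setTI; apply/idP/idP; rewrite !in_setE.
- split; last by exists M.
  apply: (measurableT_comp mh); apply: measurable_fun_g_sigma => B mB.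
  by exists B => //; rewrite setTI.
Qed.

Lemma Ex_regression_mul S (h : d.-tuple R -> R) : measurable S -> bounded_rv h ->
  Ex P0 (fun w => g S (X w) * h (X w)) = Ex P0 (fun w => (Y w \in S)%:R * h (X w)).
Proof.
move=> mS bh; have := regression_orthogonal mS bh.
have bhX : bounded_rv (fun w => h (X w)).
  case: bh => mh [M hM]; split; last by exists M.
  exact: (measurableT_comp mh (measurable_funPT X)).
have := bounded_rvM (bounded_memY mS) bhX.
have := bounded_rvM (bounded_regression mS) bhX => b1 b2.
rewrite (eq_Ex _ (g := fun w => (Y w \in S)%:R * h (X w) - g S (X w) * h (X w))).
  by rewrite ExB// => /eqP; rewrite subr_eq0 => /eqP.
by move=> w; rewrite mulrBl.
Qed.

Lemma mass01 S : measurable S -> 0 <= mass S <= 1.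
Proof.
move=> mS; apply/andP; split; first exact: Ex_ge0.
by apply: Ex_le_cst => [|w]; [exact: bounded_memY|rewrite (ler_nat _ _ 1) leq_b1].
Qed.

Lemma mem_le (S S' : set R) z : S `<=` S' -> (z \in S)%:R <= (z \in S')%:R :> R.
Proof.
move=> SS'; have [zS|_] := boolP (z \in S); last by [].
by rewrite (mem_set (SS' _ (set_mem zS))).
Qed.

Lemma mass_mono S S' : measurable S -> measurable S' -> S `<=` S' ->
  mass S <= mass S'.
Proof. by move=> mS mS' SS'; apply: le_Ex => [||w]; [exact: bounded_memY..|exact: mem_le]. Qed.

Lemma Ex_regression S : measurable S -> Ex P0 (fun w => g S (X w)) = mass S.
Proof.
move=> mS; have := Ex_regression_mul mS (bounded_rv_cst (R := R) 1).
by under eq_Ex do rewrite mulr1; under [RHS]eq_Ex do rewrite mulr1.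
Qed.

(* Everything follows from E[g_S h] = E[1_S h], without comparing versions of
   the conditional probabilities: for S included in S',
   E[g_S^2] = E[1_S g_S] <= E[1_S' g_S] = E[1_S g_S'] <= E[1_S' g_S'] = E[g_S'^2],
   and each inequality loses at most P(S') - P(S). *)
Lemma regr_sq_mono S S' : measurable S -> measurable S' -> S `<=` S' ->
  regr_sq S <= regr_sq S' <= regr_sq S + 2 * (mass S' - mass S).
Proof.
move=> mS mS' SS'.
have bS : bounded_rv (g S).
  by split; [exact: mg|exists 1 => x; have /andP[? ?] := g01 mS x; rewrite ger0_norm].
have bS' : bounded_rv (g S').
  by split; [exact: mg|exists 1 => x; have /andP[? ?] := g01 mS' x; rewrite ger0_norm].
have e1 : regr_sq S = Ex P0 (fun w => (Y w \in S)%:R * g S (X w)).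
  by rewrite -Ex_regression_mul//; apply: eq_Ex => w; rewrite expr2.
have e2 : regr_sq S' = Ex P0 (fun w => (Y w \in S')%:R * g S' (X w)).
  by rewrite -Ex_regression_mul//; apply: eq_Ex => w; rewrite expr2.
have e3 : Ex P0 (fun w => (Y w \in S')%:R * g S (X w)) =
          Ex P0 (fun w => (Y w \in S)%:R * g S' (X w)).
  rewrite -Ex_regression_mul// -Ex_regression_mul//.
  by apply: eq_Ex => w; rewrite mulrC.
have bound (h : d.-tuple R -> R) : (forall x, 0 <= h x <= 1) ->
    bounded_rv (fun w => h (X w)) ->
    Ex P0 (fun w => (Y w \in S)%:R * h (X w)) <=
    Ex P0 (fun w => (Y w \in S')%:R * h (X w)) <=
    Ex P0 (fun w => (Y w \in S)%:R * h (X w)) + (mass S' - mass S).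
  move=> h01 bh; have b1 := bounded_rvM (bounded_memY mS) bh.
  have b2 := bounded_rvM (bounded_memY mS') bh.
  have b3 := bounded_rvB (bounded_memY mS') (bounded_memY mS).
  apply/andP; split.
    apply: le_Ex => // w; apply: ler_wpM2r; last exact: mem_le.
    by have /andP[] := h01 (X w).
  rewrite /mass -ExB; [|exact: bounded_memY..].
  rewrite -ExD//; apply: le_Ex => //; first exact: bounded_rvD.
  move=> w; rewrite -lerBlDl -mulrBl ler_piMr//; last by have /andP[] := h01 (X w).
  by rewrite subr_ge0 mem_le.
have /andP[h1 h2] := bound _ (g01 mS) (bounded_regression mS).
have /andP[h3 h4] := bound _ (g01 mS') (bounded_regression mS').
by rewrite e1 e2; apply/andP; split; lra.
Qed.

Lemma measurable_halfline y : measurable (halfline y).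
Proof. by apply: measurable_upset => a b /=; exact: le_trans. Qed.

Lemma halfline_sub y z : y <= z -> halfline z `<=` halfline y.
Proof. by move=> yz a /=; exact: le_trans. Qed.

Lemma measurable_mass_halfline : measurable_fun setT (fun y => mass (halfline y)).
Proof.
apply: nonincreasing_measurable => // y z yz.
by apply: mass_mono; [exact: measurable_halfline..|exact: halfline_sub].
Qed.

Lemma measurable_regr_sq_halfline :
  measurable_fun setT (fun y => regr_sq (halfline y)).
Proof.
apply: nonincreasing_measurable => // y z yz.
have /andP[] // := regr_sq_mono (measurable_halfline z) (measurable_halfline y)
  (halfline_sub yz).
Qed.

Lemma regr_sq01 S : measurable S -> 0 <= regr_sq S <= 1.
Proof.
move=> mS; apply/andP; split; first by apply: Ex_ge0 => w; exact: sqr_ge0.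
apply: Ex_le_cst => [|w]; first by apply: bounded_rvX; exact: bounded_regression.
by have /andP[h0 h1] := g01 mS (X w); rewrite expr_le1.
Qed.

(** Connects the functions g, characterised by orthogonality, with the conditional expectations in
    the definition of [xi]. *)
Lemma regression_is_cond_exp S : measurable S ->
  is_cond_exp P0 X (\1_[set w | S (Y w)] : T0 -> R) (fun w => g S (X w)).
Proof.
move=> mS; split.
- apply: (measurableT_comp (mg mS)) => _ B mB.
  by rewrite setTI; exists B => //; rewrite setTI.
- by apply: bounded_rv_integrable; exact: bounded_regression.
- move=> _ [B mB <-]; rewrite setTI.
  have mXB : measurable (X @^-1` B).
    by rewrite -[X in measurable X]setTI; exact: (measurable_funPT X).
  have iE w : (\1_[set w | S (Y w)] w : R) = (Y w \in S)%:R.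
    by rewrite indicE; congr ((nat_of_bool _)%:R); apply/idP/idP; rewrite !in_setE.
  under [RHS]eq_integral do rewrite iE.
  rewrite -!Ex_mul_mem//; [|exact: bounded_memY|exact: bounded_regression].
  congr EFin; have bB : @bounded_rv R _ (d.-tuple R) (fun x => (x \in B)%:R).
    exact: bounded_rv_mem.
  by have := Ex_regression_mul mS bB; rewrite /in_mem/= => ->.
Qed.

Let ind y : T0 -> R := \1_[set w | y <= Y w].

Lemma variance_cond_exp_ind y :
  'V_P0[cond_exp P0 X (ind y)] = (regr_sq (halfline y) - mass (halfline y) ^+ 2)%:E.
Proof.
have mH := measurable_halfline y.
rewrite (variance_cond_exp (regression_is_cond_exp mH)); last exact: bounded_regression.
by rewrite Ex_regression.
Qed.

Lemma variance_ind y :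
  'V_P0[ind y] = (mass (halfline y) - mass (halfline y) ^+ 2)%:E.
Proof.
have iE : ind y = fun w => (Y w \in halfline y)%:R.
  by apply/funext => w; rewrite /ind indicE.
rewrite iE variance_bounded; last exact: (bounded_memY (measurable_halfline y)).
congr (EFin (_ - _)); apply: eq_Ex => w.
by case: (_ \in _); rewrite ?expr1n// expr0n.
Qed.

Lemma integral_law (f : R -> R) : bounded_rv f ->
  (\int[distribution P0 Y]_y (f y)%:E = (Ex P0 (fun w => f (Y w)))%:E)%E.
Proof.
move=> [mf [M fM]].
have bfY : bounded_rv (fun w => f (Y w)).
  split; last by exists M.
  exact: (measurableT_comp mf (measurable_funPT Y)).
rewrite -EFin_Ex// integral_distribution//; first exact/measurable_EFinP.
exact: bounded_rv_integrable bfY.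
Qed.

Lemma bounded_mass_halfline : bounded_rv (fun y => mass (halfline y)).
Proof.
split; first exact: measurable_mass_halfline.
by exists 1 => y; have /andP[? ?] := mass01 (measurable_halfline y); rewrite ger0_norm.
Qed.

Lemma bounded_regr_sq_halfline : bounded_rv (fun y => regr_sq (halfline y)).
Proof.
split; first exact: measurable_regr_sq_halfline.
by exists 1 => y; have /andP[? ?] := regr_sq01 (measurable_halfline y); rewrite ger0_norm.
Qed.

Lemma bounded_comp_Y (f : R -> R) : bounded_rv f -> bounded_rv (fun w => f (Y w)).
Proof.
move=> [mf [M fM]]; split; last by exists M.
exact: (measurableT_comp mf (measurable_funPT Y)).
Qed.

Definition lim_pair := Ex P0 (fun w => regr_sq (halfline (Y w))).
Definition lim_mass := Ex P0 (fun w => mass (halfline (Y w))).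
Definition lim_mass_sq := Ex P0 (fun w => mass (halfline (Y w)) ^+ 2).

Lemma xiE : xi X Y = (lim_pair - lim_mass_sq) / (lim_mass - lim_mass_sq).
Proof.
have bm := bounded_mass_halfline; have br := bounded_regr_sq_halfline.
have bm2 : bounded_rv (fun y => mass (halfline y) ^+ 2) by exact: bounded_rvX.
have bmY := bounded_comp_Y bm; have brY := bounded_comp_Y br.
have bm2Y := bounded_comp_Y bm2.
rewrite /xi; congr (_ / _).
  under eq_integral do rewrite variance_cond_exp_ind.
  by rewrite integral_law/= ?ExB//; exact: bounded_rvB.
under eq_integral do rewrite variance_ind.
by rewrite integral_law/= ?ExB//; exact: bounded_rvB.
Qed.

End Limit.

(** * Positivity of the limiting denominator *)

Section Denominator.
Context {R : realType} {dT0 : measure_display} {T0 : measurableType dT0}.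
Variables (P0 : probability T0 R) (Y : {RV P0 >-> R}).

Let G (y : R) := mass Y (halfline y).
Let bc := bounded_rv_cst (R := R) (T := T0).

Let mY : measurable_fun setT Y. Proof. exact: measurable_funPT. Qed.

Let GE y : G y = Ex P0 (fun w => (y <= Y w)%R%:R).
Proof. by apply: eq_Ex => w; rewrite mem_setE. Qed.

Let G01 y : 0 <= G y <= 1.
Proof. by apply: mass01; exact: measurable_halfline. Qed.

Let G_mono y z : y <= z -> G z <= G y.
Proof.
move=> yz; apply: mass_mono; [exact: measurable_halfline..|exact: halfline_sub].
Qed.

Lemma ae_of_mass1 (S : set R) : measurable S -> mass Y S = 1 ->
  {ae P0, forall w, S (Y w)}.
Proof.
move=> mS S1; have mYS : measurable (Y @^-1` S).
  by rewrite -[X in measurable X]setTI; exact: mY.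
exists (~` (Y @^-1` S)); split; [exact: measurableC| |by []].
rewrite probability_setC// (_ : P0 _ = 1%:E) ?subee//.
rewrite -S1 /mass Ex_bool; last exact: (measurableT_comp (measurable_mem mS) mY).
by congr (P0 _); apply/seteqP; split => w /= => [/mem_set|/set_mem].
Qed.

(** [A] is null, since G vanishes on it, and [B] has full mass. Two points y < z of [B] minus [A]
    cannot coexist: P(Y >= z) = 1 would give P(Y > y) = 1. So this set of full mass is a
    singleton. *)
Lemma ae_constant : (forall y, G y = 0 \/ G y = 1) ->
  exists c, {ae P0, forall w, Y w = c}.
Proof.
move=> G0or1.
pose A := [set y | G y < 1].
pose B := [set y | Ex P0 (fun w => (y < Y w)%R%:R) < 1].
have bl y : bounded_rv (fun w => (y < Y w)%R%:R : R).
  by apply: bounded_rv_bool; exact: measurable_fun_ltr.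
have uA : upset A by move=> y z /= Gy yz; apply: le_lt_trans Gy; exact: G_mono.
have uB : upset B.
  move=> y z /= Gy yz; apply: le_lt_trans Gy; apply: le_Ex => // w.
  by rewrite ler_nat; case: (ltP z) => // zY; rewrite (le_lt_trans yz zY).
have mA := measurable_upset uA; have mB := measurable_upset uB.
have A0 : mass Y A <= 0.
  apply: Ex_upset_le => // z Az; rewrite -GE.
  by case: (G0or1 z) => Gz; rewrite Gz//; move: Az; rewrite /A/= Gz ltxx.
have B1 : 1 <= mass Y B.
  by apply: Ex_upset_ge => // z /negP; rewrite -leNgt.
pose C := B `\` A.
have mC : measurable C by exact: measurableD.
have C1 : mass Y C = 1.
  apply/eqP; rewrite eq_le; have /andP[_ ->] := mass01 Y mC.
  rewrite /=; apply: (@le_trans _ _ (mass Y B - mass Y A)); first by rewrite -[leLHS]subr0; exact: lerB.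
  have b1 := bounded_memY Y mA; have b2 := bounded_memY Y mB.
  rewrite /mass -ExB//; apply: le_Ex => //.
  - exact: bounded_rvB.
  - exact: bounded_memY.
  move=> w; rewrite /C in_setD.
  by case: (_ \in A); case: (_ \in B); rewrite /= ?subrr ?subr0 ?sub0r// oppr_le0.
have C_le y z : C y -> C z -> z <= y.
  move=> [By _] [_ nAz]; rewrite leNgt; apply/negP => yz.
  have : 1 <= Ex P0 (fun w => (y < Y w)%R%:R).
    apply: (@le_trans _ _ (G z)); first by rewrite leNgt; apply/negP.
    rewrite GE; apply: le_Ex => //; first exact: bounded_rv_ler.
    move=> w; rewrite ler_nat; case: (leP z) => // zY.
    by rewrite (lt_le_trans yz zY).
  by rewrite leNgt => /negP; apply.
have [[c Cc]|C0] := pselect (exists c, C c); last first.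
  have : mass Y C = 0.
    rewrite /mass (_ : (fun w => _) = fun=> 0) ?Ex_cst//; apply/funext => w.
    by rewrite memNset// => CY; apply: C0; exists (Y w).
  by rewrite C1 => /eqP; rewrite oner_eq0.
exists c; apply: filterS (ae_of_mass1 mC C1) => w CY.
by apply/eqP; rewrite eq_le !C_le.
Qed.

(** The quantity is E[G(Y)(1 - G(Y))]. If 0 < a = G(c) < 1, then on the event Y >= c with G(Y) >=
    a/2 the integrand is at least (1 - a) a/2, and the event has probability at least a - a/2. *)
Lemma denominator_gt0 : (~ exists c, {ae P0, forall w, Y w = c}) ->
  0 < lim_mass Y - lim_mass_sq Y.
Proof.
move=> nc; have [c [c0 c1]] : exists c, 0 < G c /\ G c < 1.
  apply: contrapT => h; apply: nc; apply: ae_constant => y.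
  have /andP[y0 y1] := G01 y; have [e|y0'] := eqVneq (G y) 0; first by left.
  have [e|y1'] := eqVneq (G y) 1; first by right.
  by case: h; exists y; rewrite !lt_neqAle y0 y1 y1' eq_sym y0'.
set a := G c in c0 c1.
pose A := [set y | G y < a / 2].
have uA : upset A by move=> y z /= Gy yz; apply: le_lt_trans Gy; exact: G_mono.
have mA := measurable_upset uA.
have A0 : mass Y A <= a / 2.
  by apply: Ex_upset_le => //; [rewrite divr_ge0// ltW|move=> z /ltW; rewrite -GE].
have bA := bounded_memY Y mA; have bh := bounded_memY Y (measurable_halfline c).
have bG := bounded_comp_Y Y (bounded_mass_halfline Y).
rewrite /lim_mass /lim_mass_sq -ExB//; last exact: bounded_rvX.
apply: (@lt_le_trans _ _ ((1 - a) * (a / 2) * (a / 2))).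
  by rewrite !mulr_gt0 ?divr_gt0// subr_gt0.
apply: (@le_trans _ _ ((1 - a) * (a / 2) * (a - mass Y A))).
  apply: ler_wpM2l; first by rewrite mulr_ge0 ?divr_ge0 ?subr_ge0 ?ltW.
  by rewrite [X in _ <= X - _](splitr a); lra.
have -> : a - mass Y A = Ex P0 (fun w => (Y w \in halfline c)%:R - (Y w \in A)%:R).
  by rewrite ExB.
rewrite -ExZ; last exact: bounded_rvB.
apply: le_Ex.
- by apply: bounded_rvM; [exact: bc|exact: bounded_rvB].
- by apply: bounded_rvB => //; exact: bounded_rvX.
move=> w; rewrite -/(mass Y _) -/(G _); set y := Y w.
have /andP[y0 y1] := G01 y.
have -> : (y \in halfline c) = (c <= y) by rewrite mem_setE.
have [cy|cy] := leP c y; last first.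
  rewrite sub0r; apply: (@le_trans _ _ 0); last nra.
  by rewrite mulrN oppr_le0 !mulr_ge0// ?divr_ge0 ?subr_ge0 ?ltW.
have Gya := G_mono cy; rewrite -/a in Gya.
have [Ay|/negP nAy] := boolP (y \in A); first by rewrite subrr mulr0; nra.
have : a / 2 <= G y by rewrite leNgt; apply/negP => h; apply: nAy; rewrite inE.
rewrite subr0 mulr1 => h.
have -> : G y - G y ^+ 2 = (1 - G y) * G y by ring.
apply: ler_pM => //; [by rewrite subr_ge0 ltW|by rewrite divr_ge0// ltW|lra].
Qed.

End Denominator.

(** * Consistency *)

Section Consistency.
Context {R : realType} {d : nat}.
Context {dT0 : measure_display} {T0 : measurableType dT0} (P0 : probability T0 R).
Variables (X : {RV P0 >-> d.-tuple R}) (Y : {RV P0 >-> R}).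
Context {dT : measure_display} {T : measurableType dT} (P : probability T R).
Variables (Xs : nat -> {RV P >-> d.-tuple R}) (Ys U : nat -> {RV P >-> R}).
Hypothesis hcopies : forall (k : nat) (B : set (d.-tuple R * R)), measurable B ->
  P [set w | B (Xs k w, Ys k w)] = P0 [set w | B (X w, Y w)].
Hypothesis hunif : forall (k : nat) (B : set R), measurable B ->
  distribution P (U k) B = uniform_prob (@ltr01 R) B.
Hypothesis hindep : mutually_independent P (fun a : nat + nat =>
  match a with
  | inl k => g_sigma_algebra_preimage (fun w => (Xs k w, Ys k w))
  | inr k => g_sigma_algebra_preimage (U k)
  end).

Let mY k : measurable_fun setT (Ys k). Proof. exact: measurable_funPT. Qed.
Let bcst := bounded_rv_cst (R := R) (T := T).

Lemma bounded_snd (f : R -> R) : bounded_rv f ->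
  @bounded_rv R _ (d.-tuple R * R)%type (fun p => f p.2).
Proof.
move=> [mf [M fM]]; split; last by exists M.
exact: (measurableT_comp mf measurable_snd).
Qed.

(** * From fixed sets to the random thresholds *)

Section Uniformization.
Variables (Hn : nat -> set R -> T -> R) (H : set R -> R) (c : R).
Hypothesis c0 : 0 <= c.
Hypothesis Hn_mono : forall n S S' w, S `<=` S' -> Hn n S w <= Hn n S' w.
Hypothesis H_mono : forall S S', measurable S -> measurable S' -> S `<=` S' ->
  H S <= H S' <= H S + c * (mass Y S' - mass Y S).
Hypothesis bHn : forall n S, (1 < n)%N -> measurable S -> bounded_rv (Hn n S).
Hypothesis bHY : forall n k, (1 < n)%N ->
  bounded_rv (fun w => Hn n (halfline (Ys k w)) w).
Hypothesis bH : bounded_rv (fun y => H (halfline y)).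
Hypothesis cvgH : forall S, measurable S ->
  vanishing (fun n => Ex P (fun w => `|Hn n S w - H S|)).

(** A Glivenko-Cantelli argument: monotonicity squeezes every half-line between two brackets,
    between which H moves by at most c e. The bound [b] sums the errors over all brackets and so
    does not depend on y, which may then be random. *)
Lemma uniform_halfline (e : R) : 0 < e ->
  exists b : nat -> T -> R, [/\ forall n, (1 < n)%N -> bounded_rv (b n),
    vanishing (fun n => Ex P (b n)) &
    forall n w y, `|Hn n (halfline y) w - H (halfline y)| <= b n w + c * e].
Proof.
move=> e0; have [m [S [mS brk]]] := upset_brackets P0 (measurable_funPT Y) e0.
exists (fun n w => \sum_(l < m) `|Hn n (S l) w - H (S l)|).
have bS n l : (1 < n)%N -> bounded_rv (fun w => `|Hn n (S l) w - H (S l)|).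
  by move=> n1; apply: bounded_rv_norm; apply: bounded_rvB => //; exact: bHn.
split.
- by move=> n n1; apply: bounded_rv_sum => l _; exact: bS.
- apply: (vanishing_le (k := 2%N) (b := fun n =>
    \sum_(l < m) Ex P (fun w => `|Hn n (S l) w - H (S l)|))).
    by move=> n n1; rewrite Ex_sum// => l _; exact: bS.
  by apply: vanishing_sum => l; exact: cvgH.
move=> n w y; have [l [l' [lm l'm Sl Sl' mass_le]]] := brk y.
have mI := measurable_halfline y.
have /andP[h1 h2] := H_mono (mS l) mI Sl.
have /andP[h3 h4] := H_mono mI (mS l') Sl'.
have p1 := mass_mono Y (mS l) mI Sl.
have p2 := mass_mono Y mI (mS l') Sl'.
have term k : (k < m)%N -> `|Hn n (S k) w - H (S k)| <=
    \sum_(j < m) `|Hn n (S j) w - H (S j)|.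
  by move=> km; rewrite (bigD1 (Ordinal km))//= lerDl sumr_ge0.
have := term l lm; have := term l' l'm; set b := \sum_(_ < _) _.
rewrite !ler_norml => /andP[_ t'] /andP[t _].
have q1 := Hn_mono n w Sl; have q2 := Hn_mono n w Sl'.
have ce1 : c * (mass Y (halfline y) - mass Y (S l)) <= c * e.
  by apply: ler_wpM2l => //; rewrite lerBlDl (le_trans p2).
have ce2 : c * (mass Y (S l') - mass Y (halfline y)) <= c * e.
  by apply: ler_wpM2l => //; rewrite lerBlDl (le_trans mass_le)// lerD2r.
by apply/andP; split; lra.
Qed.

Lemma mean_halfline_cvg : vanishing (fun n => Ex P (fun w =>
  `|n%:R^-1 * \sum_(k < n) Hn n (halfline (Ys k w)) w
    - Ex P0 (fun w => H (halfline (Y w)))|)).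
Proof.
set L := Ex P0 _; apply: (vanishing_approx (c := c)) => // e e0.
have [b [bb vb b_le]] := uniform_halfline e0.
have bf := bounded_snd bH.
exists 2%N, (fun n => Ex P (b n) + Ex P (fun w =>
   `|n%:R^-1 * \sum_(i < n) H (halfline (Ys i w)) - L|)); split.
  by apply: vanishingD => //; exact: (lln hcopies hindep bf).
move=> n n1; have n0 : 0 < n%:R :> R by rewrite ltr0n ltnW.
have bHY' k : bounded_rv (fun w => H (halfline (Ys k w))).
  case: bH => mH [M HM]; split; last by exists M.
  exact: (measurableT_comp mH (mY k)).
have b1 : bounded_rv (fun w => `|n%:R^-1 * \sum_(i < n) H (halfline (Ys i w)) - L|).
  apply: bounded_rv_norm; apply: bounded_rvB => //; apply: bounded_rvM => //.
  exact: bounded_rv_sum.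
have b2 := bb n n1.
rewrite -ExD// -[X in _ <= _ + X](Ex_cst P) -ExD//; last exact: bounded_rvD.
apply: le_Ex.
- apply: bounded_rv_norm; apply: bounded_rvB => //; apply: bounded_rvM => //.
  by apply: bounded_rv_sum => k _; exact: bHY.
- by apply: bounded_rvD => //; exact: bounded_rvD.
move=> w; set s := \sum_(i < n) H _; set t := \sum_(k < n) Hn _ _ _.
have -> : n%:R^-1 * t - L = n%:R^-1 * (t - s) + (n%:R^-1 * s - L) by ring.
apply: le_trans (ler_normD _ _) _.
rewrite addrAC lerD2r normrM gtr0_norm ?invr_gt0// ler_pdivrMl//.
rewrite /t /s -sumrB; apply: le_trans (ler_norm_sum _ _ _) _.
rewrite mulr_natl -[X in _ <= _ *+ X]card_ord -sumr_const.
by apply: ler_sum => k _; exact: b_le.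
Qed.

End Uniformization.

Definition sample_mass n (S : set R) w : R := n%:R^-1 * \sum_(i < n) (Ys i w \in S)%:R.

Lemma bounded_memYs k (S : set R) : measurable S ->
  bounded_rv (fun w => (Ys k w \in S)%:R : R).
Proof. by move=> mS; apply: bounded_rv_upset. Qed.

Lemma bounded_sample_mass n S : measurable S -> bounded_rv (sample_mass n S).
Proof.
move=> mS; apply: bounded_rvM => //; apply: bounded_rv_sum => i _.
exact: bounded_memYs.
Qed.

Lemma sample_mass01 n S w : 0 <= sample_mass n S w <= 1.
Proof. exact: mean_bool01. Qed.

Lemma sample_mass_cvg S : measurable S ->
  vanishing (fun n => Ex P (fun w => `|sample_mass n S w - mass Y S|)).
Proof.
move=> mS; have bf : @bounded_rv R _ (d.-tuple R * R)%type (fun p => (p.2 \in S)%:R).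
  apply: bounded_rv_bool; exact: (measurableT_comp (measurable_mem mS) measurable_snd).
exact: (lln hcopies hindep bf).
Qed.

Lemma sample_mass_mono n S S' w : S `<=` S' -> sample_mass n S w <= sample_mass n S' w.
Proof.
move=> SS'; rewrite ler_wpM2l ?invr_ge0//; apply: ler_sum => i _; exact: mem_le.
Qed.

Lemma halflineE (y z : R) : (z \in halfline y) = (y <= z).
Proof. by rewrite mem_setE. Qed.

Lemma bounded_sample_mass_halfline n k :
  bounded_rv (fun w => sample_mass n (halfline (Ys k w)) w).
Proof.
apply: bounded_rvM => //; apply: bounded_rv_sum => i _.
by under eq_fun do rewrite halflineE; exact: bounded_rv_ler.
Qed.

Lemma mean_mass_cvg : vanishing (fun n => Ex P (fun w =>
  `|n%:R^-1 * \sum_(k < n) sample_mass n (halfline (Ys k w)) w - lim_mass Y|)).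
Proof.
apply: (mean_halfline_cvg (c := 1)) => //.
- exact: sample_mass_mono.
- move=> S S' mS mS' SS'; rewrite mul1r addrC subrK lexx andbT.
  exact: mass_mono.
- by move=> n S _; exact: bounded_sample_mass.
- by move=> n k _; exact: bounded_sample_mass_halfline.
- exact: bounded_mass_halfline.
- exact: sample_mass_cvg.
Qed.

Lemma mean_mass_sq_cvg : vanishing (fun n => Ex P (fun w =>
  `|n%:R^-1 * \sum_(k < n) sample_mass n (halfline (Ys k w)) w ^+ 2 - lim_mass_sq Y|)).
Proof.
(* The constant 2 is the Lipschitz constant of the square on [0, 1]. *)
apply: (mean_halfline_cvg (Hn := fun n S w => sample_mass n S w ^+ 2)
  (H := fun S => mass Y S ^+ 2) (c := 2)) => //.
- move=> n S S' w SS'; have /andP[h0 _] := sample_mass01 n S w.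
  have /andP[h0' _] := sample_mass01 n S' w.
  by rewrite ler_pXn2r ?nnegrE// sample_mass_mono.
- move=> S S' mS mS' SS'; have h := mass_mono Y mS mS' SS'.
  have /andP[a0 a1] := mass01 Y mS; have /andP[b0 b1] := mass01 Y mS'.
  by apply/andP; split; nra.
- by move=> n S _ mS; apply: bounded_rvX; exact: bounded_sample_mass.
- by move=> n k _; apply: bounded_rvX; exact: bounded_sample_mass_halfline.
- by apply: bounded_rvX; exact: bounded_mass_halfline.
- move=> S mS; have := vanishingZ (ler0n _ 2) (sample_mass_cvg mS).
  apply: (vanishing_le (k := 0%N)) => n _.
  have bs := bounded_sample_mass n mS.
  have b1 : bounded_rv (fun w => `|sample_mass n S w - mass Y S|).
    by apply: bounded_rv_norm; exact: bounded_rvB.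
  rewrite -ExZ//; apply: le_Ex.
  + by apply: bounded_rv_norm; apply: bounded_rvB => //; exact: bounded_rvX.
  + exact: bounded_rvM.
  move=> w; have /andP[a0 a1] := mass01 Y mS.
  have /andP[b0 b1'] := sample_mass01 n S w.
  rewrite subr_sqr normrM mulrC ler_wpM2r//.
  by rewrite ger0_norm ?addr_ge0// (_ : 2 = 1 + 1) ?lerD//; ring.
Qed.

Section Regressions.
Variable g : set R -> d.-tuple R -> R.
Hypothesis mg : forall S, measurable S -> measurable_fun setT (g S).
Hypothesis g01 : forall S, measurable S -> forall x, 0 <= g S x <= 1.
Hypothesis gS : forall S, measurable S -> forall A, measurable A ->
  Ex P0 (fun w => ((Y w \in S)%:R - g S (X w)) * (X w \in A)%:R) = 0.

Lemma bounded_pair_mean_halfline n k : (1 < n)%N ->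
  bounded_rv (fun w => pair_mean Xs Ys U (halfline (Ys k w)) n w).
Proof.
move=> n1; apply: bounded_rvM => //; apply: bounded_rv_sum => i _.
apply: (@bounded_at_neighbour _ _ _ _ P Xs U n i
  (fun l w => (Ys i w \in halfline (Ys k w))%:R * (Ys l w \in halfline (Ys k w))%:R)) => // l.
by apply: bounded_rvM; under eq_fun do rewrite halflineE; exact: bounded_rv_ler.
Qed.

Lemma mean_pair_cvg : vanishing (fun n => Ex P (fun w =>
  `|n%:R^-1 * \sum_(k < n) pair_mean Xs Ys U (halfline (Ys k w)) n w
    - lim_pair X Y g|)).
Proof.
apply: (mean_halfline_cvg (Hn := fun n S w => pair_mean Xs Ys U S n w)
  (H := regr_sq X g) (c := 2)) => //.
- move=> n S S' w SS'; rewrite ler_wpM2l ?invr_ge0//; apply: ler_sum => i _.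
  by apply: ler_pM => //; exact: mem_le.
- by move=> S S' mS mS' SS'; exact: (regr_sq_mono mg g01 gS).
- by move=> n S n1 mS; exact: bounded_pair_mean.
- by move=> n k n1; exact: bounded_pair_mean_halfline.
- exact: (bounded_regr_sq_halfline mg g01 gS).
- move=> S mS; exact: (pair_mean_cvg hcopies hunif hindep mS (mg mS) (g01 mS) (gS mS)).
Qed.

End Regressions.

Definition mean_pair n w : R :=
  n%:R^-1 * \sum_(k < n) pair_mean Xs Ys U (halfline (Ys k w)) n w.
Definition mean_mass n w : R :=
  n%:R^-1 * \sum_(k < n) sample_mass n (halfline (Ys k w)) w.
Definition mean_mass_sq n w : R :=
  n%:R^-1 * \sum_(k < n) sample_mass n (halfline (Ys k w)) w ^+ 2.

Let stat n w : R := xi_stat (fun k : 'I_n => Xs k w) (fun k : 'I_n => Ys k w)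
                            (fun k : 'I_n => U k w).

(** The half-lines below y_i and y_k are nested, so the smaller count is that of their
    intersection. *)
Lemma min_ecdf n (y : 'I_n -> R) (i k : 'I_n) :
  Num.min (ecdf y (y i)) (ecdf y (y k)) =
  n%:R^-1 * \sum_l (y l <= y i)%R%:R * (y l <= y k)%R%:R.
Proof.
wlog ik : i k / y i <= y k => [h|].
  have [|/ltW ki] := leP (y i) (y k); first exact: h.
  by rewrite minC h//; congr (_ * _); apply: eq_bigr => l _; rewrite mulrC.
rewrite min_l; last first.
  rewrite ler_wpM2l ?invr_ge0//; apply: ler_sum => l _; rewrite ler_nat.
  by case: (leP (y l) (y i)) => // li; rewrite (le_trans li ik).
congr (_ * _); apply: eq_bigr => l _.
case: (leP (y l) (y i)) => li; last by rewrite mul0r.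
by rewrite (le_trans li ik) mulr1.
Qed.

(** After [min_ecdf], exchanging the sums makes l the threshold and i the averaged index. The factor
    1/n put in front of numerator and denominator cancels, which uses n > 0. *)
Lemma xi_statE n w : (0 < n)%N ->
  stat n w = (mean_pair n w - mean_mass_sq n w) / (mean_mass n w - mean_mass_sq n w).
Proof.
move=> n0; have nn0 : n%:R^-1 != 0 :> R by rewrite invr_eq0 pnatr_eq0 -lt0n.
have esurvE (i : 'I_n) : esurv (fun k : 'I_n => Ys k w) (Ys i w) =
    sample_mass n (halfline (Ys i w)) w.
  by congr (_ * _); apply: eq_bigr => k _; rewrite halflineE.
rewrite /stat /xi_stat /mean_pair /mean_mass /mean_mass_sq -!mulrBr -mulf_div mulfV// mul1r.
congr (_ / _); last first.
  by rewrite -sumrB; apply: eq_bigr => i _; rewrite esurvE; ring.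
rewrite sumrB; congr (_ - _); last by apply: eq_bigr => i _; rewrite esurvE.
under eq_bigr do rewrite min_ecdf.
rewrite -mulr_sumr exchange_big/= mulr_sumr; apply: eq_bigr => k _.
by congr (_ * _); apply: eq_bigr => i _; rewrite !halflineE.
Qed.

Hypothesis nondegenerate : ~ exists c, {ae P0, forall w, Y w = c}.

(** Shaped for Markov's inequality: the probability that the quotient deviates is bounded by K times
    an L^1 error. The case B = 0 is included, being far from be. *)
Lemma ratio_deviation (al be eps : R) : 0 < be -> 0 < eps ->
  exists K, 0 <= K /\ forall A B, eps < `|A / B - al / be| ->
    1 <= K * (`|A - al| + `|B - be|).
Proof.
move=> be0 eps0.
(* An error below the first entry keeps B > be / 2; below the second, the numerator of the
   difference of quotients is less than eps be^2 / 2, hence than eps B be. *)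
pose kappa := Num.min (be / 2) (eps * (be ^+ 2 / 2) / (be + `|al|)).
have ba : 0 < be + `|al| by rewrite ltr_wpDr.
have k0 : 0 < kappa.
  by rewrite lt_min !divr_gt0// mulr_gt0// divr_gt0// exprn_gt0.
exists kappa^-1; split; first by rewrite invr_ge0 ltW.
move=> A B; apply: contraTT; rewrite -ltNge -leNgt.
rewrite mulrC ltr_pdivrMr// mul1r lt_min => /andP[].
set dl := _ + _ => d1 d2.
have dA : `|A - al| <= dl by rewrite lerDl.
have dB : `|B - be| <= dl by rewrite lerDr.
have B2 : be / 2 < B by move: (le_lt_trans dB d1); rewrite ltr_norml => /andP[]; lra.
have B0 : 0 < B by rewrite (lt_trans _ B2)// divr_gt0.
have -> : A / B - al / be = ((A - al) * be - al * (B - be)) / (B * be).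
  by field; rewrite !gt_eqF.
rewrite normrM normfV (gtr0_norm (mulr_gt0 B0 be0)) ler_pdivrMr ?mulr_gt0//.
apply: (@le_trans _ _ (dl * (be + `|al|))).
  apply: le_trans (ler_normB _ _) _; rewrite !normrM (gtr0_norm be0) mulrDr.
  apply: lerD; first by rewrite ler_wpM2r// ltW.
  by rewrite mulrC ler_wpM2r.
apply: ltW; move: d2; rewrite ltr_pdivlMr// => /lt_le_trans; apply.
by rewrite ler_pM2l// expr2 mulrAC ler_pM2r// ltW.
Qed.

Lemma bounded_means n : (1 < n)%N ->
  [/\ bounded_rv (mean_pair n), bounded_rv (mean_mass n) & bounded_rv (mean_mass_sq n)].
Proof.
move=> n1; split; apply: bounded_rvM => //; apply: bounded_rv_sum => k _.
- exact: bounded_pair_mean_halfline.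
- exact: bounded_sample_mass_halfline.
- by apply: bounded_rvX; exact: bounded_sample_mass_halfline.
Qed.

(** Division by 0 gives 0, so the event B = 0 is treated apart; elsewhere the inequality is
    multiplied by |B|. *)
Lemma measurable_deviation (A B : T -> R) (c eps : R) : measurable_fun setT A ->
  measurable_fun setT B -> measurable_fun setT (fun w => eps < `|A w / B w - c|).
Proof.
move=> mA mB.
have -> : (fun w => eps < `|A w / B w - c|) = fun w =>
    (B w == 0) && (eps < `|c|) ||
    ~~ (B w == 0) && (eps * `|B w| < `|A w - c * B w|).
  apply/funext => w; have [->|B0] /= := eqVneq (B w) 0.
    by rewrite invr0 mulr0 sub0r normrN orbF.
  have -> : A w / B w - c = (A w - c * B w) / B w by field.
  by rewrite normrM normfV ltr_pdivlMr// normr_gt0.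
have mB0 : measurable_fun setT (fun w => B w == 0) by exact: measurable_fun_eqr.
apply: measurable_or; apply: measurable_and => //.
  exact: measurable_neg.
apply: measurable_fun_ltr.
  by apply: measurable_funM => //; exact: measurableT_comp.
apply: measurableT_comp => //; apply: measurable_funB => //.
exact: measurable_funM.
Qed.

Lemma xi_consistent : cvg_in_probability P (fun n w => stat n w) (xi X Y).
Proof.
(* One regression function is chosen for each set; sets that are not measurable get the value 0. *)
have /choice[g gP] : forall S : set R, exists g : d.-tuple R -> R, measurable S ->
    [/\ measurable_fun setT g, forall x, 0 <= g x <= 1 &
      forall A, measurable A ->
        Ex P0 (fun w => ((Y w \in S)%:R - g (X w)) * (X w \in A)%:R) = 0].
  move=> S; have [mS|nmS] := pselect (measurable S); last by exists (cst 0) => /nmS.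
  by have [g gP] := ex_regression X Y mS; exists g.
have mg S : measurable S -> measurable_fun setT (g S) by move=> /gP[].
have g01 S : measurable S -> forall x, 0 <= g S x <= 1 by move=> /gP[].
have gS S : measurable S -> forall A, measurable A ->
  Ex P0 (fun w => ((Y w \in S)%:R - g S (X w)) * (X w \in A)%:R) = 0 by move=> /gP[].
move=> eps eps0; rewrite (xiE mg g01 gS).
have den0 := denominator_gt0 nondegenerate.
set al := lim_pair X Y g - _; set be := lim_mass Y - _ in den0 *.
have [K [K0 devK]] := ratio_deviation al den0 eps0.
(* The squared masses enter both numerator and denominator, hence the factor 2. Where the statistic
   deviates by more than eps, [dev] is at least 1. *)
pose dev n w := K * (`|mean_pair n w - lim_pair X Y g| + `|mean_mass n w - lim_mass Y|
  + 2 * `|mean_mass_sq n w - lim_mass_sq Y|).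
have PE n : (1 < n)%N -> exists2 p : R, P [set w | eps < `|stat n w - al / be|] = p%:E &
    0 <= p <= Ex P (dev n).
  move=> n1; have [b1 b2 b3] := bounded_means n1.
  have mdev : measurable_fun setT (fun w => eps < `|stat n w - al / be|).
    under eq_fun do rewrite xi_statE ?(ltnW n1)//.
    by apply: measurable_deviation; [case: (bounded_rvB b1 b3)|case: (bounded_rvB b2 b3)].
  exists (Ex P (fun w => (eps < `|stat n w - al / be|)%R%:R)).
    by rewrite Ex_bool.
  rewrite Ex_ge0//=; apply: le_Ex.
  - exact: bounded_rv_bool.
  - apply: bounded_rvM => //; apply: bounded_rvD.
      by apply: bounded_rvD; apply: bounded_rv_norm; exact: bounded_rvB.
    by apply: bounded_rvM => //; apply: bounded_rv_norm; exact: bounded_rvB.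
  move=> w; case: ltP => h /=; last first.
    by rewrite mulr_ge0// !addr_ge0// mulr_ge0.
  rewrite xi_statE ?(ltnW n1)// in h; apply: le_trans (devK _ _ h) _.
  apply: ler_wpM2l => //.
  have -> : mean_pair n w - mean_mass_sq n w - al =
    (mean_pair n w - lim_pair X Y g) - (mean_mass_sq n w - lim_mass_sq Y).
    by rewrite /al; ring.
  have -> : mean_mass n w - mean_mass_sq n w - be =
    (mean_mass n w - lim_mass Y) - (mean_mass_sq n w - lim_mass_sq Y).
    by rewrite /be; ring.
  apply: le_trans (lerD (ler_normB _ _) (ler_normB _ _)) _.
  by rewrite addrACA lerD2l (_ : 2 = 1 + 1) ?mulrDl ?mul1r//; ring.
have vdev : vanishing (fun n => Ex P (dev n)).
  have := vanishingZ K0 (vanishingD (vanishingD (mean_pair_cvg mg g01 gS) mean_mass_cvg)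
    (vanishingZ (ler0n _ 2) mean_mass_sq_cvg)).
  apply: (vanishing_le (k := 2%N)) => n n1; have [b1 b2 b3] := bounded_means n1.
  have c1 := bounded_rv_norm (bounded_rvB b1 (bcst (lim_pair X Y g))).
  have c2 := bounded_rv_norm (bounded_rvB b2 (bcst (lim_mass Y))).
  have c3 := bounded_rv_norm (bounded_rvB b3 (bcst (lim_mass_sq Y))).
  rewrite /dev ExZ; last by apply: bounded_rvD; [exact: bounded_rvD|exact: bounded_rvM].
  rewrite ExD; [|exact: bounded_rvD|exact: bounded_rvM].
  by rewrite ExD// ExZ.
apply/fine_cvgP; split.
  by exists 2%N => // n /= n1; have [p ->] := PE n n1.
apply/cvgrPdist_le => e e0; have [m me] := vdev e e0.
exists (maxn 2 m) => // n /=; rewrite geq_max => /andP[n1 mn].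
have [p -> /andP[p0 pd]] := PE n n1.
by rewrite /= sub0r normrN ger0_norm// (le_trans pd)// me.
Qed.
End Consistency.

Theorem theorem3p1 (R : realType) (d : nat)
    (* the probability space of (X, Y) *)
    (dT0 : measure_display) (T0 : measurableType dT0) (P0 : probability T0 R)
    (X : {RV P0 >-> d.-tuple R}) (Y : {RV P0 >-> R})
    (* the probability space of the copies and of the tie-breaking draws *)
    (dT : measure_display) (T : measurableType dT) (P : probability T R)
    (Xs : nat -> {RV P >-> d.-tuple R}) (Ys : nat -> {RV P >-> R})
    (U : nat -> {RV P >-> R})
    (hcopies : forall (k : nat) (B : set (d.-tuple R * R)), measurable B ->
      P [set w | B (Xs k w, Ys k w)] = P0 [set w | B (X w, Y w)])
    (hunif : forall (k : nat) (B : set R), measurable B ->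
      distribution P (U k) B = uniform_prob (@ltr01 R) B)
    (hindep : mutually_independent P (fun a : nat + nat =>
      match a with
      | inl k => g_sigma_algebra_preimage (fun w => (Xs k w, Ys k w))
      | inr k => g_sigma_algebra_preimage (U k)
      end))
    (hY : ~ exists f : d.-tuple R -> R,
      measurable_fun [set: d.-tuple R] f /\ {ae P0, forall w, Y w = f (X w)}) :
  cvg_in_probability P
    (fun n w => xi_stat (fun k : 'I_n => Xs k w) (fun k : 'I_n => Ys k w)
                        (fun k : 'I_n => U k w))
    (xi X Y).
Proof.
(* A constant is a measurable function of X, so [hY] rules out an almost surely constant Y. *)
apply: (xi_consistent hcopies hunif hindep) => -[c Yc]; apply: hY.
by exists (cst c).
Qed.
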